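(* Let $0<p<2$, let $k_p:=\max\{k\in\mathbb Z^+: k<2/p\}$, and let $K_p(z)$ be the $p$-Bergman kernel of the punctured unit disc $\mathbb D^\ast=\{z\in\mathbb C:0<|z|<1\}$. Then $$K_p(z)=\frac{2-pk_p}{2\pi|z|^{pk_p}}+\frac{4-pk_p}{2\pi}|z|^{2-pk_p}+o\left(|z|^{2-pk_p}\right),\qquad z\to0.$$
   Context: For a bounded domain $\Omega\subset\mathbb C$ and $0<p<\infty$, $A^p(\Omega)=\{f\in\mathcal O(\Omega):\|f\|_p^p:=\int_\Omega|f|^p<\infty\}$ (Lebesgue measure) and the $p$-Bergman kernel of $\Omega$ is $K_p(z):=\bigl(\inf\{\|f\|_p: f\in A^p(\Omega),\ f(z)=1\}\bigr)^{-p}$. $\mathbb Z^+$ denotes the positive integers. *)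

(* Defs.v *)
From mathcomp Require Import all_boot all_order all_algebra.
From mathcomp Require Import all_classical all_reals all_analysis.
From mathcomp Require Export complex.

Set Implicit Arguments.
Unset Strict Implicit.
Unset Printing Implicit Defensive.

Import Order.TTheory GRing.Theory Num.Theory numFieldNormedType.Exports.

Local Open Scope classical_set_scope.
Local Open Scope ring_scope.

(* [R[i]] carries a norm with values in [R[i]] itself but no topology; its
   alias [(R[i])^o] is the one-dimensional normed module over the field
   [R[i]]. Hence [derivable f z 1], for f : (R[i])^o -> (R[i])^o, is complex
   differentiability at z, and [0^'] is the punctured neighbourhood filter. *)
Notation CC R := ((R[i])^o)%type.

(* The R-valued modulus (on R[i], the generic norm `|z| is R[i]-valued). *)
Notation cmod := ComplexField.Normc.normc.

Section BergmanKernel.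
Variable R : realType.
Implicit Types (Omega : set (CC R)) (p : R) (f : CC R -> CC R) (z : CC R).

(* Only meant for an open Omega: the values of f outside Omega are then
   irrelevant. *)
Definition holomorphic_on Omega f : Prop :=
  forall z, Omega z -> derivable f z 1.

(* The integral of |f|^p over Omega; the planar Lebesgue measure is the
   product measure on R * R, with (x, y) standing for x + iy. *)
Definition int_powp p Omega f : \bar R :=
  (\int[@lebesgue_measure R \x @lebesgue_measure R]_(xy in
      [set xy | Omega (Complex xy.1 xy.2)])
    (cmod (f (Complex xy.1 xy.2)) `^ p)%:E)%E.

Definition bergman_space p Omega : set (CC R -> CC R) :=
  [set f | holomorphic_on Omega f /\ (int_powp p Omega f < +oo)%E].

Definition bergman_norm p Omega f : R :=
  fine (int_powp p Omega f) `^ p^-1.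

(* For z in a bounded domain Omega the set below contains the norm of the
   constant 1 and is bounded below by 0, so that [inf] is its infimum. *)
Definition bergman_kernel p Omega z : R :=
  inf [set bergman_norm p Omega f |
        f in [set f | bergman_space p Omega f /\ f z = 1]] `^ (- p).

Definition punctured_disc : set (CC R) := [set z | 0 < cmod z < 1].

Definition is_max (A : set nat) (k : nat) : Prop :=
  A k /\ forall j, A j -> (j <= k)%N.

End BergmanKernel.

(* Main.v *)
Require Import Defs.
From mathcomp Require Import all_boot all_order all_algebra.
From mathcomp Require Import all_classical all_reals all_analysis.
From mathcomp Require Import measurable_realfun ring lra zify.
Import Order.TTheory GRing.Theory Num.Theory numFieldNormedType.Exports.
Local Open Scope classical_set_scope.
Local Open Scope ring_scope.

(** Let [a = p k]; the choice of [k] means [a < 2 <= a + p]. If [f] is p-integrable on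
    the punctured disc, then [w ^ k f] has a removable singularity at 0 ([pole_order]).
    For [f z = 1] the function [g w = (w / z) ^ k f w] is thus holomorphic on the disc
    with [g z = 1], and the p-th power of the norm of [f] is [|z| ^ a] times the energy
    of [g], the integral of [|w| ^ (- a) |g| ^ p] over the unit disc. Let [I0 = 2 pi /
    (2 - a)] and [I1 = 2 pi / (4 - a)] be the integrals of [|w| ^ (- a)] and [|w| ^ (2 -
    a)] over it. The claim becomes: the least energy of a [g] with [g z = 1] is the
    inverse of [1 / I0 + |z| ^ 2 / I1 + o(|z| ^ 2)].

    Since [p] may be less than 1, there is no convexity to rely on. Its role is played
    by means over the rotations by [N]-th roots of unity, which do not change the
    energy. Over such an orbit, the mean of [|P| ^ p] is at least its geometric mean,
    which by Jensen's formula is nearly at least [|P 0| ^ p] ([poly_submean]). If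
    moreover [P] is close to [P 0 = 1], then in the expansion of [|1 + v| ^ p] the terms
    in [v] and [v ^ 2] average to 0, and the mean is nearly 1 plus [p ^ 2 / 4] times the
    mean of [|v| ^ 2] ([orbit_quad], [poly_quad_lower]). Both facts pass to holomorphic
    functions by uniform approximation ([submean], [quad_lower]).

    For the lower bound, only functions of energy at most [I0] matter, as the constant 1
    has energy [I0]. For these, Cauchy estimates hold uniformly ([coef_unif]), so the
    coefficient [b0] tends to 1 with [z]. But then [b0] alone accounts for nearly all
    the energy, which forces the other coefficients to tend to 0 ([coef_small]). So [g]
    is nearly constant on compact sets, and its energy is at least [|b0| ^ p (I0 + k u ^
    2 I1)], with [u = |b1 / b0|] and [k] close to [p ^ 2 / 4] ([quad_energy]). On the
    other hand [g z = 1] reads [b0 (1 + (b1 / b0) z) = 1 + o(z ^ 2)], so that [|b0|] is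
    at least about [1 / (1 + u |z|)]. Minimising over [u] is the inequality between the
    arithmetic and geometric means ([quad_opt], [energy_lower]). The optimal [u]
    dictates the test function [(1 + a w) / (1 + a z)], with [a] proportional to the
    conjugate of [z], for the upper bound ([energy_test]).

    The function theory needed is proved from the invariance of planar Lebesgue measure,
    Goursat's bisection in logarithmic polar coordinates ([circle_mean]), and Chernoff's
    derivation of the Taylor expansion from the Riemann-Lebesgue lemma ([taylor]). *)

Set Implicit Arguments.
Unset Strict Implicit.
Unset Printing Implicit Defensive.

(** * Invariance of planar Lebesgue measure *)

Section planar.
Variable R : realType.
Local Notation mu := (@lebesgue_measure R).
Local Notation mu2 := (mu \x mu)%E.

(** Both sides are integrals against measures that agree on half-open intervals. *)
Lemma ge0_integral_shift (a : R) (f : R -> \bar R) : measurable_fun setT f ->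
  (forall x, 0 <= f x)%E -> (\int[mu]_x f (x + a)%R = \int[mu]_x f x)%E.
Proof.
move=> mf f0.
pose phi : measurableTypeR R -> measurableTypeR R := fun x => x + a.
have ma : measurable_fun setT phi.
  exact: measurable_funD.
transitivity (\int[pushforward mu phi]_x f x)%E.
  by rewrite (ge0_integral_pushforward ma)//=.
apply: eq_measure_integral => A mA _; apply/esym.
apply: (lebesgue_measure_unique (mu := pushforward mu phi)) => //= _ [[b c]] _ <-.
rewrite /pushforward /=.
have -> : phi @^-1` `]b, c] = `]b - a, c - a]%classic.
  by apply/seteqP; split=> x /=; rewrite !in_itv/= ltrBlDr lerBrDr.
rewrite !lebesgue_measure_itv/= !lte_fin ltrD2r.
by case: ifP => // _; rewrite -!EFinD; congr EFin; lra.
Qed.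

Lemma ge0_integral_dilate (a : R) (f : R -> \bar R) : 0 < a -> measurable_fun setT f ->
  (forall x, 0 <= f x)%E -> (a%:E * \int[mu]_x f (a * x)%R = \int[mu]_x f x)%E.
Proof.
move=> a0 mf f0.
pose phi : measurableTypeR R -> measurableTypeR R := fun x => a * x.
have ma : measurable_fun setT phi.
  exact: measurable_funM.
have an : 0 <= a by exact: ltW.
pose nu := mscale (NngNum an)
  (measure_function_pushforward__canonical__measure_function_Measure mu ma).
transitivity (\int[nu]_x f x)%E.
  rewrite ge0_integral_mscale//=.
  by rewrite (ge0_integral_pushforward ma)//=.
apply: eq_measure_integral => A mA _; apply/esym.
apply: (lebesgue_measure_unique (mu := nu)) => //= _ [[b c]] _ <-.
rewrite /nu /mscale /= /pushforward.
have -> : phi @^-1` `]b, c] = `](a^-1 * b), (a^-1 * c)]%classic.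
  by apply/seteqP; split=> x /=; rewrite !in_itv/= ltr_pdivrMl// ler_pdivlMl.
rewrite !lebesgue_measure_itv/= !lte_fin ltr_pM2l ?invr_gt0//.
case: ifP => // _; rewrite ?mule0// -!EFinD -EFinM; congr EFin.
by field; rewrite gt_eqF.
Qed.

Section maps.
Variable F : R * R -> \bar R.
Hypothesis mF : measurable_fun setT F.
Hypothesis F0 : forall x, (0 <= F x)%E.

(** Tonelli: for each value of the other coordinate, a shear is a translation. *)
Lemma integral_shear1 (G : R -> R) : measurable_fun setT G ->
  (\int[mu2]_z F (z.1 + G z.2, z.2)%R = \int[mu2]_z F z)%E.
Proof.
move=> mG.
rewrite [LHS]fubini_tonelli2//=; last first.
  apply: measurableT_comp => //; apply/measurable_fun_pair => //.
  by apply: measurable_funD => //; apply: measurableT_comp.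
rewrite [RHS]fubini_tonelli2//; apply: eq_integral => y _.
rewrite /fubini_G /= (ge0_integral_shift (G y) (f := fun x => F (x, y)))//.
exact: measurableT_comp.
Qed.

Lemma integral_shear2 (G : R -> R) : measurable_fun setT G ->
  (\int[mu2]_z F (z.1, z.2 + G z.1)%R = \int[mu2]_z F z)%E.
Proof.
move=> mG.
rewrite [LHS]fubini_tonelli1//=; last first.
  apply: measurableT_comp => //; apply/measurable_fun_pair => //.
  by apply: measurable_funD => //; apply: measurableT_comp.
rewrite [RHS]fubini_tonelli1//; apply: eq_integral => y _.
rewrite /fubini_F /= (ge0_integral_shift (G y) (f := fun x => F (y, x)))//.
exact: measurableT_comp.
Qed.

Lemma integral_dilate2 (a : R) : 0 < a ->
  ((a ^+ 2)%:E * \int[mu2]_z F (a * z.1, a * z.2)%R = \int[mu2]_z F z)%E.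
Proof.
move=> a0.
have mFa : measurable_fun setT (fun z : R * R => F (a * z.1, a * z.2)).
  apply: measurableT_comp => //; apply/measurable_fun_pair => //;
  by apply: measurable_funM => //; apply: measurableT_comp.
have mFa1 : measurable_fun setT (fun z : R * R => F (a * z.1, z.2)).
  apply: measurableT_comp => //; apply/measurable_fun_pair => //;
  by apply: measurable_funM => //; apply: measurableT_comp.
transitivity (a%:E * \int[mu2]_z F (a * z.1, z.2)%R)%E.
  rewrite [in LHS]fubini_tonelli1// [in RHS]fubini_tonelli1// expr2 EFinM -muleA; congr (_ * _)%E.
  rewrite -ge0_integralZl//=; last 3 first.
  - by apply: measurable_fun_fubini_tonelli_F.
  - by move=> x _; apply: integral_ge0.
  - by rewrite lee_fin ltW.
  apply: eq_integral => x _.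
  rewrite /fubini_F /=.
  apply: (ge0_integral_dilate (f := fun y => F (a * x, y)) a0) => //.
  exact: measurableT_comp.
rewrite [in LHS]fubini_tonelli2// [in RHS]fubini_tonelli2//.
rewrite -ge0_integralZl//=; last 3 first.
- by apply: measurable_fun_fubini_tonelli_G.
- by move=> x _; apply: integral_ge0.
- by rewrite lee_fin ltW.
apply: eq_integral => x _.
rewrite /fubini_G /=.
apply: (ge0_integral_dilate (f := fun y => F (y, x)) a0) => //.
exact: measurableT_comp.
Qed.

End maps.

Lemma mfun_linear (F : R * R -> \bar R) (a b c d e f : R) : measurable_fun setT F ->
  measurable_fun setT (fun z : R * R => F (a * z.1 + b * z.2 + c, d * z.1 + e * z.2 + f)).
Proof.
move=> mF; apply: measurableT_comp => //; apply/measurable_fun_pair => //;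
apply: measurable_funD => //; apply: measurable_funD => //; apply: measurable_funM => //.
Qed.

(** A rotation other than the half turn is a product of three shears. *)
Lemma integral_rot_half (F : R * R -> \bar R) (c s : R) :
  measurable_fun setT F -> (forall x, 0 <= F x)%E ->
  c ^+ 2 + s ^+ 2 = 1 -> 1 + c != 0 ->
  (\int[mu2]_z F (c * z.1 - s * z.2, s * z.1 + c * z.2)%R = \int[mu2]_z F z)%E.
Proof.
move=> mF F0 cs c1.
pose t := - (s / (1 + c)).
have mt a : measurable_fun setT (fun x : R => a * x) by exact: measurable_funM.
have tE : (1 + c) * t = - s by rewrite /t; field.
have h1 : 1 + t * s = c.
  by apply: (mulfI c1); rewrite mulrDr mulrA tE mulr1; move: cs; rewrite !expr2 => cs; lra.
pose F1 z := F (z.1 + t * z.2, z.2).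
have mF1 : measurable_fun setT F1.
  have := mfun_linear 1 t 0 0 1 0 mF; congr measurable_fun.
  by apply/funext => z; rewrite /F1; congr (F (_, _)); ring.
pose F2 z := F1 (z.1, z.2 + s * z.1).
have mF2 : measurable_fun setT F2.
  have := mfun_linear 1 0 0 s 1 0 mF1; congr measurable_fun.
  by apply/funext => z; rewrite /F2; congr (F1 (_, _)); ring.
rewrite -[RHS](integral_shear1 mF F0 (mt t)).
rewrite -[RHS](integral_shear2 mF1 (fun _ => F0 _) (mt s)).
rewrite -[RHS](integral_shear1 mF2 (fun _ => F0 _) (mt t)).
apply: eq_integral => z _; rewrite /F2 /F1/=; congr (F (_, _)).
  have -> : z.1 + t * z.2 + t * (z.2 + s * (z.1 + t * z.2)) =
    (1 + t * s) * z.1 + (t * (2 + t * s)) * z.2 by ring.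
  rewrite h1.
  have -> : t * (2 + t * s) = - s by rewrite -tE -{1}h1; ring.
  ring.
rewrite -h1; ring.
Qed.
End planar.

(** * The modulus, and integrals over sets of complex numbers *)

Notation cRe := complex.Re.
Notation cIm := complex.Im.

Section cmod.
Variable R : realType.
Implicit Types z w : R[i].

Lemma cmod_ge0 z : 0 <= cmod z.
Proof. by case: z => a b /=; exact: sqrtr_ge0. Qed.

Lemma cmod_sqr z : cmod z ^+ 2 = cRe z ^+ 2 + cIm z ^+ 2.
Proof. by case: z => a b /=; rewrite sqr_sqrtr// addr_ge0 ?sqr_ge0. Qed.

Lemma cmod0 : cmod (0 : R[i]) = 0.
Proof. exact: ComplexField.Normc.normc0. Qed.

Lemma cmod1 : cmod (1 : R[i]) = 1.
Proof. exact: ComplexField.Normc.normc1. Qed.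

Lemma cmodM z w : cmod (z * w) = cmod z * cmod w.
Proof. exact: ComplexField.Normc.normcM. Qed.

Lemma cmodV z : cmod z^-1 = (cmod z)^-1.
Proof. exact: ComplexField.Normc.normcV. Qed.

Lemma cmod_eq0 z : (cmod z == 0) = (z == 0).
Proof.
apply/eqP/eqP => [/ComplexField.Normc.eq0_normc//|->]; exact: cmod0.
Qed.

Lemma cmod_gt0 z : (0 < cmod z) = (z != 0).
Proof. by rewrite lt_def cmod_ge0 cmod_eq0 andbT. Qed.

Lemma cmodX z n : cmod (z ^+ n) = cmod z ^+ n.
Proof. by elim: n => [|n ih]; rewrite ?expr0 ?cmod1// !exprS cmodM ih. Qed.

Lemma cmodN z : cmod (- z) = cmod z.
Proof. by case: z => a b /=; rewrite !sqrrN. Qed.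

Lemma cmodC z w : cmod (z - w) = cmod (w - z).
Proof. by rewrite -cmodN opprB. Qed.

Lemma ler_Re z : `|cRe z| <= cmod z.
Proof.
rewrite -ler_sqr ?nnegrE ?cmod_ge0// real_normK ?num_real// cmod_sqr.
by rewrite lerDl sqr_ge0.
Qed.

Lemma ler_Im z : `|cIm z| <= cmod z.
Proof.
rewrite -ler_sqr ?nnegrE ?cmod_ge0// real_normK ?num_real// cmod_sqr.
by rewrite lerDr sqr_ge0.
Qed.

Lemma cmod_le_ReIm z : cmod z <= `|cRe z| + `|cIm z|.
Proof.
rewrite -ler_sqr ?nnegrE ?cmod_ge0 ?addr_ge0// cmod_sqr.
by rewrite sqrrD !real_normK ?num_real// -addrA addrCA addrC lerDl mulrn_wge0// mulr_ge0.
Qed.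

Lemma ler_cmodD z w : cmod (z + w) <= cmod z + cmod w.
Proof.
rewrite -ler_sqr ?nnegrE ?cmod_ge0 ?addr_ge0 ?cmod_ge0// cmod_sqr sqrrD !cmod_sqr.
have h : cRe z * cRe w + cIm z * cIm w <= cmod z * cmod w.
  apply: (le_trans (ler_norm _)); rewrite -ler_sqr ?nnegrE ?mulr_ge0 ?cmod_ge0//.
  rewrite real_normK ?num_real// exprMn !cmod_sqr.
  move: (cRe z) (cIm z) (cRe w) (cIm w) => a b c d.
  rewrite -subr_ge0; have -> : (a ^+ 2 + b ^+ 2) * (c ^+ 2 + d ^+ 2) - (a * c + b * d) ^+ 2 = (a * d - b * c) ^+ 2 by ring.
  exact: sqr_ge0.
move: h; case: z => a b; case: w => c d; rewrite /=.
set u := Num.sqrt _ * _ => h.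
have -> : (a + c) ^+ 2 + (b + d) ^+ 2 = a ^+ 2 + b ^+ 2 + (c ^+ 2 + d ^+ 2) + (a * c + b * d) *+ 2 by ring.
rewrite [X in _ <= X](_ : _ = a ^+ 2 + b ^+ 2 + (c ^+ 2 + d ^+ 2) + u *+ 2); last by ring.
by rewrite lerD2l lerMn2r.
Qed.

Lemma ler_cmodB z w : cmod (z - w) <= cmod z + cmod w.
Proof. by rewrite -(cmodN w) ler_cmodD. Qed.

Lemma ler_distB z w : cmod z - cmod w <= cmod (z - w).
Proof. by rewrite lerBlDr; apply: le_trans (ler_cmodD _ _); rewrite subrK. Qed.

Lemma cmod_sum (I : Type) (s : seq I) (P : pred I) (F : I -> R[i]) :
  cmod (\sum_(i <- s | P i) F i) <= \sum_(i <- s | P i) cmod (F i).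
Proof.
elim/big_ind2 : _ => //; first by rewrite cmod0.
by move=> x1 x2 y1 y2 h1 h2; rewrite (le_trans (ler_cmodD _ _))// lerD.
Qed.

Lemma cmod_prod (I : Type) (s : seq I) (P : pred I) (F : I -> R[i]) :
  cmod (\prod_(i <- s | P i) F i) = \prod_(i <- s | P i) cmod (F i).
Proof. by elim/big_ind2 : _ => //; [exact: cmod1|move=> ? ? ? ? <- <-; rewrite cmodM]. Qed.

Lemma cmod_real (x : R) : cmod (Complex x 0) = `|x|.
Proof. by rewrite /= expr0n/= addr0 sqrtr_sqr. Qed.

End cmod.

Section aint.
Variable R : realType.
Local Notation mu := (@lebesgue_measure R).
Local Notation mu2 := (mu \x mu)%E.
Implicit Types (D U : set R[i]) (F G : R[i] -> R).

(** Sets and functions of a complex variable are measured through the coordinates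
    [(x, y)] of [x + iy], as in the definition of the Bergman norm. *)

Definition planar D : set (R * R) := [set xy | D (Complex xy.1 xy.2)].

Definition aint D F : \bar R :=
  (\int[mu2]_(xy in planar D) (F (Complex xy.1 xy.2))%:E)%E.

Definition cmset D := measurable (planar D).
Definition cmfun D F := measurable_fun (planar D) (fun xy => F (Complex xy.1 xy.2)).

Lemma aint_ge0 D F : (forall w, D w -> 0 <= F w) -> (0 <= aint D F)%E.
Proof. by move=> F0; apply: integral_ge0 => z Dz; rewrite lee_fin; exact: F0. Qed.

Lemma le_aint D F G : cmset D -> cmfun D F -> cmfun D G ->
  (forall w, D w -> 0 <= F w <= G w) -> (aint D F <= aint D G)%E.
Proof.
move=> mD mF mG FG; apply: ge0_le_integral => //.
- by move=> z Dz; rewrite lee_fin; case/andP: (FG _ Dz).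
- exact/measurable_EFinP.
- exact/measurable_EFinP.
- by move=> z Dz; rewrite lee_fin; case/andP: (FG _ Dz).
Qed.

Lemma subset_aint D U F : cmset D -> cmset U -> cmfun U F -> D `<=` U ->
  (forall w, U w -> 0 <= F w) -> (aint D F <= aint U F)%E.
Proof.
move=> mD mU mF DU F0; apply: ge0_subset_integral => //.
- exact/measurable_EFinP.
- by move=> z Dz; rewrite lee_fin; exact: F0.
- by move=> z; exact: DU.
Qed.

Lemma eq_aint D F G : (forall w, D w -> F w = G w) -> aint D F = aint D G.
Proof. by move=> FG; apply: eq_integral => z; rewrite inE => Dz; rewrite FG. Qed.

Lemma aintU D U F : cmset D -> cmset U -> cmfun (D `|` U) F ->
  (forall w, (D `|` U) w -> 0 <= F w) -> (forall w, D w -> U w -> False) ->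
  (aint (D `|` U) F = aint D F + aint U F)%E.
Proof.
move=> mD mU mF F0 DU; apply: ge0_integral_setU => //.
- exact/measurable_EFinP.
- by move=> z Dz; rewrite lee_fin; exact: F0.
- by rewrite disj_set2E; apply/eqP; rewrite -subset0 => z [] /DU.
Qed.

Lemma aintZ D F (k : R) : cmset D -> cmfun D F -> (forall w, D w -> 0 <= F w) -> 0 <= k ->
  (aint D (fun w => k * F w)%R = k%:E * aint D F)%E.
Proof.
move=> mD mF F0 k0; rewrite /aint -ge0_integralZl_EFin//.
- by move=> z Dz; rewrite lee_fin; exact: F0.
- exact/measurable_EFinP.
Qed.

Lemma aintD D F G : cmset D -> cmfun D F -> cmfun D G -> (forall w, D w -> 0 <= F w) ->
  (forall w, D w -> 0 <= G w) -> (aint D (fun w => F w + G w)%R = aint D F + aint D G)%E.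
Proof.
move=> mD mF mG F0 G0; rewrite /aint -ge0_integralD//.
- by move=> z Dz; rewrite lee_fin; exact: F0.
- exact/measurable_EFinP.
- by move=> z Dz; rewrite lee_fin; exact: G0.
- exact/measurable_EFinP.
Qed.

Lemma aint_sum D (I : Type) (s : seq I) (F : I -> R[i] -> R) : cmset D -> (forall i, cmfun D (F i)) ->
  (forall i w, D w -> 0 <= F i w) ->
  (aint D (fun w => \sum_(i <- s) F i w)%R = \sum_(i <- s) aint D (F i))%E.
Proof.
move=> mD mF F0; rewrite /aint.
under eq_integral do rewrite -sumEFin.
rewrite ge0_integral_sum//.
- by move=> i; apply/measurable_EFinP; exact: mF.
- by move=> i z Dz; rewrite lee_fin; exact: F0.
Qed.

(** Multiplication by [a] is a rotation followed by a dilation. The half turn, which is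
    not a product of three shears of the above kind, is the square of a quarter turn. *)
Lemma aint_affine D F (a b : R[i]) : cmset D -> cmfun D F -> (forall w, D w -> 0 <= F w) ->
  a != 0 ->
  (aint D F = (cmod a ^+ 2)%:E * aint [set w | D (a * w + b)%R] (fun w => F (a * w + b)%R))%E.
Proof.
move=> mD mF F0 a0.
pose H : R * R -> \bar R := ((fun xy => (F (Complex xy.1 xy.2))%:E) \_ (planar D)).
have mH : measurable_fun setT H.
  by apply/(measurable_restrictT _ _).1 => //; exact/measurable_EFinP.
have H0 z : (0 <= H z)%E.
  by rewrite /H patchE; case: ifPn => // /set_mem Dz; rewrite lee_fin; exact: F0.
have rot (G : R * R -> \bar R) (c s : R) : measurable_fun setT G -> (forall x, 0 <= G x)%E -> c ^+ 2 + s ^+ 2 = 1 ->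
  (\int[mu2]_z G (c * z.1 - s * z.2, s * z.1 + c * z.2)%R = \int[mu2]_z G z)%E.
  move=> mG G0 cs.
  have [c1|c1] := eqVneq (1 + c) 0; last exact: integral_rot_half.
  have {}c1 : c = - 1 by apply/eqP; rewrite -subr_eq0 opprK addrC c1.
  have {}s0 : s = 0.
    by move: cs; rewrite c1 sqrrN expr1n => /eqP; rewrite -subr_eq0 addrAC subrr add0r sqrf_eq0 => /eqP.
  pose G1 z := G (0 * z.1 - 1 * z.2, 1 * z.1 + 0 * z.2).
  have mG1 : measurable_fun setT G1.
    have := mfun_linear 0 (-1) 0 1 0 0 mG; congr measurable_fun.
    by apply/funext => z; rewrite /G1; congr (G (_, _)); ring.
  have e01 : (0 : R) ^+ 2 + 1 ^+ 2 = 1 by rewrite expr0n/= expr1n add0r.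
  have n01 : (1 + 0 : R) != 0 by rewrite addr0 oner_neq0.
  rewrite -(integral_rot_half mG G0 e01 n01) -/(G1 _).
  rewrite -(integral_rot_half mG1 (fun _ => G0 _) e01 n01).
  by apply: eq_integral => z _; rewrite /G1/= c1 s0; congr (G (_, _)); ring.
pose r := cmod a.
have r0 : 0 < r by rewrite cmod_gt0.
pose ca := cRe a / r; pose sa := cIm a / r.
have cs : ca ^+ 2 + sa ^+ 2 = 1.
  by rewrite !expr_div_n -mulrDl -cmod_sqr divff// expf_neq0// gt_eqF.
have rc : r * ca = cRe a by rewrite mulrC divfK// gt_eqF.
have rs : r * sa = cIm a by rewrite mulrC divfK// gt_eqF.
have pt x y : Complex (ca * (r * x) - sa * (r * y) + cRe b)
    (sa * (r * x) + ca * (r * y) + cIm b) = a * Complex x y + b.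
  rewrite (_ : ca * _ - _ + _ = (r * ca) * x - (r * sa) * y + cRe b); last by ring.
  rewrite (_ : sa * _ + _ + _ = (r * sa) * x + (r * ca) * y + cIm b); last by ring.
  by rewrite rc rs; case: (a) => a1 a2; case: (b) => b1' b2'; congr Complex => /=; ring.
pose b1 := cRe b; pose b2 := cIm b.
pose H1 z := H (z.1 + b1, z.2 + b2).
have mH1 : measurable_fun setT H1.
  have := mfun_linear 1 0 b1 0 1 b2 mH; congr measurable_fun.
  by apply/funext => z; rewrite /H1; congr (H (_, _)); ring.
pose H2 z := H1 (ca * z.1 - sa * z.2, sa * z.1 + ca * z.2).
have mH2 : measurable_fun setT H2.
  have := mfun_linear ca (- sa) 0 sa ca 0 mH1; congr measurable_fun.
  by apply/funext => z; rewrite /H2; congr (H1 (_, _)); ring.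
have mcst (x : R) : measurable_fun setT (fun _ : R => x) by exact: measurable_cst.
have EH : (\int[mu2]_z H z = \int[mu2]_z H1 z)%E.
  pose H' z := H (z.1 + b1, z.2).
  have mH' : measurable_fun setT H'.
    have := mfun_linear 1 0 b1 0 1 0 mH; congr measurable_fun.
    by apply/funext => z; rewrite /H'; congr (H (_, _)); ring.
  rewrite -(integral_shear1 mH H0 (mcst b1)) -/(H' _).
  by rewrite -(integral_shear2 mH' (fun _ => H0 _) (mcst b2)).
rewrite /aint integral_mkcond -/H EH -(rot _ ca sa mH1 (fun _ => H0 _) cs) -/(H2 _).
rewrite -(integral_dilate2 mH2 (fun _ => H0 _) r0); congr (_ * _)%E.
rewrite [RHS]integral_mkcond; apply: eq_integral => -[x y] _.
rewrite /H2 /H1 /H !patchE /=.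
rewrite pt; set u := (_ \in planar D).
suff -> : u = ((x, y) \in planar [set w | D (a * w + b)]) by [].
by apply/idP/idP; rewrite /u !inE /planar /= pt.
Qed.

End aint.

(** * Measurability, and the area of the disc *)

Section meas.
Variable R : realType.
Local Notation mu := (@lebesgue_measure R).
Local Notation mu2 := (mu \x mu)%E.
Implicit Types (D U : set R[i]) (F G : R[i] -> R).

Definition copen U := forall w, U w -> exists2 r, 0 < r & forall v, cmod (v - w) < r -> U v.
Definition ccont_on U F := forall w, U w -> forall e, 0 < e ->
  exists2 d, 0 < d & forall v, cmod (v - w) < d -> `|F v - F w| < e.

(** An open set is a countable union of boxes with rational centres. *)
Lemma copen_cmset U : copen U -> cmset U.
Proof.
move=> oU.
pose box (q1 q2 : rat) (n : nat) : set (R * R) :=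
  [set x | ball (ratr q1 : R) (n.+1%:R^-1) x] `*` [set x | ball (ratr q2 : R) (n.+1%:R^-1) x].
pose sub q1 q2 n := box q1 q2 n `<=` planar U.
rewrite /cmset; have -> : planar U = \bigcup_q1 \bigcup_q2 \bigcup_n
   (if `[< sub q1 q2 n >] then box q1 q2 n else set0).
  apply/seteqP; split => [[x y] Uxy|[x y] [q1 _] [q2 _] [n _]]; last first.
    by case: asboolP => // s b; exact: s.
  have [r r0 rU] := oU _ Uxy.
  have r4 : 0 < r / 4 by rewrite divr_gt0.
  pose n := Num.truncn (r / 4)^-1.
  have nr : n.+1%:R^-1 < r / 4 by rewrite invf_plt ?posrE// truncnS_gt.
  have n0 : 0 < n.+1%:R^-1 :> R by rewrite invr_gt0.
  have itv (u : R) : u - n.+1%:R^-1 < u + n.+1%:R^-1 by rewrite ltrBlDr -addrA ltrDl addr_gt0.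
  have [q1 q1x] : exists q : rat, `|ratr q - x| < n.+1%:R^-1.
    have [q] := @rat_in_itvoo R _ _ (itv x).
    by rewrite in_itv/= => /andP[h1 h2]; exists q; rewrite ltr_norml ltrBrDl h1 /= ltrBlDl.
  have [q2 q2x] : exists q : rat, `|ratr q - y| < n.+1%:R^-1.
    have [q] := @rat_in_itvoo R _ _ (itv y).
    by rewrite in_itv/= => /andP[h1 h2]; exists q; rewrite ltr_norml ltrBrDl h1 /= ltrBlDl.
  exists q1 => //; exists q2 => //; exists n => //.
  case: asboolP => [_|]; first by split.
  case=> -[x' y'] [/= b1 b2]; apply: rU => /=.
  apply: le_lt_trans (cmod_le_ReIm (Complex (x' - x) (y' - y))) _ => /=.
  have h1 : `|x' - x| < r / 2.
    move: b1; rewrite /ball/= distrC => b1.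
    by move: b1 q1x nr; set e := _^-1; have := ler_distD (ratr q1) x' x; lra.
  have h2 : `|y' - y| < r / 2.
    move: b2; rewrite /ball/= distrC => b2.
    by move: b2 q2x nr; set e := _^-1; have := ler_distD (ratr q2) y' y; lra.
  lra.
apply: bigcupT_measurable_rat => q1; apply: bigcupT_measurable_rat => q2.
apply: bigcupT_measurable => n; case: ifP => // _.
by apply: measurableX; exact: measurable_ball.
Qed.

Lemma ccont_cmfun U F : copen U -> ccont_on U F -> cmfun U F.
Proof.
move=> oU cF; rewrite /cmfun; apply: (measurability _ (RGenOInfty.measurableE R)).
move=> _ [_ [a ->] <-].
suff : copen (U `&` [set w | a < F w]).
  move/copen_cmset; rewrite /cmset; congr measurable.
  by apply/seteqP; split => z /=; rewrite /planar /= in_itv/= andbT.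
move=> w [Uw /= aF].
have [r r0 rU] := oU _ Uw.
have [d d0 dF] := cF _ Uw (F w - a) ltac:(by rewrite subr_gt0).
exists (Num.min r d); first by rewrite lt_min r0.
move=> v; rewrite lt_min => /andP[/rU Uv /dF]; split => //=.
by have := ler_norm (F w - F v); rewrite distrC; lra.
Qed.

Lemma cmod_cont : ccont_on setT (@ComplexField.Normc.normc R).
Proof.
move=> w _ e e0; exists e => // v vw; apply: le_lt_trans vw.
rewrite ler_norml; apply/andP; split; last exact: ler_distB.
by rewrite lerNl opprB cmodC ler_distB.
Qed.

Lemma cmfun_cmod : cmfun setT (@ComplexField.Normc.normc R).
Proof. by apply: ccont_cmfun; [move=> w _; exists 1|exact: cmod_cont]. Qed.

Lemma cmfunS D U F : cmset U -> D `<=` U -> cmfun U F -> cmfun D F.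
Proof. by move=> mU DU; apply: measurable_funS => // z; exact: DU. Qed.

Lemma cmfun_comp D F (g : R -> R) : measurable_fun setT g -> cmfun D F -> cmfun D (fun w => g (F w)).
Proof. by move=> mg mF; apply: measurableT_comp. Qed.

Lemma cmfun_powR D F p : cmfun D F -> cmfun D (fun w => F w `^ p).
Proof. by move=> mF; apply: (cmfun_comp (g := fun x => x `^ p)) => //; exact: measurable_powR. Qed.

Lemma cmfunM D F G : cmfun D F -> cmfun D G -> cmfun D (fun w => F w * G w).
Proof. by move=> mF mG; apply: measurable_funM. Qed.

Lemma cmfunD D F G : cmfun D F -> cmfun D G -> cmfun D (fun w => F w + G w).
Proof. by move=> mF mG; apply: measurable_funD. Qed.

Lemma cmfun_cst D (a : R) : cmfun D (fun=> a).
Proof. exact: measurable_cst. Qed.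

Lemma cmfun_cmodw D : cmset D -> cmfun D (@ComplexField.Normc.normc R).
Proof. by move=> mD; apply: (@cmfunS _ setT) cmfun_cmod => //; exact: measurableT. Qed.

Lemma cmset_cmod (A : set R) : measurable A -> cmset [set w | A (cmod w)].
Proof.
move=> mA; rewrite /cmset /planar/=.
have := cmfun_cmod; rewrite /cmfun => /(_ measurableT A mA); rewrite setTI//.
Qed.

Definition annulus (s t : R) : set R[i] := [set w | s <= cmod w < t].
Definition disc (t : R) : set R[i] := [set w | cmod w < t].

Lemma cmset_annulus s t : cmset (annulus s t).
Proof.
have := @cmset_cmod `[s, t[%classic; rewrite /annulus => /(_ (measurable_itv _)).
by congr cmset; apply/seteqP; split => x /=; rewrite in_itv.
Qed.

Lemma cmset_disc t : cmset (disc t).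
Proof.
have := @cmset_cmod `]-oo, t[%classic; rewrite /disc => /(_ (measurable_itv _)).
by congr cmset; apply/seteqP; split => x /=; rewrite in_itv.
Qed.

(** By Tonelli the area is the integral of [2 * Num.sqrt (1 - x ^ 2)], of which an
    antiderivative on [-1, 1] is known explicitly. *)
Lemma area_disc1 : aint (disc 1) (fun=> 1) = pi%:E.
Proof.
rewrite /aint integral_cst ?mul1e; last exact: cmset_disc.
rewrite /product_measure1/=.
pose h x : R := 2 * Num.sqrt (1 - x ^+ 2).
have secE x : mu (xsection (planar (disc 1)) x) = (h x)%:E.
  have -> : xsection (planar (disc 1)) x = `](- Num.sqrt (1 - x ^+ 2)), (Num.sqrt (1 - x ^+ 2))[%classic.
    apply/seteqP; split => y /=; rewrite /xsection/= inE /planar/= /disc/= in_itv/=.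
      move=> H; have : x ^+ 2 + y ^+ 2 < 1.
        by rewrite -[X in _ < X]sqrtr1 ltr_sqrt in H.
      move=> {}H; rewrite -ltr_norml -sqrtr_sqr ltr_sqrt; last by have := sqr_ge0 y; lra.
      lra.
    rewrite -ltr_norml -sqrtr_sqr => H.
    rewrite -[X in _ < X]sqrtr1 ltr_sqrt//.
    have h0 : 0 < 1 - x ^+ 2.
      by rewrite -sqrtr_gt0; apply: le_lt_trans H; exact: sqrtr_ge0.
    by move: H; rewrite ltr_sqrt//; lra.
  rewrite lebesgue_measure_itv/= lte_fin.
  case: ifPn => [_|]; first by rewrite -EFinD; congr EFin; rewrite /h; lra.
  rewrite -leNgt => H; congr EFin; rewrite /h.
  have := sqrtr_ge0 (1 - x ^+ 2); lra.
transitivity (\int[mu]_x (h x)%:E)%E; first by apply: eq_integral => x _; exact: secE.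
pose I : set R := `[- 1, 1]%classic.
have -> : (\int[mu]_x (h x)%:E = \int[mu]_(x in I) (h x)%:E)%E.
  rewrite [RHS]integral_mkcond; apply: eq_integral => x _; rewrite patchE.
  case: ifPn => // /negP xn; congr EFin; rewrite /h.
  suff -> : Num.sqrt (1 - x ^+ 2) = 0 by rewrite mulr0.
  apply/eqP; rewrite sqrtr_eq0 subr_le0.
  rewrite leNgt; apply/negP => x2; apply: xn; rewrite /I inE/= in_itv/=.
  by rewrite -ler_norml -(@ler_sqr _ `|x| 1) ?nnegrE// expr1n real_normK ?num_real// ltW.
have pi0 := pi_gt0 R.
have ch : continuous h.
  move=> x; rewrite /h; apply: cvgM; first exact: cvg_cst.
  apply: (@continuous_comp _ _ _ (fun x : R => 1 - x ^+ 2) (@Num.sqrt R)); last exact: sqrt_continuous.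
  by apply: cvgB; [exact: cvg_cst|exact: exprn_continuous].
have dsin : (@sin R)^`()%classic = @cos R by apply/funext => x; rewrite derive1E derive_val.
have E1 : (- 1 : R) = sin (- (pi / 2)) by rewrite sinN sin_pihalf.
have E2 : (1 : R) = sin (pi / 2) by rewrite sin_pihalf.
have -> : I = `[sin (- (pi / 2)), sin (pi / 2)]%classic by rewrite /I -E1 -E2.
rewrite integration_by_substitution_increasing; first last.
- exact: continuous_subspaceT.
- split; [by move=> x _; exact: derivable_sin|..].
  + by apply: cvg_at_right_filter; exact: continuous_sin.
  + by apply: cvg_at_left_filter; exact: continuous_sin.
- rewrite dsin; apply/cvg_ex; eexists; apply: cvg_at_left_filter; exact: continuous_cos.
- rewrite dsin; apply/cvg_ex; eexists; apply: cvg_at_right_filter; exact: continuous_cos.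
- by move=> x _; rewrite dsin; exact: continuous_cos.
- by move=> x y xI yI; rewrite ltr_sin.
- lra.
pose F (x : R) : R := x + sin x * cos x.
have F' (x : R) : is_derive x (1 : R) F (2 * cos x ^+ 2).
  rewrite /F; apply: is_derive_eq; rewrite /GRing.scale/=.
  by have := cos2Dsin2 x; rewrite !expr2; lra.
transitivity (\int[mu]_(x in `[(- (pi / 2))%R, (pi / 2)%R]) (2 * cos x ^+ 2)%:E)%E.
  apply: eq_integral => x; rewrite inE/= in_itv/= => /andP[x1 x2]; congr EFin; rewrite dsin.
  change (h (sin x) * cos x = 2 * cos x ^+ 2); rewrite /h.
  rewrite -cos2sin2 sqrtr_sqr ger0_norm; first by rewrite -mulrA expr2.
  by apply: cos_ge0_pihalf; rewrite x1 x2.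
rewrite (@continuous_FTC2 _ _ F)//.
- rewrite /F -EFinD sinN cosN sin_pihalf cos_pihalf; congr EFin; lra.
- lra.
- apply: continuous_subspaceT => x; apply: cvgM; first exact: cvg_cst.
  apply: (@continuous_comp _ _ _ (@cos R) (fun y => y ^+ 2)); first exact: continuous_cos.
  exact: exprn_continuous.
- have cF : continuous F.
    by move=> x; apply/differentiable_continuous/derivable1_diffP; have [] := F' x.
  split; [by move=> x _; have [] := F' x|..].
  + by apply: cvg_at_right_filter; exact: cF.
  + by apply: cvg_at_left_filter; exact: cF.
- by move=> x _; rewrite derive1E; have [_ ->] := F' x.
Qed.

End meas.

(** * Integrals of powers of the modulus *)

Section radial.
Variable R : realType.
Implicit Types (D U : set R[i]) (F G : R[i] -> R).

Lemma pow1R (a : R) : 1 `^ a = 1 :> R. Proof. by rewrite powR1. Qed.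

Lemma aint_dilate D F (t : R) : cmset D -> cmfun D F -> (forall w, D w -> 0 <= F w) -> 0 < t ->
  (aint D F = (t ^+ 2)%:E * aint [set w | D (Complex t 0 * w)%R] (fun w => F (Complex t 0 * w)%R))%E.
Proof.
move=> mD mF F0 t0.
have tc : Complex t 0 != 0 :> R[i] by rewrite -cmod_eq0 cmod_real normr_eq0 gt_eqF.
rewrite (aint_affine 0 mD mF F0 tc) cmod_real (gtr0_norm t0); congr (_ * aint _ _)%E.
  by apply/seteqP; split => w /=; rewrite addr0.
by apply/funext => w; rewrite addr0.
Qed.

Definition cpow (b : R) (w : R[i]) := cmod w `^ b.

Lemma cmfun_cpow D b : cmset D -> cmfun D (cpow b).
Proof. by move=> mD; apply: cmfun_powR; exact: cmfun_cmodw. Qed.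

Lemma cpow_ge0 b w : 0 <= cpow b w. Proof. exact: powR_ge0. Qed.

(** The weight is homogeneous of degree [b], and areas have degree 2. All the integrals of
    [cpow] are computed from this scaling law and the area of the disc alone. *)
Lemma aint_annulus_dilate b s u t : 0 < t ->
  aint (annulus (t * s) (t * u)) (cpow b) = ((t `^ (2 + b))%:E * aint (annulus s u) (cpow b))%E.
Proof.
move=> t0.
have mA := @cmset_annulus R s u; have mA' := @cmset_annulus R (t * s) (t * u).
rewrite (aint_dilate mA' (cmfun_cpow b mA') (fun w _ => cpow_ge0 b w) t0).
have -> : (t `^ (2 + b))%:E = ((t ^+ 2)%:E * (t `^ b)%:E)%E.
  rewrite -EFinM powRD; last by apply/implyP => _; rewrite gt_eqF.
  by rewrite (powR_mulrn 2)// ltW.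
rewrite -muleA -(aintZ mA (cmfun_cpow b mA) (fun w _ => cpow_ge0 b w) (powR_ge0 _ _)).
have -> : [set w | annulus (t * s) (t * u) (Complex t 0 * w)%R] = annulus s u.
  apply/seteqP; split => w; rewrite /annulus /= -/(cmod _) cmodM cmod_real gtr0_norm//.
    by rewrite ler_pM2l// ltr_pM2l.
  by rewrite ler_pM2l// ltr_pM2l.
congr (_ * _)%E; apply: eq_aint => w _.
by rewrite /cpow cmodM cmod_real gtr0_norm// powRM ?cmod_ge0 ?ltW.
Qed.

Lemma disc_annulus0 t : disc t = annulus 0 t :> set R[i].
Proof. by apply/seteqP; split => w; rewrite /disc /annulus /= cmod_ge0. Qed.

Lemma aint_split F r s t : cmfun (annulus r t) F -> (forall w, annulus r t w -> 0 <= F w) ->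
  r <= s -> s <= t ->
  (aint (annulus r t) F = aint (annulus r s) F + aint (annulus s t) F)%E.
Proof.
move=> mF F0 rs st.
have E : annulus r t = annulus r s `|` annulus s t.
  apply/seteqP; split => w; rewrite /annulus/=.
    by move=> /andP[h1 h2]; have [h|h] := ltP (cmod w) s; [left|right]; rewrite ?h1 ?h ?h2.
  by case=> /andP[h1 h2]; [rewrite h1 (lt_le_trans h2)|rewrite h2 (le_trans rs)].
rewrite E aintU -?E//.
- exact: cmset_annulus.
- exact: cmset_annulus.
- by move=> w /andP[_ h1] /andP[h2 _]; move: h1; rewrite ltNge h2.
Qed.

Lemma aint_annulus_split b r s t : r <= s -> s <= t ->
  (aint (annulus r t) (cpow b) = aint (annulus r s) (cpow b) + aint (annulus s t) (cpow b))%E.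
Proof.
by apply: aint_split; [apply: cmfun_cpow; exact: cmset_annulus|move=> w _; exact: cpow_ge0].
Qed.

Lemma area_disc (t : R) : 0 < t -> aint (disc t) (fun=> 1) = (pi * t ^+ 2)%:E.
Proof.
move=> t0.
rewrite (aint_dilate (@cmset_disc R t) (cmfun_cst (D := disc t) 1) (fun _ _ => ler01) t0).
have -> : [set w | disc t (Complex t 0 * w)%R] = disc 1.
  apply/seteqP; split => w; rewrite /disc /= -/(cmod _) cmodM cmod_real gtr0_norm//.
    by rewrite -ltr_pdivlMl// mulVf// gt_eqF.
  by rewrite -ltr_pdivlMl// mulVf// gt_eqF.
by rewrite area_disc1 -EFinM mulrC.
Qed.

Lemma area_annulus (q : R) : 0 < q < 1 -> aint (annulus q 1) (fun=> 1) = (pi * (1 - q ^+ 2))%:E.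
Proof.
move=> /andP[q0 q1].
have : aint (disc 1) (fun=> 1%R) = (aint (disc q) (fun=> 1%R) + aint (annulus q 1%R) (fun=> 1%R) : \bar R)%E.
  rewrite -aintU.
  - congr aint; apply/seteqP; split => w; rewrite /annulus /disc/=.
      by move=> h; have [h'|h'] := ltP (cmod w) q; [left|right].
    by case=> [h|/andP[]//]; exact: lt_trans q1.
  - exact: cmset_disc.
  - exact: cmset_annulus.
  - exact: cmfun_cst.
  - by move=> *; exact: ler01.
  - by move=> w; rewrite /disc /= => h1 /andP[h2 _]; move: h1; rewrite ltNge h2.
rewrite area_disc1 area_disc// => h.
have : aint (annulus q 1) (fun=> 1) \is a fin_num.
  by move: h; case: aint.
move=> /fineK h2; move: h; rewrite -h2 -EFinD => -[h]; congr EFin; lra.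
Qed.

Lemma cpow_annulus_bounds b q w : 0 < q < 1 -> annulus q 1 w ->
  q `^ `|b| <= cpow b w <= q `^ (- `|b|).
Proof.
move=> /andP[q0 q1] /andP[w1 w2]; rewrite /cpow.
have w0 : 0 < cmod w by exact: lt_le_trans w1.
have bb : - `|b| <= b <= `|b| by rewrite -ler_norml.
case/andP: bb => bb1 bb2.
have q1' : 0 < q <= 1 by rewrite q0 ltW.
have w1' : 0 < cmod w <= 1 by rewrite w0 ltW.
apply/andP; split.
  apply: (@le_trans _ _ (cmod w `^ `|b|)); last exact: ger_powR.
  by rewrite ge0_ler_powR// nnegrE ltW.
apply: (@le_trans _ _ (cmod w `^ (- `|b|))); first exact: ger_powR.
rewrite !powRN lef_pV2 ?posrE ?powR_gt0//.
by rewrite ge0_ler_powR// nnegrE ltW.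
Qed.

Lemma aint_cpow_annulus_bounds b q : 0 < q < 1 ->
  ((pi * (q `^ `|b| * (1 - q ^+ 2)))%:E <= aint (annulus q 1) (cpow b)
     <= (pi * (q `^ (- `|b|) * (1 - q ^+ 2)))%:E)%E.
Proof.
move=> q01; have mA := @cmset_annulus R q 1.
have areac (c : R) : 0 <= c ->
    (pi * (c * (1 - q ^+ 2)))%:E = aint (annulus q 1) (fun=> c * 1).
  move=> c0; rewrite (aintZ mA (cmfun_cst (D := annulus q 1) 1) (fun _ _ => ler01) c0).
  by rewrite area_annulus// -EFinM mulrCA.
rewrite !areac ?powR_ge0//.
apply/andP; split; apply: le_aint => //.
- exact: cmfun_cst.
- exact: cmfun_cpow.
- by move=> w /(cpow_annulus_bounds b q01)/andP[h _]; rewrite mulr1 powR_ge0.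
- exact: cmfun_cpow.
- exact: cmfun_cst.
- by move=> w /(cpow_annulus_bounds b q01)/andP[_ h]; rewrite mulr1 cpow_ge0.
Qed.

(** A geometric series: by homogeneity, adding an annulus to the range of integration
    amounts to the affine map [x -> g x + const] with [g < 1], whose fixed point is [B].
    *)
Lemma aint_cpow_disc_fin (b : R) : - 2 < b -> aint (disc 1) (cpow b) \is a fin_num.
Proof.
move=> b2; pose q : R := 2^-1.
have q01 : 0 < q < 1 by rewrite /q; apply/andP; split; lra.
have /andP[q0 q1] := q01.
have g0 : 0 < 2 + b by lra.
pose g := q `^ (2 + b).
have g01 : 0 < g < 1.
  rewrite /g powR_gt0//=; rewrite -[X in _ < X](pow1R (2 + b)).
  by rewrite gt0_ltr_powR// nnegrE// ltW.
case/andP: g01 => g_gt0 g_lt1.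
(* the fixed point of the affine recursion for the integrals over q ^ n <= |w| < 1 *)
pose B := pi * (q `^ (- `|b|) * (1 - q ^+ 2)) / (1 - g).
have B0 : 0 <= B.
  rewrite /B !mulr_ge0 ?pi_ge0 ?powR_ge0// ?invr_ge0 ?subr_ge0 ?ltW//.
  by rewrite expr_lt1// ltW.
pose A n : set R[i] := annulus (q ^+ n) 1.
have AB n : (aint (A n) (cpow b) <= B%:E)%E.
  elim: n => [|n ih].
    rewrite /A expr0 (_ : annulus 1 1 = set0); last first.
      by apply/seteqP; split => // w /andP[h1]; rewrite ltNge h1.
    by rewrite /aint /planar /= integral_set0 lee_fin.
  have qn : q ^+ n <= 1 by rewrite exprn_ile1// ltW.
  rewrite /A (@aint_annulus_split b _ q)//; last 2 first.
  - by rewrite exprS -[X in _ <= X]mulr1 ler_pM2l.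
  - exact: ltW.
  rewrite (_ : annulus (q ^+ n.+1) q = annulus (q * q ^+ n) (q * 1)); last by rewrite mulr1 exprS.
  rewrite aint_annulus_dilate// -/g.
  rewrite (_ : B = g * B + pi * (q `^ (- `|b|) * (1 - q ^+ 2))); last first.
    by rewrite /B; field; rewrite subr_eq0 gt_eqF.
  rewrite EFinD; apply: leeD.
    by rewrite EFinM; apply: lee_wpmul2l; [rewrite lee_fin ltW|exact: ih].
  by case/andP: (aint_cpow_annulus_bounds b q01).
have UA : planar (disc 1 `\` [set 0]) = \bigcup_n planar (A n).
  apply/seteqP; split => [[x y] [/= h1 h2]|[x y] [n _] /andP[/= h1 h2]]; last first.
    split => //= h3; move: h1; rewrite -/(cmod (Complex x y)) h3 cmod0 leNgt.
    by rewrite exprn_gt0.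
  set w := Complex x y in h1 h2 *.
  have w0 : 0 < cmod w by rewrite cmod_gt0; apply/eqP.
  have [n nw] : exists n, q ^+ n <= cmod w.
    have : (q ^+ n @[n --> \oo] --> 0)%R by apply: cvg_expr; rewrite gtr0_norm.
    move=> /cvgrPdist_le/(_ _ w0)[n _ /(_ n (leqnn n))] /=.
    rewrite sub0r normrN ger0_norm; last by rewrite exprn_ge0// ltW.
    by move=> h; exists n.
  by exists n => //; rewrite /planar/= /A /annulus /=; apply/andP; split.
have B1 : (aint (disc 1 `\` [set 0%R]) (cpow b) <= B%:E)%E.
  have C : (fun n => aint (A n) (cpow b)) @ \oo -->
      aint (disc 1 `\` [set 0%R]) (cpow b).
    rewrite {2}/aint UA; apply: ge0_nondecreasing_set_cvg_integral.
  - move=> m n mn; rewrite subsetEset => -[x y] /andP[/= h1 h2]; apply/andP; split => //=.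
    by apply: le_trans h1; apply: ler_wiXn2l => //; exact: ltW.
  - by move=> n; exact: cmset_annulus.
  - by move=> n; apply/measurable_EFinP; apply: cmfun_cpow; exact: cmset_annulus.
  - by move=> n x _; rewrite lee_fin cpow_ge0.
  by apply: (cvge_to_le C); apply: nearW => n; exact: AB.
have m0 : cmset [set (0 : R[i])].
  rewrite (_ : [set 0] = [set w | [set (0 : R)] (cmod w)]); first exact: cmset_cmod.
  by apply/seteqP; split => w /= => [->|/eqP]; rewrite ?cmod0// cmod_eq0 => /eqP.
have [->|bn0] := eqVneq b 0.
  rewrite (@eq_aint _ _ _ (fun=> 1)) ?area_disc1// => w _.
  by rewrite /cpow powRr0.
rewrite (_ : disc 1 = (disc 1 `\` [set 0]) `|` [set 0]); last first.
  by rewrite setUC setDUK// => w /= ->; rewrite /disc; have := @cmod0 R; rewrite /= => ->; exact: ltr01.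
rewrite aintU//; first last.
- by move=> w [].
- by move=> *; exact: cpow_ge0.
- apply: cmfun_cpow; apply: measurableU => //; apply: measurableD => //; exact: cmset_disc.
- apply: measurableD => //; exact: cmset_disc.
rewrite (_ : aint [set 0] (cpow b) = 0%E) ?adde0; last first.
  rewrite (@eq_aint _ _ _ (fun=> 0)); last by move=> w ->; rewrite /cpow cmod0 powR0.
  by rewrite /aint integral0_eq.
rewrite ge0_fin_numE; first by apply: le_lt_trans B1 _; rewrite ltry.
by apply: aint_ge0 => *; exact: cpow_ge0.
Qed.

(** Let [I] be the integral and [g = 2 + b]. The annulus [q <= |w| < 1] contributes [I (1
    - q ^ g)] by homogeneity, and lies between the values [pi q ^ (+- |b|) (1 - q ^ 2)] by
    comparison of the weight with a constant. Dividing by [1 - q] and letting [q] tend to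
    1 gives [I g = 2 pi]. *)
Theorem aint_cpow_disc1 (b : R) : - 2 < b -> aint (disc 1) (cpow b) = (2 * pi / (2 + b))%:E.
Proof.
move=> b2; have /fineK := aint_cpow_disc_fin b2.
set I := fine _ => IE; rewrite -IE; congr EFin.
pose g := 2 + b; have g0 : 0 < g by rewrite /g; lra.
have key q : 0 < q < 1 -> pi * (q `^ `|b| * (1 - q ^+ 2)) <= I * (1 - q `^ g) <=
    pi * (q `^ (- `|b|) * (1 - q ^+ 2)).
  move=> q01; have := aint_cpow_annulus_bounds b q01; case/andP: q01 => q0 q1.
  have : aint (disc 1) (cpow b) = ((q `^ g)%:E * aint (disc 1) (cpow b) + aint (annulus q 1) (cpow b))%E.
    rewrite {1}disc_annulus0 (@aint_annulus_split b _ q) ?ltW//.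
    rewrite (_ : annulus 0 q = annulus (q * 0) (q * 1)); last by rewrite mulr0 mulr1.
    by rewrite aint_annulus_dilate// disc_annulus0.
  rewrite -IE; case: (aint (annulus q 1) (cpow b)) => //= M [h].
  by rewrite !lee_fin (_ : I * _ = M)//; move: h; set u := q `^ g; lra.
have pc : (h^-1 * ((1 + h) `^ g - 1)) @[h --> (0 : R)^'-] --> g.
  have [/cvg_ex[/= l lh]] := @is_derive1_powR R g 1 ltr01.
  rewrite /derive (cvg_lim _ lh)// pow1R mulr1 => lg; rewrite {}lg in lh.
  move/cvg_dnbhs_at_left : lh; apply: cvg_trans; apply: near_eq_cvg; near=> h.
  by rewrite /= /GRing.scale/= mulr1 pow1R (addrC h).
have cid : (fun h : R => 1 + h) h @[h --> (0 : R)^'-] --> (1 : R).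
  rewrite -[X in _ --> X]addr0; apply: cvgD; first exact: cvg_cst.
  exact: cvg_at_left_filter.
have pcst c : ((1 + h) `^ c) @[h --> (0 : R)^'-] --> (1 : R).
  rewrite -[X in _ --> X](pow1R c).
  apply: (@continuous_cvg _ _ _ _ _ _ (fun x : R => x `^ c) 1) => //.
  apply: differentiable_continuous; apply/derivable1_diffP.
  by have [] := @is_derive1_powR R c 1 ltr01.
have lc : (I * (h^-1 * ((1 + h) `^ g - 1))) @[h --> (0 : R)^'-] --> I * g.
  exact: cvgMr.
have bc c : (pi * ((1 + h) `^ c * (1 + (1 + h)))) @[h --> (0 : R)^'-] --> pi * (1 * (1 + 1)).
  apply: cvgMr; apply: cvgM; first exact: pcst.
  by apply: cvgD => //; exact: cvg_cst.
have h01 : \forall h \near (0 : R)^'-, 0 < 1 + h < 1 /\ h < 0.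
  near=> h; have h0 : h < 0 by near: h; exact: nbhs_left_lt.
  split => //; rewrite gtrDl h0 andbT.
  have : - 1 < h by near: h; apply: nbhs_left_gt; rewrite ltrN10.
  lra.
have hI (h : R) : h < 0 -> (- h) * (I * (h^-1 * ((1 + h) `^ g - 1))) = I * (1 - (1 + h) `^ g).
  by move=> h0; field; rewrite lt_eqF.
have hpi (h : R) c : (- h) * (pi * ((1 + h) `^ c * (1 + (1 + h)))) =
    pi * ((1 + h) `^ c * (1 - (1 + h) ^+ 2)).
  by ring.
have lo := ler_cvg_to (bc `|b|) lc.
have up := ler_cvg_to lc (bc (- `|b|)).
have e : I * g = pi * (1 * (1 + 1)).
  apply/eqP; rewrite eq_le; apply/andP; split; [apply: up|apply: lo].
    apply: filterS h01 => h [h1 h2].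
    by rewrite -(ler_pM2l (x := - h)) ?oppr_gt0// hI// hpi; case/andP: (key _ h1).
  apply: filterS h01 => h [h1 h2].
  by rewrite -(ler_pM2l (x := - h)) ?oppr_gt0// hI// hpi; case/andP: (key _ h1).
have -> : I = I * g / g by rewrite mulfK// gt_eqF.
by rewrite e /g; congr (_ / _); ring.
Unshelve. all: by end_near.
Qed.

Lemma aint_cpow_disc (b t : R) : - 2 < b -> 0 <= t ->
  aint (disc t) (cpow b) = (2 * pi / (2 + b) * t `^ (2 + b))%:E.
Proof.
move=> b2; rewrite le_eqVlt => /predU1P[<-|t0].
  rewrite powR0; last by rewrite gt_eqF//; lra.
  rewrite mulr0 (_ : disc 0 = set0) /aint; last first.
    by apply/seteqP; split => // w; rewrite /disc /= -/(cmod w) ltNge cmod_ge0.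
  by rewrite /planar integral_set0.
rewrite disc_annulus0 (_ : annulus 0 t = annulus (t * 0) (t * 1)); last by rewrite mulr0 mulr1.
rewrite aint_annulus_dilate//.
by rewrite -disc_annulus0 aint_cpow_disc1// -EFinM mulrC.
Qed.

Lemma aint_cpow_annulus (b s t : R) : - 2 < b -> 0 <= s -> s <= t ->
  aint (annulus s t) (cpow b) = (2 * pi / (2 + b) * (t `^ (2 + b) - s `^ (2 + b)))%:E.
Proof.
move=> b2 s0 st; have := aint_annulus_split b s0 st.
rewrite -!disc_annulus0 !aint_cpow_disc//; last exact: le_trans st.
by case: (aint _ _) => //= M [h]; congr EFin; lra.
Qed.

End radial.

(** * Green's theorem on boxes, after Goursat *)

Section green.
Variable R : realType.
Local Notation mu := (@lebesgue_measure R).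

(** Integrals over segments are only ever taken of functions that are continuous at
    each point of the segment. *)

Definition rint (a b : R) (f : R -> R) : R := \int[mu]_(x in `[a, b]) f x.

Definition cont_itv (a b : R) (f : R -> R) := forall x, a <= x <= b -> {for x, continuous f}.

Lemma cont_itv_integrable a b f : cont_itv a b f -> mu.-integrable `[a, b] (EFin \o f).
Proof.
move=> cf; apply: continuous_compact_integrable; first exact: segment_compact.
by apply: continuous_in_subspaceT => x; rewrite inE/= in_itv/=; exact: cf.
Qed.

Lemma cont_itvB a b f g : cont_itv a b f -> cont_itv a b g -> cont_itv a b (fun x => f x - g x).
Proof. by move=> cf cg x xab; apply: cvgB; [exact: cf|exact: cg]. Qed.

Lemma cont_itv_cst a b c : cont_itv a b (fun=> c).
Proof. by move=> x _; exact: cvg_cst. Qed.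

Lemma rint_split a m b f : a <= m -> m <= b -> cont_itv a b f -> rint a b f = rint a m f + rint m b f.
Proof.
move=> am mb cf; have iab := cont_itv_integrable cf.
have := @Rintegral_itvB R f (BLeft a) (BRight b) m iab.
rewrite !bnd_simp => /(_ am mb) h.
rewrite /rint -[X in _ + X]Rintegral_itv_obnd_cbnd; first by rewrite -h; lra.
by apply: integrableS iab => //; apply: subset_itvr; rewrite bnd_simp.
Qed.

Lemma rint_cst a b c : a <= b -> rint a b (fun=> c) = c * (b - a).
Proof.
move=> ab; rewrite /rint Rintegral_cst//= lebesgue_measure_itv/= lte_fin.
case: ifPn => [_ //|]; rewrite -leNgt => ba /=.
have -> : b = a by lra.
by rewrite subrr !mulr0.
Qed.

Lemma le_rint a b f g : cont_itv a b f -> cont_itv a b g ->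
  (forall x, a <= x <= b -> f x <= g x) -> rint a b f <= rint a b g.
Proof.
move=> cf cg fg; apply: le_Rintegral => //; try exact: cont_itv_integrable.
Qed.

Lemma rintD a b f g : cont_itv a b f -> cont_itv a b g ->
  rint a b (fun x => f x + g x) = rint a b f + rint a b g.
Proof. by move=> cf cg; apply: RintegralD => //; exact: cont_itv_integrable. Qed.

Lemma rintB a b f g : cont_itv a b f -> cont_itv a b g ->
  rint a b (fun x => f x - g x) = rint a b f - rint a b g.
Proof. by move=> cf cg; apply: RintegralB => //; exact: cont_itv_integrable. Qed.

Lemma rintZ a b f c : cont_itv a b f -> rint a b (fun x => c * f x) = c * rint a b f.
Proof. by move=> cf; apply: RintegralZl => //; exact: cont_itv_integrable. Qed.

Lemma rint_near a b f k e : a <= b -> cont_itv a b f ->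
  (forall x, a <= x <= b -> `|f x - k| <= e) -> `|rint a b f - k * (b - a)| <= e * (b - a).
Proof.
move=> ab cf fk; rewrite -rint_cst// -rintB//; last exact: cont_itv_cst.
have cfk : cont_itv a b (fun x => f x - k) by apply: cont_itvB => //; exact: cont_itv_cst.
rewrite ler_norml; apply/andP; split.
  rewrite -mulNr -rint_cst//; apply: le_rint => //; first exact: cont_itv_cst.
  by move=> x /fk; rewrite ler_norml => /andP[].
rewrite -rint_cst//; apply: le_rint => //; first exact: cont_itv_cst.
by move=> x /fk; rewrite ler_norml => /andP[].
Qed.

(** Frechet differentiability of [P] at [(x, y)]: partial derivatives alone would not do
    for the bisection argument. *)
Definition gdiff (P : R -> R -> R) (x y a b : R) := forall e, 0 < e -> exists2 d, 0 < d &
  forall x' y', `|x' - x| < d -> `|y' - y| < d ->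
    `|P x' y' - P x y - (a * (x' - x) + b * (y' - y))| <= e * (`|x' - x| + `|y' - y|).

Lemma gdiff_contl P x y a b : gdiff P x y a b -> {for x, continuous (fun x' => P x' y)}.
Proof.
move=> gP; apply/cvgrPdist_le => e e0.
have [d d0 dP] := gP 1 ltr01.
have c0 : 0 < 1 + `|a| by rewrite ltr_pwDl.
near=> x'.
have h1 : `|x' - x| < d by near: x'; apply: cvgr_distC_lt.
have h2 : `|x' - x| < e / (1 + `|a|).
  by near: x'; apply: cvgr_distC_lt => //; rewrite divr_gt0.
have := dP x' y h1; rewrite subrr normr0 !mulr0 !addr0 => /(_ d0) h3.
rewrite distrC.
have -> : P x' y - P x y = (P x' y - P x y - a * (x' - x)) + a * (x' - x) by ring.
apply: le_trans (ler_normD _ _) _; rewrite normrM.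
move: h2; rewrite ltr_pdivlMr// mulrDr mulr1 (mulrC _ `|a|) => h2.
by rewrite mul1r in h3; lra.
Unshelve. all: by end_near. Qed.

Lemma gdiff_contr P x y a b : gdiff P x y a b -> {for y, continuous (P x)}.
Proof.
move=> gP; apply: (@gdiff_contl (fun x y => P y x) y x b a) => e e0.
have [d d0 dP] := gP e e0; exists d => // y' x' h1 h2.
by rewrite (addrC (b * _)) (addrC `|y' - y|); exact: dP.
Qed.

Section box.
Variables P Q : R -> R -> R.

(** The circulation of the form [P dx + Q dy] around a box. *)
Definition circulation a b c d : R :=
  rint a b (fun x => P x c - P x d) + rint c d (fun y => Q b y - Q a y).

(** The form [P dx + Q dy] is differentiable and closed on the box: the derivative [s] of
    [P] in the second variable is also that of [Q] in the first one. *)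
Definition closed_form a b c d := forall x y, a <= x <= b -> c <= y <= d ->
  exists p1 s q2, gdiff P x y p1 s /\ gdiff Q x y s q2.

Lemma closed_form_contP a b c d y : closed_form a b c d -> c <= y <= d -> cont_itv a b (fun x => P x y).
Proof. by move=> g yc x xab; have [p1 [s [q2 [/gdiff_contl]]]] := g x y xab yc. Qed.

Lemma closed_form_contQ a b c d x : closed_form a b c d -> a <= x <= b -> cont_itv c d (Q x).
Proof. by move=> g xa y yc; have [p1 [s [q2 [_ /gdiff_contr]]]] := g x y xa yc. Qed.

Lemma closed_formS a b c d a' b' c' d' : closed_form a b c d -> a <= a' -> b' <= b -> c <= c' -> d' <= d ->
  closed_form a' b' c' d'.
Proof.
move=> g aa bb cc dd x y /andP[x1 x2] /andP[y1 y2]; apply: g.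
  by rewrite (le_trans aa)// (le_trans x2).
by rewrite (le_trans cc)// (le_trans y2).
Qed.

Lemma circulation_splitx a m b c d : a <= m -> m <= b -> c <= d -> closed_form a b c d ->
  circulation a b c d = circulation a m c d + circulation m b c d.
Proof.
move=> am mb cd g; have ab := le_trans am mb.
have hc : c <= c <= d by rewrite lexx. have hd : c <= d <= d by rewrite lexx cd.
rewrite /circulation (rint_split am mb); last by apply: cont_itvB; exact: closed_form_contP g _.
have eQ u v : a <= u <= b -> a <= v <= b ->
    rint c d (fun y => Q u y - Q v y) = rint c d (Q u) - rint c d (Q v).
  by move=> hu hv; rewrite rintB//; apply: (closed_form_contQ g).
by rewrite !eQ ?lexx ?am ?ab ?mb//; ring.
Qed.

Lemma circulation_splity a b c m d : a <= b -> c <= m -> m <= d -> closed_form a b c d ->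
  circulation a b c d = circulation a b c m + circulation a b m d.
Proof.
move=> ab cm md g; have cd := le_trans cm md.
have hc : a <= a <= b by rewrite lexx. have hd : a <= b <= b by rewrite lexx ab.
have hm : c <= m <= d by rewrite cm.
have hc' : c <= c <= d by rewrite lexx. have hd' : c <= d <= d by rewrite lexx cd.
rewrite /circulation (rint_split cm md); last by apply: cont_itvB; exact: closed_form_contQ g _.
have eP u v : c <= u <= d -> c <= v <= d ->
    rint a b (fun x => P x u - P x v) = rint a b (P^~ u) - rint a b (P^~ v).
  by move=> hu hv; rewrite rintB//; apply: (closed_form_contP g).
by rewrite !eP//; ring.
Qed.

Record box := Box { bx0 : R; bx1 : R; by0 : R; by1 : R }.

Definition boxval q := `|circulation (bx0 q) (bx1 q) (by0 q) (by1 q)|.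
Definition wf q := bx0 q <= bx1 q /\ by0 q <= by1 q.
Definition box_closed q := closed_form (bx0 q) (bx1 q) (by0 q) (by1 q).
Definition half_of q q' := [/\ bx0 q <= bx0 q', bx1 q' <= bx1 q, by0 q <= by0 q' & by1 q' <= by1 q]
  /\ bx1 q' - bx0 q' = (bx1 q - bx0 q) / 2 /\ by1 q' - by0 q' = (by1 q - by0 q) / 2.

(** One bisection step: the circulation is additive, so that one of the four quarters
    carries at least a quarter of it. *)
Lemma quarter q : wf q -> box_closed q -> exists q', half_of q q' /\ boxval q <= 4 * boxval q'.
Proof.
case: q => a b c d [/= ab cd]; rewrite /box_closed /= => g.
pose m := (a + b) / 2; pose n := (c + d) / 2.
have am : a <= m by rewrite /m; lra.
have mb : m <= b by rewrite /m; lra.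
have cn : c <= n by rewrite /n; lra.
have nd : n <= d by rewrite /n; lra.
have m1 : m - a = (b - a) / 2 by rewrite /m; lra.
have m2 : b - m = (b - a) / 2 by rewrite /m; lra.
have n1 : n - c = (d - c) / 2 by rewrite /n; lra.
have n2 : d - n = (d - c) / 2 by rewrite /n; lra.
have E : circulation a b c d = circulation a m c n + circulation a m n d + (circulation m b c n + circulation m b n d).
  rewrite (circulation_splitx am mb cd g) (circulation_splity am cn nd) ?(circulation_splity mb cn nd)//.
    by apply: closed_formS g _ _ _ _.
  by apply: closed_formS g _ _ _ _.
have T : `|circulation a b c d| <= `|circulation a m c n| + `|circulation a m n d| + (`|circulation m b c n| + `|circulation m b n d|).
  by rewrite E; apply: (le_trans (ler_normD _ _)); apply: lerD; exact: ler_normD.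
rewrite /boxval /half_of /=.
have [h1|h1] := leP `|circulation a b c d| (4 * `|circulation a m c n|).
  by exists (Box a m c n).
have [h2|h2] := leP `|circulation a b c d| (4 * `|circulation a m n d|).
  by exists (Box a m n d).
have [h3|h3] := leP `|circulation a b c d| (4 * `|circulation m b c n|).
  by exists (Box m b c n).
exists (Box m b n d); split => //=.
by move: T h1 h2 h3; clear; lra.
Qed.

(** The form differs by at most [e (|x' - x| + |y' - y|)] from its first-order expansion,
    which is exact because the form is closed. *)
Lemma circulation_small a b c d x y p1 s q2 e dl : a <= b -> c <= d -> closed_form a b c d ->
  a <= x <= b -> c <= y <= d -> 0 <= e ->
  (forall x' y', `|x' - x| < dl -> `|y' - y| < dl ->
    `|P x' y' - P x y - (p1 * (x' - x) + s * (y' - y))| <= e * (`|x' - x| + `|y' - y|)) ->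
  (forall x' y', `|x' - x| < dl -> `|y' - y| < dl ->
    `|Q x' y' - Q x y - (s * (x' - x) + q2 * (y' - y))| <= e * (`|x' - x| + `|y' - y|)) ->
  b - a < dl -> d - c < dl ->
  `|circulation a b c d| <= 2 * e * (b - a + (d - c)) ^+ 2.
Proof.
move=> ab cd g /andP[x1 x2] /andP[y1 y2] e0 dP dQ bad dcd.
set W := b - a; set H := d - c.
have nx x' : a <= x' <= b -> `|x' - x| <= W.
  by move=> /andP[h1 h2]; rewrite ler_norml /W; apply/andP; split; lra.
have ny y' : c <= y' <= d -> `|y' - y| <= H.
  by move=> /andP[h1 h2]; rewrite ler_norml /H; apply/andP; split; lra.
have hc : c <= c <= d by rewrite lexx. have hd : c <= d <= d by rewrite lexx cd.
have ha : a <= a <= b by rewrite lexx. have hb : a <= b <= b by rewrite lexx ab.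
have eP x' y' : a <= x' <= b -> c <= y' <= d ->
    `|P x' y' - P x y - (p1 * (x' - x) + s * (y' - y))| <= e * (W + H).
  move=> h1 h2; have h3 := nx _ h1; have h4 := ny _ h2.
  apply: le_trans (dP _ _ (le_lt_trans h3 bad) (le_lt_trans h4 dcd)) _.
  by rewrite ler_wpM2l// lerD.
have eQ x' y' : a <= x' <= b -> c <= y' <= d ->
    `|Q x' y' - Q x y - (s * (x' - x) + q2 * (y' - y))| <= e * (W + H).
  move=> h1 h2; have h3 := nx _ h1; have h4 := ny _ h2.
  apply: le_trans (dQ _ _ (le_lt_trans h3 bad) (le_lt_trans h4 dcd)) _.
  by rewrite ler_wpM2l// lerD.
have I1 : `|rint a b (fun x => P x c - P x d) - (s * (c - d)) * (b - a)| <= (2 * (e * (W + H))) * (b - a).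
  apply: rint_near => //; first by apply: cont_itvB; exact: closed_form_contP g _.
  move=> x' hx'; have := eP x' c hx' hc; have := eP x' d hx' hd.
  rewrite !ler_norml => /andP[u1 u2] /andP[u3 u4]; apply/andP; split; lra.
have I2 : `|rint c d (fun y => Q b y - Q a y) - (s * (b - a)) * (d - c)| <= (2 * (e * (W + H))) * (d - c).
  apply: rint_near => //; first by apply: cont_itvB; exact: closed_form_contQ g _.
  move=> y' hy'; have := eQ b y' hb hy'; have := eQ a y' ha hy'.
  rewrite !ler_norml => /andP[u1 u2] /andP[u3 u4]; apply/andP; split; lra.
rewrite /circulation.
set A := rint _ _ _ in I1 *; set B := rint _ _ _ in I2 *.
have -> : A + B = (A - s * (c - d) * (b - a)) + (B - s * (b - a) * (d - c)) by ring.
apply: le_trans (ler_normD _ _) _; apply: le_trans (lerD I1 I2) _.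
by rewrite -/W -/H le_eqVlt; apply/orP; left; apply/eqP; ring.
Qed.

(** Goursat's argument, which needs no continuity of the derivatives: nested boxes
    carrying at least [4 ^- n] of the circulation shrink to a point, near which the
    circulation is negligible compared to the area. *)
Theorem green_goursat a b c d : a <= b -> c <= d -> closed_form a b c d -> circulation a b c d = 0.
Proof.
move=> ab cd g; apply/eqP; rewrite -normr_le0 leNgt; apply/negP => J0.
set J := `|_| in J0.
have step q : {q' | wf q -> box_closed q -> half_of q q' /\ boxval q <= 4 * boxval q'}.
  apply: cid; case: (pselect (wf q /\ box_closed q)) => [[w gq]|n].
    by have [q' hq'] := quarter w gq; exists q'.
  by exists q => w gq; case: n.
pose sq n := iter n (fun q => sval (step q)) (Box a b c d).
have sqP n : [/\ wf (sq n), box_closed (sq n), J <= 4 ^+ n * boxval (sq n),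
    bx1 (sq n) - bx0 (sq n) = (b - a) / 2 ^+ n & by1 (sq n) - by0 (sq n) = (d - c) / 2 ^+ n].
  elim: n => [|n [w gq hJ hx hy]].
    by rewrite /sq /= !expr0 !divr1 mul1r; split.
  have [[[h1 h2 h3 h4] [h5 h6]] hv] := svalP (step (sq n)) w gq.
  rewrite -/(sq n.+1) in h1 h2 h3 h4 h5 h6 hv *.
  case: w => w1 w2; split.
  - by split; lra.
  - exact: closed_formS gq _ _ _ _.
  - by rewrite exprSr -mulrA; apply: le_trans hJ _; rewrite ler_wpM2l// exprn_ge0.
  - by rewrite h5 hx exprSr invfM mulrA.
  - by rewrite h6 hy exprSr invfM mulrA.
have sqS n : half_of (sq n) (sq n.+1).
  have [w gq _ _ _] := sqP n; exact: (svalP (step (sq n)) w gq).1.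
have mono m n : (m <= n)%N -> [/\ bx0 (sq m) <= bx0 (sq n), bx1 (sq n) <= bx1 (sq m),
    by0 (sq m) <= by0 (sq n) & by1 (sq n) <= by1 (sq m)].
  elim: n => [|n ih]; first by rewrite leqn0 => /eqP ->; split.
  rewrite leq_eqVlt => /predU1P[->|]; first by split.
  move=> /ih[i1 i2 i3 i4]; have [[h1 h2 h3 h4] _] := sqS n.
  by split; [exact: le_trans h1|exact: le_trans i2|exact: le_trans h3|exact: le_trans i4].
have nest m n : bx0 (sq m) <= bx1 (sq n) /\ by0 (sq m) <= by1 (sq n).
  case: (leqP m n) => mn.
    have [i1 i2 i3 i4] := mono _ _ mn; have [[w1 w2] _ _ _ _] := sqP n.
    by split; [exact: le_trans w1|exact: le_trans w2].
  have [i1 i2 i3 i4] := mono _ _ (ltnW mn); have [[w1 w2] _ _ _ _] := sqP m.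
  by split; [exact: le_trans i2|exact: le_trans i4].
pose x := sup [set bx0 (sq n) | n in [set: nat]].
pose y := sup [set by0 (sq n) | n in [set: nat]].
have xn n : bx0 (sq n) <= x <= bx1 (sq n).
  apply/andP; split.
    apply: sup_upper_bound; last by exists n.
    split; first by exists (bx0 (sq 0)); exists 0%N.
    by exists (bx1 (sq 0)) => _ [m _ <-]; have [] := nest m 0%N.
  apply: sup_le_ub; first by exists (bx0 (sq 0)); exists 0%N.
  by move=> _ [m _ <-]; have [] := nest m n.
have yn n : by0 (sq n) <= y <= by1 (sq n).
  apply/andP; split.
    apply: sup_upper_bound; last by exists n.
    split; first by exists (by0 (sq 0)); exists 0%N.
    by exists (by1 (sq 0)) => _ [m _ <-]; have [] := nest m 0%N.
  apply: sup_le_ub; first by exists (by0 (sq 0)); exists 0%N.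
  by move=> _ [m _ <-]; have [] := nest m n.
have [p1 [s [q2 [gP gQ]]]] := g x y (xn 0%N) (yn 0%N).
pose L := b - a + (d - c).
have L0 : 0 <= L by rewrite /L; lra.
pose e := J / (2 * (L ^+ 2 + 1)) / 2.
have L1 : 0 < L ^+ 2 + 1 by rewrite ltr_pwDr// sqr_ge0.
have e0 : 0 < e by rewrite /e !divr_gt0// mulr_gt0.
have [d1 d10 dP] := gP e e0.
have [d2 d20 dQ] := gQ e e0.
pose dl := Num.min d1 d2.
have dl0 : 0 < dl by rewrite lt_min d10.
have dl1 : dl <= d1 by rewrite ge_min lexx.
have dl2 : dl <= d2 by rewrite ge_min lexx orbT.
have [n nL] : exists n, L / 2 ^+ n < dl.
  have : (L * (2^-1) ^+ n @[n --> \oo] --> L * 0).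
    by apply: cvgMr; apply: cvg_expr; rewrite ger0_norm; lra.
  rewrite mulr0 => /cvgrPdist_lt/(_ _ dl0)[n _ /(_ n (leqnn n))] /=.
  rewrite sub0r normrN ger0_norm ?mulr_ge0 ?exprn_ge0 ?invr_ge0// => h.
  by exists n; rewrite -exprVn.
have [[w1 w2] gq hJ hx hy] := sqP n.
have p2 : 0 < 2 ^+ n :> R by rewrite exprn_gt0.
have xd : bx1 (sq n) - bx0 (sq n) < dl.
  rewrite hx; apply: le_lt_trans nL; rewrite ler_pM2r ?invr_gt0// /L; lra.
have yd : by1 (sq n) - by0 (sq n) < dl.
  rewrite hy; apply: le_lt_trans nL; rewrite ler_pM2r ?invr_gt0// /L; lra.
have hb : boxval (sq n) <= _ := circulation_small w1 w2 gq (xn n) (yn n) (ltW e0) 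
  (fun x' y' h1 h2 => dP x' y' (lt_le_trans h1 dl1) (lt_le_trans h2 dl1))
  (fun x' y' h1 h2 => dQ x' y' (lt_le_trans h1 dl2) (lt_le_trans h2 dl2)) xd yd.
move: hb; rewrite hx hy -mulrDl -/L => hb.
have : J <= 2 * e * L ^+ 2.
  apply: le_trans hJ _; apply: (le_trans (ler_wpM2l _ hb)); first by rewrite exprn_ge0.
  rewrite (_ : 4 = 2 ^+ 2); last by ring.
  rewrite exprAC exprMn exprVn le_eqVlt; apply/orP; left; apply/eqP.
  by field; rewrite gt_eqF.
apply/negP; rewrite -ltNge /e.
have -> : 2 * (J / (2 * (L ^+ 2 + 1)) / 2) * L ^+ 2 = J * (L ^+ 2 / (2 * (L ^+ 2 + 1))).
  by field; rewrite gt_eqF.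
rewrite gtr_pMr// ltr_pdivrMr ?mulr_gt0//; have := sqr_ge0 L; lra.
Qed.

End box.
End green.

(** * Complex differentiability and polar coordinates *)

Section cdiff.
Variable R : realType.
Implicit Types (f g : R[i] -> R[i]) (z w : R[i]).

(** Difference quotients are multiplied out, so that [w = z] needs no separate treatment,
    and the modulus is the [R]-valued one; [derivable_cdiff] is the link with derivability
    in the normed module of complex numbers. *)
Definition cdiff_at f z d := forall e : R, 0 < e -> exists2 dl : R, 0 < dl &
  forall w, cmod (w - z) < dl -> cmod (f w - f z - d * (w - z)) <= e * cmod (w - z).

Definition cdiff f z := exists d, cdiff_at f z d.

Definition cctn f z := forall e : R, 0 < e -> exists2 dl : R, 0 < dl &
  forall w, cmod (w - z) < dl -> cmod (f w - f z) < e.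

Lemma normC_cmod z : `|z| = Complex (cmod z) 0.
Proof. by case: z => a b; rewrite normc_def. Qed.

Lemma cmod_lt_norm z (e : R) : (`|z| < Complex e 0) = (cmod z < e).
Proof. by rewrite normC_cmod ltcE /= eqxx. Qed.

Lemma cmod_le_norm z (e : R) : (`|z| <= Complex e 0) = (cmod z <= e).
Proof. by rewrite normC_cmod lecE /= eqxx. Qed.

Lemma pos_complex (e : R[i]) : 0 < e -> exists2 e' : R, 0 < e' & e = Complex e' 0.
Proof. by case: e => a b; rewrite ltcE /= => /andP[/eqP -> a0]; exists a. Qed.

Lemma derivable_cdiff (f : CC R -> CC R) (z : CC R) : derivable f z 1 <-> cdiff f z.
Proof.
split.
  move=> /cvg_ex[/= l] /cvgrPdist_le H; exists l => e e0.
  have e0' : 0 < Complex e 0 by rewrite ltcE /= eqxx.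
  have /= := H _ e0'; rewrite /dnbhs /within/= => /nbhs_ballP[/= d d0 hd].
  have [d' d'0 dE] := pos_complex d0.
  exists d' => // w wd.
  have [->|wz] := eqVneq w z; first by rewrite !subrr mulr0 subr0 cmod0 mulr0.
  have := hd (w - z); rewrite /ball/= sub0r normrN dE cmod_lt_norm => /(_ wd).
  rewrite subr_eq0 => /(_ wz).
  rewrite cmod_le_norm /GRing.scale/= mulr1 subrK.
  have wz0 : w - z != 0 by rewrite subr_eq0.
  set u := cmod _ => ue.
  have -> : f w - f z - l * (w - z) = - (l - (w - z)^-1 * (f w - f z)) * (w - z).
    by rewrite mulNr mulrBl mulrAC mulVf// mul1r opprB.
  by rewrite cmodM cmodN ler_wpM2r// cmod_ge0.
move=> [l H]; apply/cvg_ex; exists l; apply/cvgrPdist_le => /= e /pos_complex[e' e0 ->].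
have [d d0 hd] := H _ e0.
rewrite /dnbhs /within/=; apply/nbhs_ballP; exists (Complex d 0) => /=.
  by rewrite ltcE /= eqxx.
move=> h; rewrite /ball/= sub0r normrN cmod_lt_norm => hd' h0.
rewrite cmod_le_norm /GRing.scale/= mulr1.
have := hd (h + z); rewrite addrK => /(_ hd').
have hh : 0 < cmod h by rewrite cmod_gt0.
rewrite -ler_pdivrMr//; apply: le_trans; rewrite ler_pdivlMr// -cmodM.
rewrite -cmodN le_eqVlt; apply/orP; left; apply/eqP; congr cmod.
by rewrite mulrBl mulrAC mulVf// mul1r opprB.
Qed.

Lemma cdiff_cctn f z : cdiff f z -> cctn f z.
Proof.
move=> [l H] e e0; have [d d0 hd] := H 1 ltr01.
have l0 : 0 < 1 + cmod l by rewrite ltr_pwDl// cmod_ge0.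
exists (Num.min d (e / (1 + cmod l))); first by rewrite lt_min d0 divr_gt0.
move=> w; rewrite lt_min => /andP[/hd h1]; rewrite ltr_pdivlMr// => h2.
have -> : f w - f z = (f w - f z - l * (w - z)) + l * (w - z) by ring.
apply: le_lt_trans (ler_cmodD _ _) _; rewrite cmodM.
apply: le_lt_trans h2; rewrite mul1r in h1.
by apply: le_trans (lerD h1 (lexx _)) _; rewrite mulrDr mulr1 mulrC.
Qed.

Lemma cdiff_cst (c : R[i]) z : cdiff (fun=> c) z.
Proof.
exists 0 => e e0; exists 1 => // w _; rewrite mul0r !subrr cmod0.
by rewrite mulr_ge0 ?cmod_ge0// ltW.
Qed.

Lemma cdiff_id z : cdiff id z.
Proof.
exists 1 => e e0; exists 1 => // w _; rewrite mul1r subrr cmod0.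
by rewrite mulr_ge0 ?cmod_ge0// ltW.
Qed.

Lemma cdiffD f g z : cdiff f z -> cdiff g z -> cdiff (fun w => f w + g w) z.
Proof.
move=> [a fa] [b gb]; exists (a + b) => e e0.
have e2 : 0 < e / 2 by rewrite divr_gt0.
have [d1 d10 h1] := fa _ e2; have [d2 d20 h2] := gb _ e2.
exists (Num.min d1 d2); first by rewrite lt_min d10.
move=> w; rewrite lt_min => /andP[/h1 k1 /h2 k2].
have -> : f w + g w - (f z + g z) - (a + b) * (w - z) =
  (f w - f z - a * (w - z)) + (g w - g z - b * (w - z)) by ring.
apply: le_trans (ler_cmodD _ _) _; lra.
Qed.

Lemma cdiffM f g z : cdiff f z -> cdiff g z -> cdiff (fun w => f w * g w) z.
Proof.
move=> cf cg; have := cdiff_cctn cg; move: cf cg => [a fa] [b gb] cg.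
exists (a * g z + f z * b) => e e0.
pose M := cmod (g z) + 1 + cmod (f z) + cmod a.
have M0 : 0 < M by rewrite /M; have := cmod_ge0 (g z); have := cmod_ge0 (f z); have := cmod_ge0 a; lra.
have e3 : 0 < e / (3 * M) by rewrite divr_gt0// mulr_gt0.
have e3' : 0 < Num.min 1 (e / (3 * M)) by rewrite lt_min ltr01.
have [d1 d10 h1] := fa _ e3; have [d2 d20 h2] := gb _ e3.
have [d3 d30 h3] := cg _ e3'.
exists (Num.min d1 (Num.min d2 d3)); first by rewrite !lt_min d10 d20.
move=> w; rewrite !lt_min => /and3P[/h1 k1 /h2 k2 /h3].
rewrite lt_min => /andP[k3 k4].
have -> : f w * g w - f z * g z - (a * g z + f z * b) * (w - z) =
  (f w - f z - a * (w - z)) * g w + (a * (w - z)) * (g w - g z) + f z * (g w - g z - b * (w - z)) by ring.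
apply: le_trans (ler_cmodD _ _) _.
have u1 : cmod ((f w - f z - a * (w - z)) * g w) <= e / 3 * cmod (w - z).
  rewrite cmodM.
  have gw : cmod (g w) <= M.
    have -> : g w = (g w - g z) + g z by ring.
    apply: le_trans (ler_cmodD _ _) _; rewrite /M.
    have := cmod_ge0 (f z); have := cmod_ge0 a; lra.
  apply: le_trans (ler_pM (cmod_ge0 _) (cmod_ge0 _) k1 gw) _.
  rewrite le_eqVlt; apply/orP; left; apply/eqP; field; rewrite gt_eqF//.
have u2 : cmod ((a * (w - z)) * (g w - g z)) <= e / 3 * cmod (w - z).
  rewrite !cmodM mulrAC ler_wpM2r ?cmod_ge0//.
  have aM : cmod a <= M by rewrite /M; have := cmod_ge0 (g z); have := cmod_ge0 (f z); lra.
  apply: le_trans (ler_pM (cmod_ge0 _) (cmod_ge0 _) aM (ltW k4)) _.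
  rewrite le_eqVlt; apply/orP; left; apply/eqP; field; rewrite gt_eqF//.
have u3 : cmod (f z * (g w - g z - b * (w - z))) <= e / 3 * cmod (w - z).
  have fM : cmod (f z) <= M by rewrite /M; have := cmod_ge0 (g z); have := cmod_ge0 a; lra.
  rewrite cmodM; apply: le_trans (ler_pM (cmod_ge0 _) (cmod_ge0 _) fM k2) _.
  rewrite le_eqVlt; apply/orP; left; apply/eqP; field; rewrite gt_eqF//.
apply: le_trans (lerD (ler_cmodD _ _) (lexx _)) _.
apply: le_trans (lerD (lerD u1 u2) u3) _; lra.
Qed.

Lemma cdiffN f z : cdiff f z -> cdiff (fun w => - f w) z.
Proof.
move=> cf; have := cdiffM (cdiff_cst (-1) z) cf.
by congr (cdiff _ z); apply/funext => w; rewrite mulN1r.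
Qed.

Lemma cdiffB f g z : cdiff f z -> cdiff g z -> cdiff (fun w => f w - g w) z.
Proof. by move=> cf cg; apply: cdiffD => //; exact: cdiffN. Qed.

Lemma cdiffX f n z : cdiff f z -> cdiff (fun w => f w ^+ n) z.
Proof.
move=> cf; elim: n => [|n ih].
  by have := cdiff_cst 1 z; congr (cdiff _ z); apply/funext => w; rewrite expr0.
by have := cdiffM cf ih; congr (cdiff _ z); apply/funext => w; rewrite exprS.
Qed.

Lemma cdiff_inv z : z != 0 -> cdiff (fun w => w^-1) z.
Proof.
move=> z0; exists (- z^-1 ^+ 2) => e e0.
have cz : 0 < cmod z by rewrite cmod_gt0.
exists (Num.min (cmod z / 2) (e * cmod z ^+ 3 / 2)).
  by rewrite lt_min !divr_gt0// mulr_gt0// exprn_gt0.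
move=> w; rewrite lt_min => /andP[h1 h2].
have wz : cmod z / 2 < cmod w.
  have := ler_distB z w; rewrite cmodC; lra.
have w0 : w != 0 by rewrite -cmod_gt0; apply: lt_trans wz; rewrite divr_gt0.
have -> : w^-1 - z^-1 - - z^-1 ^+ 2 * (w - z) = (w - z) ^+ 2 * (w^-1 * z^-1 ^+ 2).
  by field; apply/andP.
rewrite cmodM !cmodX expr2 -mulrA mulrC ler_wpM2r ?cmod_ge0//.
rewrite cmodM cmodX !cmodV.
have -> : cmod (w - z) * ((cmod w)^-1 * (cmod z)^-1 ^+ 2) = cmod (w - z) / (cmod w * cmod z ^+ 2).
  by field; rewrite !gt_eqF// cmod_gt0.
rewrite ler_pdivrMr ?mulr_gt0 ?exprn_gt0 ?cmod_gt0//.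
apply: (le_trans (ltW h2)).
have -> : e * cmod z ^+ 3 / 2 = e * (cmod z / 2 * cmod z ^+ 2) by field.
by rewrite ler_pM2l// ler_wpM2r ?exprn_ge0 ?cmod_ge0// ltW.
Qed.

Lemma cdiff_affine f a b z : cdiff f (a * z + b) -> cdiff (fun w => f (a * w + b)) z.
Proof.
move=> [l H]; exists (l * a) => e e0.
have a0 : 0 < cmod a + 1 by rewrite ltr_wpDl// cmod_ge0.
have [d d0 hd] := H (e / (cmod a + 1)) ltac:(by rewrite divr_gt0).
exists (d / (cmod a + 1)); first by rewrite divr_gt0.
move=> w; rewrite ltr_pdivlMr// => hw.
have E : a * w + b - (a * z + b) = a * (w - z) by ring.
have := hd (a * w + b); rewrite E cmodM => /(_ _).
have h0 := cmod_ge0 (w - z).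
rewrite mulrA => h; apply: le_trans (h _) _.
  by apply: le_lt_trans hw; rewrite mulrC ler_wpM2l// lerDl.
rewrite mulrA ler_wpM2r//.
rewrite mulrAC ler_pdivrMr// ler_wpM2l ?(ltW e0)// lerDl//.
Qed.

Lemma cctn_cmod f z : cctn f z -> forall e : R, 0 < e -> exists2 dl : R, 0 < dl &
  forall w, cmod (w - z) < dl -> `|cmod (f w) - cmod (f z)| < e.
Proof.
move=> cf e e0; have [d d0 h] := cf e e0; exists d => // w /h; apply: le_lt_trans.
rewrite ler_norml ler_distB andbT lerNl opprB cmodC; exact: ler_distB.
Qed.

Definition expi (x : R) : R[i] := Complex (cos x) (sin x).

Lemma cmod_expi x : cmod (expi x) = 1.
Proof. by rewrite /expi /= cos2Dsin2 sqrtr1. Qed.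

(** The complex exponential of [s + i x]: in the coordinates [(s, x)], the region between
    two circles about 0 is a rectangle, with opposite sides along [s] glued together. *)
Definition polar (s x : R) : R[i] := Complex (expR s) 0 * expi x.

Lemma cmod_polar s x : cmod (polar s x) = expR s.
Proof. by rewrite cmodM cmod_expi cmod_real mulr1 ger0_norm// expR_ge0. Qed.

Lemma is_derive_eps (a : R -> R) (x a' : R) : is_derive x (1 : R) a a' ->
  forall e : R, 0 < e -> exists2 dl : R, 0 < dl &
  forall y, `|y - x| < dl -> `|a y - a x - a' * (y - x)| <= e * `|y - x|.
Proof.
move=> [/cvg_ex[/= l lh]]; rewrite /derive (cvg_lim _ lh)// => <- e e0.
move/cvgrPdist_le : lh => /(_ _ e0); rewrite /= /dnbhs /within/=.
move=> /nbhs_ballP[/= d d0 hd]; exists d => // y yd.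
have [->|yx] := eqVneq y x; first by rewrite !subrr mulr0 subr0 normr0 mulr0.
have := hd (y - x); rewrite /ball/= sub0r normrN subr_eq0 => /(_ yd yx).
rewrite /GRing.scale/= mulr1 subrK => h.
have yx0 : y - x != 0 by rewrite subr_eq0.
have -> : a y - a x - l * (y - x) = - (l - (y - x)^-1 * (a y - a x)) * (y - x) by field.
by rewrite normrM normrN ler_wpM2r.
Qed.

Lemma gdiff_prod (a b : R -> R) (x y a' b' : R) : is_derive x (1 : R) a a' -> is_derive y (1 : R) b b' ->
  gdiff (fun x y => a x * b y) x y (a' * b y) (a x * b').
Proof.
move=> /is_derive_eps da /is_derive_eps db e e0.
pose M := `|a x| + `|b y| + `|a'| + `|b'| + 1.
have [nax nby na' nb'] : [/\ 0 <= `|a x|, 0 <= `|b y|, 0 <= `|a'| & 0 <= `|b'|] by split.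
have M0 : 0 < M by rewrite /M; lra.
pose e1 := Num.min 1 (e / (2 * M)).
have e10 : 0 < e1 by rewrite lt_min ltr01 divr_gt0// mulr_gt0.
have e1M : e1 * M <= e / 2.
  have : e1 <= e / (2 * M) by rewrite ge_min lexx orbT.
  move=> h; apply: le_trans (ler_wpM2r (ltW M0) h) _.
  by rewrite le_eqVlt; apply/orP; left; apply/eqP; field; rewrite gt_eqF.
have e11 : e1 <= 1 by rewrite ge_min lexx.
have [d1 d10 h1] := da _ e10; have [d2 d20 h2] := db _ e10.
pose d3 := e / (2 * (M * M)).
have d30 : 0 < d3 by rewrite divr_gt0// !mulr_gt0.
exists (Num.min d1 (Num.min d2 d3)); first by rewrite !lt_min d10 d20.
move=> x' y'; rewrite !lt_min => /and3P[/h1 k1 _ _] /and3P[_ /h2 k2 k3].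
set dx := x' - x in k1 *; set dy := y' - y in k2 k3 *.
have -> : a x' * b y' - a x * b y - (a' * b y * dx + a x * b' * dy) =
  (a x' - a x - a' * dx) * b y + a x * (b y' - b y - b' * dy) + (a x' - a x) * (b y' - b y) by ring.
have u1 : `|a x' - a x| <= M * `|dx|.
  have -> : a x' - a x = (a x' - a x - a' * dx) + a' * dx by ring.
  apply: le_trans (ler_normD _ _) _; rewrite normrM.
  have k1' := le_trans k1 (ler_wpM2r (normr_ge0 dx) e11).
  have : (1 + `|a'|) * `|dx| <= M * `|dx| by rewrite ler_wpM2r// /M; lra.
  rewrite mulrDl; lra.
have u2 : `|b y' - b y| <= M * `|dy|.
  have -> : b y' - b y = (b y' - b y - b' * dy) + b' * dy by ring.
  apply: le_trans (ler_normD _ _) _; rewrite normrM.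
  have k2' := le_trans k2 (ler_wpM2r (normr_ge0 dy) e11).
  have : (1 + `|b'|) * `|dy| <= M * `|dy| by rewrite ler_wpM2r// /M; lra.
  rewrite mulrDl; lra.
have v1 : `|(a x' - a x - a' * dx) * b y| <= e / 2 * `|dx|.
  rewrite normrM mulrC; apply: le_trans (ler_wpM2l nby k1) _.
  rewrite mulrA ler_wpM2r// mulrC; apply: le_trans e1M; rewrite ler_pM2l// /M; lra.
have v2 : `|a x * (b y' - b y - b' * dy)| <= e / 2 * `|dy|.
  rewrite normrM; apply: le_trans (ler_wpM2l nax k2) _.
  rewrite mulrA ler_wpM2r// mulrC; apply: le_trans e1M; rewrite ler_pM2l// /M; lra.
have v3 : `|(a x' - a x) * (b y' - b y)| <= e / 2 * `|dx|.
  rewrite normrM; apply: le_trans (ler_pM (normr_ge0 _) (normr_ge0 _) u1 u2) _.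
  rewrite (_ : M * `|dx| * (M * `|dy|) = `|dy| * (M * M) * `|dx|); last by ring.
  apply: ler_wpM2r => //.
  by move: k3; rewrite /d3 ltr_pdivlMr ?mulr_gt0// => k3; lra.
apply: le_trans (ler_normD _ _) _.
apply: le_trans (lerD (ler_normD _ _) (lexx _)) _.
apply: le_trans (lerD (lerD v1 v2) v3) _.
rewrite mulrDr; have : 0 <= e * `|dy| by rewrite mulr_ge0// ltW.
lra.
Qed.

Lemma polar_diff s x : forall e : R, 0 < e -> exists2 dl : R, 0 < dl & forall s' x',
  `|s' - s| < dl -> `|x' - x| < dl ->
  cmod (polar s' x' - polar s x - polar s x * Complex (s' - s) (x' - x)) <= e * (`|s' - s| + `|x' - x|).
Proof.
move=> e e0; have e2 : 0 < e / 2 by rewrite divr_gt0.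
have [d1 d10 h1] := gdiff_prod (is_derive_expR s) (is_derive_cos x) e2.
have [d2 d20 h2] := gdiff_prod (is_derive_expR s) (is_derive_sin x) e2.
exists (Num.min d1 d2); first by rewrite lt_min d10.
move=> s' x'; rewrite !lt_min => /andP[a1 a2] /andP[b1 b2].
have := h1 _ _ a1 b1; have := h2 _ _ a2 b2 => k2 k1.
apply: le_trans (cmod_le_ReIm _) _; rewrite /polar /expi /= !mul0r !subr0 !addr0.
have -> : expR s' * cos x' - expR s * cos x - (expR s * cos x * (s' - s) - expR s * sin x * (x' - x))
  = expR s' * cos x' - expR s * cos x - (expR s * cos x * (s' - s) + expR s * (- sin x) * (x' - x)) by ring.
have -> : expR s' * sin x' - expR s * sin x - (expR s * cos x * (x' - x) + expR s * sin x * (s' - s))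
  = expR s' * sin x' - expR s * sin x - (expR s * sin x * (s' - s) + expR s * cos x * (x' - x)) by ring.
apply: le_trans (lerD k1 k2) _; lra.
Qed.

(** With [A = f'(w) w] at [w = polar s x], the derivatives of [f] along [s] and [x] are
    [A] and [i A]; these are the Cauchy-Riemann equations in logarithmic polar
    coordinates. *)
Lemma polar_cdiff f s x d : cdiff_at f (polar s x) d -> let A := d * polar s x in
  gdiff (fun s x => cRe (f (polar s x))) s x (cRe A) (- cIm A) /\
  gdiff (fun s x => cIm (f (polar s x))) s x (cIm A) (cRe A).
Proof.
move=> H A.
have key : forall e : R, 0 < e -> exists2 dl : R, 0 < dl & forall s' x',
  `|s' - s| < dl -> `|x' - x| < dl ->
  cmod (f (polar s' x') - f (polar s x) - A * Complex (s' - s) (x' - x)) <= e * (`|s' - s| + `|x' - x|).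
  move=> e e0.
  pose r := expR s; have r0 : 0 < r by exact: expR_gt0.
  pose M := r + 1 + cmod d.
  have M0 : 0 < M by rewrite /M; have := cmod_ge0 d; lra.
  have e1 : 0 < e / (2 * M) by rewrite divr_gt0// mulr_gt0.
  have e2 : 0 < Num.min 1 (e / (2 * M)) by rewrite lt_min ltr01.
  have [d1 d10 h1] := H _ e1.
  have [d2 d20 h2] := polar_diff s x e2.
  have d3 : 0 < d1 / (2 * M) by rewrite divr_gt0// mulr_gt0.
  exists (Num.min d2 (d1 / (2 * M))); first by rewrite lt_min d20.
  move=> s' x'; rewrite !lt_min => /andP[a1 a2] /andP[b1 b2].
  have k := h2 _ _ a1 b1.
  set S := `|s' - s| + `|x' - x| in k *.
  have S0 : 0 <= S by rewrite addr_ge0.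
  have k1 : cmod (polar s' x' - polar s x) <= M * S.
    set p := polar s' x' in k *; set q := polar s x in k *.
    have -> : p - q = (p - q - q * Complex (s' - s) (x' - x)) + q * Complex (s' - s) (x' - x) by ring.
    apply: le_trans (ler_cmodD _ _) _; rewrite cmodM cmod_polar -/r.
    have c1 : cmod (Complex (s' - s) (x' - x)) <= S by exact: cmod_le_ReIm.
    have c2 : Num.min 1 (e / (2 * M)) * S <= S.
      by rewrite -[X in _ <= X]mul1r ler_wpM2r// ge_min lexx.
    have c3 : r * cmod (Complex (s' - s) (x' - x)) <= r * S by rewrite ler_pM2l.
    have c4 : (r + 1) * S <= M * S by rewrite ler_wpM2r// /M lerDl cmod_ge0.
    rewrite mulrDl mul1r in c4; lra.
  have k2 : cmod (polar s' x' - polar s x) < d1.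
    apply: le_lt_trans k1 _.
    have : S < d1 / M.
      have -> : d1 / M = d1 / (2 * M) + d1 / (2 * M) by field; rewrite gt_eqF.
      by rewrite /S ltrD.
    by rewrite ltr_pdivlMr// mulrC.
  have k3 := h1 _ k2.
  have -> : f (polar s' x') - f (polar s x) - A * Complex (s' - s) (x' - x) =
    (f (polar s' x') - f (polar s x) - d * (polar s' x' - polar s x)) +
    d * (polar s' x' - polar s x - polar s x * Complex (s' - s) (x' - x)).
    by rewrite /A; ring.
  apply: le_trans (ler_cmodD _ _) _; rewrite cmodM.
  have l1 : e / (2 * M) * cmod (polar s' x' - polar s x) <= e / 2 * S.
    apply: le_trans (ler_wpM2l (ltW e1) k1) _.
    by rewrite le_eqVlt; apply/orP; left; apply/eqP; field; rewrite gt_eqF.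
  have l2 : cmod d * cmod (polar s' x' - polar s x - polar s x * Complex (s' - s) (x' - x)) <= e / 2 * S.
    apply: le_trans (ler_wpM2l (cmod_ge0 _) k) _.
    rewrite mulrA ler_wpM2r//.
    have dM : cmod d <= M by rewrite /M; lra.
    apply: (@le_trans _ _ (M * (e / (2 * M)))).
      apply: ler_pM => //; first exact: cmod_ge0.
        exact: ltW.
      by rewrite ge_min lexx orbT.
    by rewrite le_eqVlt; apply/orP; left; apply/eqP; field; rewrite gt_eqF.
  apply: le_trans (lerD k3 (lexx _)) _.
  lra.
have reE (u v : R[i]) (a b : R) : cRe (u - v - A * Complex a b) = cRe u - cRe v - (cRe A * a + (- cIm A) * b).
  by move: u v (A) => [? ?] [? ?] [? ?] /=; ring.
have imE (u v : R[i]) (a b : R) : cIm (u - v - A * Complex a b) = cIm u - cIm v - (cIm A * a + cRe A * b).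
  by move: u v (A) => [? ?] [? ?] [? ?] /=; ring.
split => e e0; have [dl dl0 h] := key e e0; exists dl => // s' x' h1 h2.
  by rewrite -reE; apply: le_trans (ler_Re _) _; exact: h.
by rewrite -imE; apply: le_trans (ler_Im _) _; exact: h.
Qed.

End cdiff.

(** * Circle means and Fourier coefficients *)

Section cmean.
Variable R : realType.
Implicit Types (f : R[i] -> R[i]) (H F : R -> R[i]) (u v : R -> R) (t : R).
Local Notation tpi := (2 * (pi : R)).

Lemma tpi_gt0 : 0 < tpi. Proof. by rewrite mulr_gt0// pi_gt0. Qed.

(** Means over a full turn, first of real functions, then of complex ones. *)
Definition lmean (u : R -> R) : R := tpi^-1 * rint 0 tpi u.

Lemma lmeanD u v : continuous u -> continuous v -> lmean (fun x => u x + v x) = lmean u + lmean v.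
Proof. by move=> cu cv; rewrite /lmean rintD ?mulrDr// => x _; [exact: cu|exact: cv]. Qed.

Lemma lmeanZ (c : R) u : continuous u -> lmean (fun x => c * u x) = c * lmean u.
Proof. by move=> cu; rewrite /lmean rintZ 1?mulrCA// => x _; exact: cu. Qed.

Lemma lmean_cst (c : R) : lmean (fun=> c) = c.
Proof.
have t0 := tpi_gt0.
by rewrite /lmean rint_cst ?(ltW t0)// subr0 mulrCA mulVf ?mulr1// gt_eqF.
Qed.

Lemma le_lmean u v : continuous u -> continuous v -> (forall x, u x <= v x) -> lmean u <= lmean v.
Proof.
move=> cu cv uv; rewrite ler_pM2l ?invr_gt0 ?tpi_gt0//.
by apply: le_rint => // x _; [exact: cu|exact: cv].
Qed.

Definition cmean H : R[i] := Complex (lmean (fun x => cRe (H x))) (lmean (fun x => cIm (H x))).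

Definition ccurve H := continuous (fun x => cRe (H x)) /\ continuous (fun x => cIm (H x)).

Lemma ccurveD H F : ccurve H -> ccurve F -> ccurve (fun x => H x + F x).
Proof.
move=> [h1 h2] [f1 f2]; split.
  rewrite (_ : (fun x => cRe (H x + F x)) = (fun x => cRe (H x) + cRe (F x))).
    by move=> x; apply: cvgD; [exact: h1|exact: f1].
  by apply/funext => x; case: (H x) (F x) => ? ? [].
rewrite (_ : (fun x => cIm (H x + F x)) = (fun x => cIm (H x) + cIm (F x))).
  by move=> x; apply: cvgD; [exact: h2|exact: f2].
by apply/funext => x; case: (H x) (F x) => ? ? [].
Qed.

Lemma ccurveM H F : ccurve H -> ccurve F -> ccurve (fun x => H x * F x).
Proof.
move=> [h1 h2] [f1 f2]; split.
  rewrite (_ : (fun x => cRe (H x * F x)) = (fun x => cRe (H x) * cRe (F x) - cIm (H x) * cIm (F x))).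
    by move=> x; apply: cvgB; apply: cvgM; [exact: h1|exact: f1|exact: h2|exact: f2].
  by apply/funext => x; case: (H x) (F x) => ? ? [].
rewrite (_ : (fun x => cIm (H x * F x)) = (fun x => cRe (H x) * cIm (F x) + cIm (H x) * cRe (F x))).
  by move=> x; apply: cvgD; apply: cvgM; [exact: h1|exact: f2|exact: h2|exact: f1].
by apply/funext => x; case: (H x) (F x) => ? ? [].
Qed.

Lemma ccurve_cst (c : R[i]) : ccurve (fun=> c).
Proof. by split => x; exact: cvg_cst. Qed.

Lemma ccurve_expi : ccurve (@expi R).
Proof. by split => x; [exact: continuous_cos|exact: continuous_sin]. Qed.

Lemma ccurve_expiN : ccurve (fun x : R => expi (- x)).
Proof.
split => x; rewrite /expi /=.
  by under eq_fun do rewrite cosN; exact: continuous_cos.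
by under eq_fun do rewrite sinN; apply: cvgN; exact: continuous_sin.
Qed.

Lemma ccurveX H n : ccurve H -> ccurve (fun x => H x ^+ n).
Proof.
move=> cH; elim: n => [|n ih].
  by under eq_fun do rewrite expr0; exact: ccurve_cst.
by under eq_fun do rewrite exprS; exact: ccurveM.
Qed.

Definition circ (t x : R) : R[i] := Complex t 0 * expi x.

Lemma cmod_circ t x : 0 <= t -> cmod (circ t x) = t.
Proof. by move=> t0; rewrite cmodM cmod_expi cmod_real mulr1 ger0_norm. Qed.

Lemma polar_ln t x : 0 < t -> polar (ln t) x = circ t x.
Proof. by move=> t0; rewrite /polar lnK// posrE. Qed.

Lemma ccurve_comp f t : (forall x, cctn f (circ t x)) -> ccurve (fun x => f (circ t x)).
Proof.
move=> cf.
have key x e : 0 < e -> \forall y \near x, cmod (f (circ t y) - f (circ t x)) < e.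
  move=> e0; have [d d0 hd] := cf x e e0.
  have d2 : 0 < d / 2 / (`|t| + 1) by rewrite !divr_gt0// ltr_wpDl.
  have cc : (cos : R -> R) y @[y --> x] --> cos x by exact: continuous_cos.
  have cs : (sin : R -> R) y @[y --> x] --> sin x by exact: continuous_sin.
  have nc := cvgr_distC_lt _ _ cc _ d2; have ns := cvgr_distC_lt _ _ cs _ d2.
  near=> y; apply: hd; apply: le_lt_trans (cmod_le_ReIm _) _.
  have h1 : `|cos y - cos x| < d / 2 / (`|t| + 1) by near: y; exact: nc.
  have h2 : `|sin y - sin x| < d / 2 / (`|t| + 1) by near: y; exact: ns.
  rewrite /circ /expi /= !mul0r !subr0 !addr0 -!mulrBr !normrM.
  move: h1 h2; rewrite !ltr_pdivlMr ?ltr_wpDl// !mulrDr !mulr1 => h1 h2.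
  have := normr_ge0 (cos y - cos x); have := normr_ge0 (sin y - sin x).
  rewrite (mulrC `|t|) (mulrC `|t|); lra.
split => x; apply/cvgrPdist_lt => e e0; have := key x e e0; apply: filterS => y; apply: le_lt_trans;
  rewrite distrC.
  have -> : cRe (f (circ t y)) - cRe (f (circ t x)) = cRe (f (circ t y) - f (circ t x)).
    by case: (f _) (f _) => ? ? [].
  exact: ler_Re.
have -> : cIm (f (circ t y)) - cIm (f (circ t x)) = cIm (f (circ t y) - f (circ t x)).
  by case: (f _) (f _) => ? ? [].
exact: ler_Im.
Unshelve. all: by end_near. Qed.

Lemma ccurve_circ t : ccurve (circ t).
Proof. by apply: ccurveM; [exact: ccurve_cst|exact: ccurve_expi]. Qed.

Lemma cmeanD H F : ccurve H -> ccurve F -> cmean (fun x => H x + F x) = cmean H + cmean F.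
Proof.
move=> [h1 h2] [f1 f2]; rewrite /cmean; congr Complex.
  rewrite -lmeanD//; congr lmean; by apply/funext => x; case: (H x) (F x) => ? ? [].
rewrite -lmeanD//; congr lmean; by apply/funext => x; case: (H x) (F x) => ? ? [].
Qed.

Lemma cmeanZ c H : ccurve H -> cmean (fun x => c * H x) = c * cmean H.
Proof.
case: c => a b [h1 h2]; rewrite /cmean; congr Complex.
  rewrite (_ : (fun x => _) = (fun x => a * cRe (H x) + (- b) * cIm (H x))).
    by rewrite lmeanD ?lmeanZ ?mulNr// => x; apply: cvgMr; [exact: h1|exact: h2].
  by apply/funext => x; case: (H x) => ? ? /=; ring.
rewrite (_ : (fun x => _) = (fun x => a * cIm (H x) + b * cRe (H x))).
  by rewrite lmeanD ?lmeanZ// => x; apply: cvgMr; [exact: h2|exact: h1].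
by apply/funext => x; case: (H x) => ? ? /=; ring.
Qed.

Lemma cmean_cst c : cmean (fun=> c) = c.
Proof. by case: c => a b; rewrite /cmean !lmean_cst. Qed.

(** The factor 2, from adding the bounds of the real and imaginary parts, is harmless
    where this is used. *)
Lemma cmean_bound H (M : R) : ccurve H -> (forall x, cmod (H x) <= M) -> cmod (cmean H) <= 2 * M.
Proof.
move=> [h1 h2] HM; apply: le_trans (cmod_le_ReIm _) _ => /=.
have hr : `|lmean (fun x => cRe (H x))| <= M.
  rewrite ler_norml -{1}(lmean_cst (- M)) -{2}(lmean_cst M); apply/andP; split; apply: le_lmean => //;
    try by move=> x; exact: cvg_cst.
    by move=> x; have := le_trans (ler_Re _) (HM x); rewrite ler_norml => /andP[].
  by move=> x; have := le_trans (ler_Re _) (HM x); rewrite ler_norml => /andP[].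
have hi : `|lmean (fun x => cIm (H x))| <= M.
  rewrite ler_norml -{1}(lmean_cst (- M)) -{2}(lmean_cst M); apply/andP; split; apply: le_lmean => //;
    try by move=> x; exact: cvg_cst.
    by move=> x; have := le_trans (ler_Im _) (HM x); rewrite ler_norml => /andP[].
  by move=> x; have := le_trans (ler_Im _) (HM x); rewrite ler_norml => /andP[].
lra.
Qed.

Definition hol_pdisc f := forall w, 0 < cmod w < 1 -> cdiff f w.

Lemma hol_ccurve f t : hol_pdisc f -> 0 < t < 1 -> ccurve (fun x => f (circ t x)).
Proof.
move=> hf /andP[t0 t1]; apply: ccurve_comp => x; apply: cdiff_cctn; apply: hf.
by rewrite cmod_circ ?t0 ?t1// ltW.
Qed.

(** In logarithmic polar coordinates [Im f ds + Re f dx] is closed, and the two sides of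
    the rectangle along [s] cancel by periodicity; the circulation is then the difference
    of two circle integrals. *)
Lemma circle_mean_re f t1 t2 : hol_pdisc f -> 0 < t1 -> t1 <= t2 -> t2 < 1 ->
  lmean (fun x => cRe (f (circ t1 x))) = lmean (fun x => cRe (f (circ t2 x))).
Proof.
move=> hf t10 t12 t21; have t20 := lt_le_trans t10 t12.
have [c1 _] := hol_ccurve hf (introT andP (conj t10 (le_lt_trans t12 t21))).
have [c2 _] := hol_ccurve hf (introT andP (conj t20 t21)).
have l12 : ln t1 <= ln t2 by rewrite ler_ln.
have g : closed_form (fun s x => cIm (f (polar s x))) (fun s x => cRe (f (polar s x))) (ln t1) (ln t2) 0 tpi.
  move=> s x /andP[s1 s2] _.
  have [|d hd] := hf (polar s x).
    rewrite cmod_polar expR_gt0/=; apply: le_lt_trans t21.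
    by rewrite -[X in _ <= X]lnK ?posrE// ler_expR.
  have [gr gi] := polar_cdiff hd.
  by exists (cIm (d * polar s x)), (cRe (d * polar s x)), (- cIm (d * polar s x)).
have := green_goursat l12 (ltW tpi_gt0) g; rewrite /circulation.
have per s : polar s tpi = polar s 0.
  by rewrite /polar /expi mulr_natl cos2pi sin2pi cos0 sin0.
rewrite [X in X + _](_ : _ = 0) ?add0r; last first.
  under eq_fun do rewrite per subrr.
  by rewrite rint_cst// mul0r.
under eq_fun do rewrite !polar_ln//.
rewrite rintB; [|by move=> x _; exact: c2|by move=> x _; exact: c1].
by move=> /eqP; rewrite subr_eq0 => /eqP h; rewrite /lmean h.
Qed.

Lemma hol_pdiscZ c f : hol_pdisc f -> hol_pdisc (fun w => c * f w).
Proof. by move=> hf w hw; apply: cdiffM; [exact: cdiff_cst|exact: hf]. Qed.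

(** Cauchy's theorem for annuli; the imaginary part of [f] is the real part of [- i f]. *)
Theorem circle_mean f t1 t2 : hol_pdisc f -> 0 < t1 < 1 -> 0 < t2 < 1 ->
  cmean (fun x => f (circ t1 x)) = cmean (fun x => f (circ t2 x)).
Proof.
move=> hf /[swap]; wlog t12 : t1 t2 / t1 <= t2 => [th h1 h2|/andP[t20 t21] /andP[t10 t11]].
  by have [/th->//|/ltW/th->] := leP t1 t2.
rewrite /cmean; congr Complex; first exact: circle_mean_re.
have := circle_mean_re (hol_pdiscZ (Complex 0 (-1)) hf) t10 t12 t21.
have E (z : R[i]) : cRe (Complex 0 (-1) * z) = cIm z by case: z => a b /=; ring.
by under eq_fun do rewrite E; under [in X in _ = X -> _]eq_fun do rewrite E.
Qed.

Lemma hol_pdiscX n : hol_pdisc (fun w => w ^+ n).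
Proof. by move=> w _; apply: cdiffX; exact: cdiff_id. Qed.

Lemma circX t x n : circ t x ^+ n = Complex (t ^+ n) 0 * expi x ^+ n.
Proof.
rewrite /circ exprMn; congr (_ * _); elim: n => // n ih.
by rewrite !exprS ih; congr Complex => /=; ring.
Qed.

(** The mean of [w ^ n] over the circle of radius [t] is proportional to [t ^ n], but does
    not depend on [t]. *)
Lemma cmean_expiX n : (0 < n)%N -> cmean (fun x => expi x ^+ n) = 0.
Proof.
move=> n0.
have h1 : 0 < (2^-1 : R) < 1 by apply/andP; split; lra.
have h2 : 0 < (4^-1 : R) < 1 by apply/andP; split; lra.
have := circle_mean (@hol_pdiscX n) h1 h2.
have ce := ccurveX n ccurve_expi.
under eq_fun do rewrite circX; under [in X in _ = X -> _]eq_fun do rewrite circX.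
rewrite !cmeanZ// => /eqP; rewrite -subr_eq0 -mulrBl mulf_eq0 => /orP[|/eqP//].
rewrite (_ : _ - _ = Complex (2^-1 ^+ n - 4^-1 ^+ n) 0 :> R[i]); last by congr Complex => /=; ring.
rewrite eq_complex /= => /andP[]; rewrite subr_eq0 (_ : 4^-1 = 2^-1 * 2^-1 :> R); last by field.
rewrite exprMn -[X in X == _]mulr1 => /eqP/(mulfI _) h _.
exfalso; move: h; rewrite expf_neq0 ?invr_eq0// => /(_ isT) h.
have : (2^-1 : R) ^+ n < 1 by rewrite exprn_ilt1 -?lt0n//; lra.
by rewrite -h ltxx.
Qed.

Definition msq H : R := lmean (fun x => cmod (H x) ^+ 2).

Lemma continuous_cmod2 H : ccurve H -> continuous (fun x => cmod (H x) ^+ 2).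
Proof.
move=> [h1 h2]; under eq_fun do rewrite cmod_sqr !expr2.
by move=> x; apply: cvgD; apply: cvgM; (exact: h1) || exact: h2.
Qed.

Lemma msq_ge0 H : ccurve H -> 0 <= msq H.
Proof.
move=> cH; rewrite -(lmean_cst 0); apply: le_lmean; [by move=> x; exact: cvg_cst|exact: continuous_cmod2|].
by move=> x; exact: sqr_ge0.
Qed.

Lemma expiK x : expi x * expi (- x) = 1 :> R[i].
Proof.
rewrite /expi cosN sinN; congr Complex => /=; last by ring.
by have := cos2Dsin2 x; rewrite !expr2; lra.
Qed.

(** Pythagoras: the subtracted Fourier mode is orthogonal to what remains. *)
Lemma bessel_step F n (a := cmean (fun x => F x * expi x ^+ n)) : ccurve F ->
  msq (fun x => F x - a * expi (- x) ^+ n) = msq F - cmod a ^+ 2.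
Proof.
move=> cF; set u := (fun x => F x * expi x ^+ n) in @a *.
have cu : ccurve u by apply: ccurveM => //; apply: ccurveX; exact: ccurve_expi.
have E x : cmod (F x - a * expi (- x) ^+ n) ^+ 2 =
    cmod (F x) ^+ 2 + (- 2 * cRe a * cRe (u x) + ((- 2 * cIm a) * cIm (u x) + cmod a ^+ 2)).
  have -> : cmod (F x - a * expi (- x) ^+ n) = cmod (u x - a).
    have -> : u x - a = expi x ^+ n * (F x - a * expi (- x) ^+ n).
      rewrite mulrBr mulrCA -exprMn expiK expr1n mulr1 /u; ring.
    by rewrite cmodM cmodX cmod_expi expr1n mul1r.
  have -> : cmod (F x) = cmod (u x) by rewrite /u cmodM cmodX cmod_expi expr1n mulr1.
  rewrite !cmod_sqr; move: (u x) a => [a1 a2] [b1 b2] /=; ring.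
rewrite /msq; under eq_fun do rewrite E.
have [c1 c2] := cu.
have k1 : continuous (fun x => - 2 * cRe a * cRe (u x)) by move=> x; apply: cvgMr; exact: c1.
have k2 : continuous (fun x => (- 2 * cIm a) * cIm (u x)) by move=> x; apply: cvgMr; exact: c2.
have k3 : continuous (fun x : R => cmod a ^+ 2) by move=> x; exact: cvg_cst.
have k4 : continuous (fun x => (- 2 * cIm a) * cIm (u x) + cmod a ^+ 2) by move=> x; apply: cvgD; [exact: k2|exact: k3].
rewrite lmeanD; [|exact: continuous_cmod2|by move=> x; apply: cvgD; [exact: k1|exact: k4]].
rewrite lmeanD// lmeanD// lmeanZ// lmeanZ// lmean_cst.
have -> : lmean (fun x => cRe (u x)) = cRe a by [].
have -> : lmean (fun x => cIm (u x)) = cIm a by [].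
by rewrite cmod_sqr; ring.
Qed.

Lemma bessel H N : ccurve H -> \sum_(n < N) cmod (cmean (fun x => H x * expi x ^+ n)) ^+ 2 <= msq H.
Proof.
move=> cH; set a := fun n => cmean (fun x => H x * expi x ^+ n).
suff [D [cD [hD hm]]] : exists D, ccurve D /\ (forall n, (N <= n)%N -> cmean (fun x => D x * expi x ^+ n) = a n)
    /\ msq D + \sum_(n < N) cmod (a n) ^+ 2 = msq H.
  by rewrite -hm lerDr msq_ge0.
elim: N => [|N [D [cD [hD hm]]]].
  by exists H; split => //; split => //; rewrite big_ord0 addr0.
exists (fun x => D x - a N * expi (- x) ^+ N); split; [|split].
- under eq_fun do rewrite -mulNr.
  apply: ccurveD => //; apply: ccurveM; first exact: ccurve_cst.
  by apply: ccurveX; exact: ccurve_expiN.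
- move=> n Nn.
  have E x : (D x - a N * expi (- x) ^+ N) * expi x ^+ n = D x * expi x ^+ n + (- a N) * expi x ^+ (n - N).
    rewrite mulrBl mulNr -mulrA; congr (_ - _ * _).
    rewrite -{1}(subnKC (ltnW Nn)) exprD mulrA -exprMn (mulrC (expi (- x))) expiK.
    by rewrite expr1n mul1r.
  under eq_fun do rewrite E.
  rewrite cmeanD; last 2 first.
  + by apply: ccurveM => //; apply: ccurveX; exact: ccurve_expi.
  + by apply: ccurveM; [exact: ccurve_cst|apply: ccurveX; exact: ccurve_expi].
  rewrite cmeanZ; last by apply: ccurveX; exact: ccurve_expi.
  by rewrite cmean_expiX ?subn_gt0// mulr0 addr0 hD// ltnW.
have := bessel_step N cD; rewrite hD// => ->.
by rewrite big_ord_recr/= -hm; ring.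
Qed.

Lemma riemann_lebesgue H : ccurve H -> forall e : R, 0 < e -> exists N, forall n, (N <= n)%N ->
  cmod (cmean (fun x => H x * expi x ^+ n)) < e.
Proof.
move=> cH e e0; set a := fun n => cmod (cmean (fun x => H x * expi x ^+ n)).
have a0 n : 0 <= a n by exact: cmod_ge0.
have : cvgn (series (fun n => a n ^+ 2)).
  apply: nondecreasing_is_cvgn.
    by apply/nondecreasing_seqP => n; rewrite /series /= big_nat_recr//= lerDl sqr_ge0.
  by exists (msq H) => _ [n _ <-]; rewrite /series /= big_mkord; exact: bessel.
move=> /cvg_series_cvg_0/cvgrPdist_lt/(_ (e ^+ 2)); rewrite exprn_gt0// => /(_ isT)[N _ hN].
exists N => n Nn; have := hN n Nn; rewrite sub0r normrN ger0_norm ?sqr_ge0//.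
by rewrite ltr_sqr ?nnegrE// ltW.
Qed.

Lemma cmeanJ H : ccurve H -> cmean (fun x => conjc (H x)) = conjc (cmean H).
Proof.
move=> [h1 h2]; rewrite /cmean /=; congr Complex.
  by congr lmean; apply/funext => x; case: (H x).
rewrite -mulN1r -lmeanZ//; congr lmean; apply/funext => x; rewrite mulN1r.
by case: (H x).
Qed.

Lemma riemann_lebesgueN H : ccurve H -> forall e : R, 0 < e -> exists N, forall n, (N <= n)%N ->
  cmod (cmean (fun x => H x * expi (- x) ^+ n)) < e.
Proof.
move=> [c1 c2] e e0.
have cj : ccurve (fun x => conjc (H x)).
  split.
    by rewrite (_ : (fun x => _) = (fun x => cRe (H x)))//; apply/funext => x; case: (H x).
  rewrite (_ : (fun x => _) = (fun x => - cIm (H x))); last by apply/funext => x; case: (H x).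
  by move=> x; apply: cvgN; exact: c2.
have [N hN] := riemann_lebesgue cj e0.
have cmodJ (z : R[i]) : cmod (conjc z) = cmod z by case: z => x y /=; rewrite sqrrN.
exists N => n Nn; rewrite -cmodJ.
have -> : conjc (cmean (fun x => H x * expi (- x) ^+ n)) = cmean (fun x => conjc (H x) * expi x ^+ n).
  have -> : (fun x => conjc (H x) * expi x ^+ n) = (fun x => conjc (H x * expi (- x) ^+ n)).
    apply/funext => x; rewrite rmorphM rmorphXn; congr (_ * _ ^+ _).
    by rewrite /expi /= cosN sinN opprK.
  have cE : ccurve (fun x => H x * expi (- x) ^+ n).
    by apply: ccurveM; [split|apply: ccurveX; exact: ccurve_expiN].
  by rewrite (cmeanJ cE).
exact: hN.
Qed.

End cmean.

(** * Laurent coefficients and the Taylor expansion *)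

Section taylor.
Variable R : realType.
Implicit Types (f : R[i] -> R[i]) (H F : R -> R[i]) (t : R).

Lemma hol_pdiscM f g : hol_pdisc f -> hol_pdisc g -> hol_pdisc (fun w => f w * g w).
Proof. by move=> hf hg w hw; apply: cdiffM; [exact: hf|exact: hg]. Qed.

Lemma hol_pdiscV n : hol_pdisc (fun w : R[i] => w^-1 ^+ n).
Proof.
move=> w /andP[w0 _]; apply: cdiffX; apply: cdiff_inv; by rewrite -cmod_gt0.
Qed.

(** The Laurent coefficients of non-negative index, and the vanishing of those of negative
    index. The radius [1 / 2] is immaterial, by [circle_mean]. *)
Definition coef f n := cmean (fun x => f (circ 2^-1 x) * (circ 2^-1 x)^-1 ^+ n).
Definition nopole f := forall m, (0 < m)%N -> cmean (fun x => f (circ 2^-1 x) * circ 2^-1 x ^+ m) = 0.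

Lemma half01 : 0 < (2^-1 : R) < 1.
Proof. by apply/andP; split; lra. Qed.

Lemma coef_circ f n t : hol_pdisc f -> 0 < t < 1 ->
  cmean (fun x => f (circ t x) * (circ t x)^-1 ^+ n) = coef f n.
Proof. by move=> hf t01; apply: (circle_mean (hol_pdiscM hf (hol_pdiscV n)) t01 half01). Qed.

Lemma nopoleE f m t : hol_pdisc f -> 0 < t < 1 ->
  cmean (fun x => f (circ t x) * circ t x ^+ m) = cmean (fun x => f (circ 2^-1 x) * circ 2^-1 x ^+ m).
Proof. by move=> hf t01; apply: (circle_mean (hol_pdiscM hf (@hol_pdiscX R m)) t01 half01). Qed.

Lemma hol_ccurveM f g t : hol_pdisc f -> hol_pdisc g -> 0 < t < 1 ->
  ccurve (fun x => f (circ t x) * g (circ t x)).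
Proof. by move=> hf hg t01; exact: (hol_ccurve (hol_pdiscM hf hg) t01). Qed.

Lemma coef_bound f n t M : hol_pdisc f -> 0 < t < 1 -> (forall x, cmod (f (circ t x)) <= M) ->
  cmod (coef f n) <= 2 * (M / t ^+ n).
Proof.
move=> hf t01 hM; rewrite -(coef_circ n hf t01); apply: cmean_bound.
  exact: (hol_ccurveM hf (hol_pdiscV n) t01).
move=> x; case/andP: t01 => t0 _.
by rewrite cmodM cmodX cmodV cmod_circ ?(ltW t0)// exprVn ler_wpM2r// invr_ge0 exprn_ge0// ltW.
Qed.

(** A singularity weaker than a simple pole has no principal part: let the radius of the
    circle of integration tend to 0. *)
Lemma nopole_crit f : hol_pdisc f -> (forall e : R, 0 < e -> exists2 t, 0 < t < 1 &
    forall x, cmod (f (circ t x)) * t <= e) -> nopole f.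
Proof.
move=> hf h m m0; apply/eqP; rewrite -cmod_eq0 eq_le cmod_ge0 andbT.
apply/ler_addgt0Pr => e e0; rewrite add0r.
have e2 : 0 < e / 2 by rewrite divr_gt0.
have [t t01 ht] := h _ e2; rewrite -(nopoleE m hf t01).
have /andP[t0 t1] := t01.
rewrite (_ : e = 2 * (e / 2)); last by field.
apply: cmean_bound; first exact: (hol_ccurveM hf (@hol_pdiscX R m) t01).
move=> x; rewrite cmodM cmodX cmod_circ ?(ltW t0)//; apply: le_trans (ht x).
rewrite ler_wpM2l ?cmod_ge0//; case: m m0 => // m _.
by rewrite exprS -[X in _ <= X]mulr1 ler_wpM2l ?(ltW t0)// exprn_ile1// ltW.
Qed.

Lemma circV t x : 0 < t -> (circ t x)^-1 = Complex t^-1 0 * expi (- x).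
Proof.
move=> t0; have c0 : circ t x != 0 by rewrite -cmod_gt0 cmod_circ// ltW.
apply: (mulfI c0); rewrite divff// /circ mulrACA expiK mulr1.
congr Complex => /=; last by ring.
by rewrite mul0r subr0 divff// gt_eqF.
Qed.

Lemma realX (t : R) n : Complex t 0 ^+ n = Complex (t ^+ n) 0 :> R[i].
Proof. by elim: n => // n ih; rewrite !exprS ih; congr Complex => /=; ring. Qed.

Lemma circVX t x n : 0 < t -> (circ t x)^-1 ^+ n = Complex (t ^- n) 0 * expi (- x) ^+ n.
Proof. by move=> t0; rewrite circV// exprMn realX exprVn. Qed.

Lemma cmean_circX t n : (0 < n)%N -> cmean (fun x => circ t x ^+ n) = 0.
Proof.
move=> n0; under eq_fun do rewrite circX.
by rewrite cmeanZ ?cmean_expiX ?mulr0//; apply: ccurveX; exact: ccurve_expi.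
Qed.

Lemma cmean_circVX t n : 0 < t -> (0 < n)%N -> cmean (fun x => (circ t x)^-1 ^+ n) = 0.
Proof.
move=> t0 n0; under eq_fun do rewrite circVX//.
rewrite cmeanZ; last by apply: ccurveX; exact: ccurve_expiN.
rewrite (_ : (fun x => _) = (fun x : R => conjc (expi x ^+ n))).
  by rewrite cmeanJ ?cmean_expiX ?conjc0 ?mulr0//; apply: ccurveX; exact: ccurve_expi.
by apply/funext => x; rewrite rmorphXn; congr (_ ^+ _); rewrite /expi cosN sinN.
Qed.

Lemma cctn_near f g z (r : R) : 0 < r -> (forall w, cmod (w - z) < r -> f w = g w) -> cctn g z -> cctn f z.
Proof.
move=> r0 fg cg e e0; have [d d0 hd] := cg e e0.
exists (Num.min r d); first by rewrite lt_min r0.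
move=> w; rewrite lt_min => /andP[h1 h2]; rewrite !fg//; first exact: hd.
by rewrite subrr cmod0.
Qed.

Section chernoff.
Variables (f : R[i] -> R[i]) (w0 : R[i]).
Hypotheses (hf : hol_pdisc f) (nf : nopole f) (w01 : 0 < cmod w0 < 1).
Let t := cmod w0.

(** The value of [Q] at [w0] is the derivative of [f]. *)
Lemma diff_quotient : exists Q, (forall w, 0 < cmod w < 1 -> cctn Q w) /\
  forall w, f w = f w0 + (w - w0) * Q w.
Proof.
have [d hd] := hf w01.
pose Q w := if w == w0 then d else (f w - f w0) / (w - w0).
exists Q; split => [w w1|w]; last first.
  rewrite /Q; case: eqVneq => [->|ww]; first by rewrite subrr mul0r addr0.
  by rewrite mulrC divfK ?subr_eq0// subrKC.
have [->|ww] := eqVneq w w0.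
  move=> e e0; have e2 : 0 < e / 2 by rewrite divr_gt0.
  have [dl dl0 h] := hd _ e2; exists dl => // v hv; rewrite /Q eqxx.
  case: eqVneq => [_|vw]; first by rewrite subrr cmod0.
  have vw0 : v - w0 != 0 by rewrite subr_eq0.
  have -> : (f v - f w0) / (v - w0) - d = (f v - f w0 - d * (v - w0)) / (v - w0).
    by field.
  rewrite cmodM cmodV; apply: (@le_lt_trans _ _ (e / 2)).
    by rewrite ler_pdivrMr ?cmod_gt0//; exact: h.
  lra.
have r0 : 0 < cmod (w - w0) by rewrite cmod_gt0 subr_eq0.
apply: (cctn_near (g := fun v => (f v - f w0) * (1 * v + (- w0))^-1) r0).
  move=> v hv; rewrite /Q mul1r ifN//; apply/eqP => vE; move: hv.
  by rewrite vE cmodC ltxx.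
apply: cdiff_cctn; apply: cdiffM; first by apply: cdiffB; [exact: hf|exact: cdiff_cst].
apply: (@cdiff_affine R (fun v => v^-1) 1 (- w0)); apply: cdiff_inv.
by rewrite mul1r subr_eq0.
Qed.

(** Chernoff's argument. On the circle through [w0], comparing the Fourier coefficients of
    the two sides of [f w = f w0 + (w - w0) Q w] gives [coef f n] as [q_(n-1) - w0 q_n],
    with [q_n] those of [Q]: the partial sums telescope, and the remainder is of modulus
    [|w0|] times a Fourier coefficient of the continuous function [Q], so it tends to 0 by
    the Riemann-Lebesgue lemma. For negative indices the same comparison makes the moments
    [r_m] geometric with ratio [w0], while Riemann-Lebesgue bounds them by [o(|w0| ^ m)]:
    hence [r_1 = 0]. *)
Theorem taylor (e : R) : 0 < e -> exists N0, forall N, (N0 <= N)%N ->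
  cmod (f w0 - \sum_(n < N) coef f n * w0 ^+ n) < e.
Proof.
move=> e0; have [Q [cQ fE]] := diff_quotient.
have [t0 t1] : 0 < t /\ t < 1 by case/andP: w01.
have t01 : 0 < t < 1 by rewrite t0.
have cQc : ccurve (fun x => Q (circ t x)).
  by apply: ccurve_comp => x; apply: cQ; rewrite cmod_circ ?(ltW t0).
have cV n : ccurve (fun x => (circ t x)^-1 ^+ n).
  exact: (hol_ccurve (@hol_pdiscV n) t01).
have cX n : ccurve (fun x => circ t x ^+ n) by apply: ccurveX; exact: ccurve_circ.
pose q n := cmean (fun x => Q (circ t x) * (circ t x)^-1 ^+ n).
pose r n := cmean (fun x => Q (circ t x) * circ t x ^+ n).
have circ0 x : circ t x != 0 by rewrite -cmod_gt0 cmod_circ// ltW.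
have splitM (G : R -> R[i]) : ccurve G -> cmean (fun x => f (circ t x) * G x) =
    f w0 * cmean G + (cmean (fun x => Q (circ t x) * (circ t x * G x)) - w0 * cmean (fun x => Q (circ t x) * G x)).
  move=> cG.
  have E x : f (circ t x) * G x = f w0 * G x +
      (Q (circ t x) * (circ t x * G x) + (- w0) * (Q (circ t x) * G x)).
    by rewrite fE; ring.
  have c1 : ccurve (fun x => Q (circ t x) * (circ t x * G x)).
    by apply: ccurveM => //; apply: ccurveM => //; exact: ccurve_circ.
  have c2 : ccurve (fun x => Q (circ t x) * G x) by exact: ccurveM.
  under eq_fun do rewrite E.
  rewrite cmeanD; [|by apply: ccurveM => //; exact: ccurve_cst|].
    rewrite cmeanZ// cmeanD//; last by apply: ccurveM => //; exact: ccurve_cst.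
    by rewrite cmeanZ// mulNr.
  by apply: ccurveD => //; apply: ccurveM => //; exact: ccurve_cst.
have rS m : (0 < m)%N -> r m.+1 = w0 * r m.
  move=> m0; apply/eqP; rewrite -subr_eq0; apply/eqP.
  have := splitM _ (cX m); rewrite nopoleE// nf// cmean_circX// mulr0 add0r => ->.
  congr (_ - _); rewrite /r; congr cmean; apply/funext => x; by rewrite exprS.
(* r m = w0 ^ (m - 1) r 1 is also o(|w0| ^ m) *)
have r1 : r 1 = 0.
  have rm m : r m.+1 = w0 ^+ m * r 1.
    by elim: m => [|m ih]; rewrite ?expr0 ?mul1r// rS// ih exprS mulrA.
  have rE m : cmod (r m) = t ^+ m * cmod (cmean (fun x => Q (circ t x) * expi x ^+ m)).
    rewrite -{1}(ger0_norm (exprn_ge0 m (ltW t0))) -cmod_real -cmodM -cmeanZ; last first.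
      by apply: ccurveM => //; apply: ccurveX; exact: ccurve_expi.
    congr cmod; congr cmean; apply/funext => x; rewrite circX; ring.
  apply/eqP; rewrite -cmod_eq0 eq_le cmod_ge0 andbT; apply/ler_addgt0Pr => e1 e10; rewrite add0r.
  have [N hN] := riemann_lebesgue cQc e10.
  have := rm N; move=> /(congr1 (@ComplexField.Normc.normc R)); rewrite rE cmodM cmodX -/t exprSr -mulrA.
  move=> /(mulfI (expf_neq0 _ (lt0r_neq0 t0))) <-.
  have := hN N.+1 (leqnSn N); set a := cmod _ => ha.
  have a0 : 0 <= a by exact: cmod_ge0.
  apply: le_trans (ltW ha); rewrite -[X in _ <= X]mul1r ler_wpM2r// ltW//.
have q0 : r 0 = q 0 by rewrite /r /q; congr cmean; apply/funext => x; rewrite !expr0.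
have c0E : coef f 0 = f w0 - w0 * q 0.
  rewrite -(coef_circ 0 hf t01) splitM//.
  rewrite (_ : cmean (fun x => _ ^+ 0) = 1); last first.
    by under eq_fun do rewrite expr0; rewrite cmean_cst.
  rewrite mulr1; congr (_ + _).
  rewrite (_ : cmean (fun x => Q (circ t x) * (circ t x * (circ t x)^-1 ^+ 0)) = r 1); last first.
    by rewrite /r; congr cmean; apply/funext => x; rewrite expr0 mulr1 expr1.
  by rewrite r1 sub0r.
have cSE n : coef f n.+1 = q n - w0 * q n.+1.
  rewrite -(coef_circ n.+1 hf t01) splitM// cmean_circVX// mulr0 add0r.
  rewrite (_ : cmean (fun x => Q (circ t x) * (circ t x * (circ t x)^-1 ^+ n.+1)) = q n)//.
  by rewrite /q; congr cmean; apply/funext => x; rewrite exprS mulVKf.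
have remE N : f w0 - \sum_(n < N.+1) coef f n * w0 ^+ n = w0 ^+ N.+1 * q N.
  elim: N => [|N ih]; first by rewrite big_ord_recr big_ord0/= c0E; ring.
  by rewrite big_ord_recr/= opprD addrA ih cSE !exprS; ring.
have qE N : cmod (w0 ^+ N.+1 * q N) = t * cmod (cmean (fun x => Q (circ t x) * expi (- x) ^+ N)).
  rewrite cmodM cmodX -/t exprS -mulrA; congr (_ * _).
  rewrite -{1}(ger0_norm (exprn_ge0 N (ltW t0))) -cmod_real -cmodM -cmeanZ; last exact: ccurveM.
  congr cmod; congr cmean; apply/funext => x; rewrite circVX//.
  have C12 : Complex (t ^+ N) 0 * Complex (t ^- N) 0 = 1 :> R[i].
    by congr Complex => /=; rewrite ?mul0r ?mulr0 ?subr0 ?addr0// divff// expf_neq0// gt_eqF.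
  set C1 := Complex _ _ in C12 *; set C2 := Complex _ _ in C12 *.
  have -> : C1 * (Q (circ t x) * (C2 * expi (- x) ^+ N)) = (C1 * C2) * (Q (circ t x) * expi (- x) ^+ N) by ring.
  by rewrite C12 mul1r.
have [N hN] := riemann_lebesgueN cQc e0.
exists N.+1 => -[//|M] NM; rewrite remE qE.
have := hN M NM; set a := cmod _ => ha.
have a0 : 0 <= a by exact: cmod_ge0.
by apply: le_lt_trans ha; rewrite -[X in _ <= X]mul1r ler_wpM2r// ltW.
Qed.

End chernoff.
End taylor.

(** * Means over rotations by roots of unity *)

Section roots.
Variable R : realType.
Implicit Types (x y t p : R) (w z : R[i]).

Lemma expiD x y : expi (x + y) = expi x * expi y :> R[i].
Proof. by rewrite /expi cosD sinD; congr Complex => /=; ring. Qed.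

Lemma expi0 : expi 0 = 1 :> R[i].
Proof. by rewrite /expi cos0 sin0. Qed.

Lemma expiX x n : expi x ^+ n = expi (n%:R * x) :> R[i].
Proof.
elim: n => [|n ih]; first by rewrite mul0r expi0 expr0.
by rewrite exprS ih -expiD; congr expi; rewrite -natr1; ring.
Qed.

Definition zeta N : R[i] := expi (2 * pi / N%:R).

Lemma cmod_zeta N : cmod (zeta N) = 1. Proof. exact: cmod_expi. Qed.

Lemma cos_lt1 x : 0 < x < 2 * pi -> cos x < 1.
Proof.
move=> /andP[x0 x2]; have -> : x = x / 2 + x / 2 by field.
have s0 : 0 < sin (x / 2) by apply: sin_gt0_pi; apply/andP; split; lra.
rewrite cosD; have := cos2Dsin2 (x / 2); rewrite !expr2.
have : 0 < sin (x / 2) * sin (x / 2) by rewrite mulr_gt0.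
lra.
Qed.

Lemma zeta_prim N : (0 < N)%N -> N.-primitive_root (zeta N).
Proof.
move=> N0; have NR : 0 < N%:R :> R by rewrite ltr0n.
rewrite /primitive_root_of_unity N0 /=; apply/forallP => i; apply/eqP.
rewrite unity_rootE /zeta expiX.
have [->|iN] := eqVneq i.+1 N.
  rewrite (_ : N%:R * (2 * pi / N%:R) = 2 * pi); last by field; rewrite gt_eqF.
  by rewrite /expi mulr_natl cos2pi sin2pi eqxx.
apply/negbTE/eqP => -[] H _; move: H; apply/eqP; rewrite lt_eqF// cos_lt1//.
have pi0 := pi_gt0 R.
have iltN : i.+1%:R < N%:R :> R by rewrite ltr_nat ltn_neqAle iN ltn_ord.
rewrite mulrA; apply/andP; split.
  by rewrite divr_gt0// mulr_gt0// ?ltr0n// mulr_gt0.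
by rewrite ltr_pdivrMr// mulrC ltr_pM2l// mulr_gt0.
Qed.

Lemma zeta_sum N m : (0 < N)%N -> ~~ (N %| m)%N -> \sum_(j < N) (zeta N ^+ j) ^+ m = 0.
Proof.
move=> N0 Nm; have pz := zeta_prim N0.
have u1 : zeta N ^+ m != 1 by rewrite -(prim_order_dvd pz).
apply: (mulfI (x := zeta N ^+ m - 1)); first by rewrite subr_eq0.
rewrite mulr0; transitivity ((zeta N ^+ m) ^+ N - 1).
  rewrite [RHS]subrX1; congr (_ * _); apply: eq_bigr => j _.
  by rewrite -!exprM mulnC.
by rewrite exprAC (prim_expr_order pz) expr1n subrr.
Qed.

(** The numbers [zeta N ^+ j] are the roots of [X ^ N - 1]. *)
Lemma zeta_prod N (x : R[i]) : (0 < N)%N -> \prod_(j < N) (1 - zeta N ^+ j * x) = 1 - x ^+ N.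
Proof.
move=> N0; have [->|x0] := eqVneq x 0.
  by under eq_bigr do rewrite mulr0 subr0; rewrite big1// expr0n gtn_eqF// subr0.
have := factor_Xn_sub_1 (zeta_prim N0).
move=> /(congr1 (fun q => x ^+ N * q.[x^-1])).
rewrite !hornerE mulrBr mulr1 -exprMn divff// expr1n => <-.
rewrite big_mkord horner_prod.
rewrite -[in X in X * _](card_ord N) -prodr_const -big_split/=.
by apply: eq_bigr => j _; rewrite !hornerE mulrBr divff// mulrC.
Qed.

(** Means over the rotations by the [N]-th roots of unity. They replace circle means: they
    are finite sums, and leave the integral over an annulus unchanged. *)
Definition omean N (F : R[i] -> R) w : R := N%:R^-1 * \sum_(j < N) F (zeta N ^+ j * w).

Lemma annulus_zeta s t N (j : nat) w : annulus s t w -> annulus s t (zeta N ^+ j * w).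
Proof. by rewrite /annulus /= cmodM cmodX cmod_zeta expr1n mul1r. Qed.

Lemma cmfun_orbit s t N (j : nat) F : cmfun (annulus s t) F ->
  cmfun (annulus s t) (fun w => F (zeta N ^+ j * w)).
Proof.
move=> mF; have mA := @cmset_annulus R s t.
have m1 := mF.
have mG : cmfun setT (F \_ (annulus s t)).
  have := (measurable_restrictT (fun xy : R * R => F (Complex xy.1 xy.2)) mA).1 mF.
  by congr measurable_fun; apply/funext => xy; rewrite /patch !mem_setE.
pose a := cRe (zeta N ^+ j); pose b := cIm (zeta N ^+ j).
have := mfun_linear a (- b) 0 b a 0 (F := fun xy : R * R => ((F \_ (annulus s t)) (Complex xy.1 xy.2))%:E).
move=> /(_ _)/measurable_EFinP => h.
have {}h : measurable_fun setT (fun xy : R * R =>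
    (F \_ (annulus s t)) (Complex (a * xy.1 + - b * xy.2 + 0) (b * xy.1 + a * xy.2 + 0))).
  by apply: h; exact/measurable_EFinP.
have {}h := @measurable_funS _ _ _ _ setT (planar (annulus s t)) _ measurableT (@subsetT _ _) h.
apply: eq_measurable_fun h => -[x y]; rewrite inE /planar/= => xyA.
have E : Complex (a * x + - b * y + 0) (b * x + a * y + 0) = zeta N ^+ j * Complex x y.
  by rewrite /a /b; case: (zeta N ^+ j) => u v; congr Complex => /=; ring.
by rewrite E patchE mem_set//; exact: annulus_zeta.
Qed.

Lemma cmfun_orbit_sum s t N F : cmfun (annulus s t) F ->
  cmfun (annulus s t) (fun w => \sum_(j < N) F (zeta N ^+ j * w)).
Proof.
move=> mF; rewrite /cmfun; apply: (measurable_sum (index_enum 'I_N)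
  (h := fun (j : 'I_N) xy => F (zeta N ^+ j * Complex xy.1 xy.2))) => j.
exact: (cmfun_orbit N j mF).
Qed.

Lemma cmfun_omean s t N F : cmfun (annulus s t) F -> cmfun (annulus s t) (omean N F).
Proof.
move=> mF; exact: (cmfunM (cmfun_cst (D := annulus s t) N%:R^-1) (cmfun_orbit_sum N mF)).
Qed.

Lemma aint_omean N s t F : (0 < N)%N -> cmfun (annulus s t) F -> (forall w, annulus s t w -> 0 <= F w) ->
  aint (annulus s t) (omean N F) = aint (annulus s t) F.
Proof.
move=> N0 mF F0; have mA := @cmset_annulus R s t.
have NR : 0 < N%:R :> R by rewrite ltr0n.
have uA (j : nat) w : annulus s t w -> annulus s t (zeta N ^+ j * w).
  by rewrite /annulus /= cmodM cmodX cmod_zeta expr1n mul1r.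
have rotE (j : nat) : aint (annulus s t) F = aint (annulus s t) (fun w => F (zeta N ^+ j * w)).
  have uj : cmod (zeta N ^+ j) = 1 by rewrite cmodX cmod_zeta expr1n.
  have u0 : zeta N ^+ j != 0 by rewrite -cmod_eq0 uj oner_eq0.
  rewrite (aint_affine 0 mA mF F0 u0) uj expr1n mul1e.
  congr aint; last by apply/funext => w; rewrite addr0.
  by apply/seteqP; split => w; rewrite /annulus /= addr0 cmodM uj mul1r.
have mFj (j : nat) := cmfun_orbit N j mF.
have mS := cmfun_orbit_sum N mF.
have S0 w : annulus s t w -> 0 <= \sum_(j < N) F (zeta N ^+ j * w).
  by move=> Aw; apply: sumr_ge0 => j _; apply: F0; exact: uA.
have V0 : 0 <= N%:R^-1 :> R by rewrite invr_ge0 ltW.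
rewrite /omean (aintZ mA mS S0 V0).
rewrite aint_sum//; last by move=> j w Aw; apply: F0; exact: uA.
under eq_bigr do rewrite -rotE.
have : (0 <= aint (annulus s t) F)%E by exact: aint_ge0.
case: (aint _ _) => [a| |]//= a0.
  rewrite sumEFin sumr_const card_ord -EFinM; congr EFin.
  by rewrite -[a *+ N]mulr_natl mulKf// gt_eqF.
have sumoo M : (0 < M)%N -> (\sum_(j < M) +oo)%E = +oo%E :> \bar R.
  case: M => // M _; elim: M => [|M ih]; first by rewrite big_ord1.
  by rewrite big_ord_recr/= ih.
by rewrite sumoo// gt0_muley// lte_fin invr_gt0.
Qed.

Lemma ler_geomean N (E : 'I_N -> R) : (0 < N)%N -> (forall i, 0 <= E i) ->
  (\prod_(i < N) E i) `^ (N%:R^-1) <= N%:R^-1 * \sum_(i < N) E i.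
Proof.
move=> N0 E0; have NR : 0 < N%:R :> R by rewrite ltr0n.
have := leif_AGM (A := @predT 'I_N) (E := E) (fun i _ => E0 i) => -[h _].
rewrite card_ord in h; set m := (_ / _) in h.
have m0 : 0 <= m by rewrite /m divr_ge0 ?ler0n// sumr_ge0.
rewrite (_ : N%:R^-1 * _ = m); last by rewrite /m mulrC.
have -> : m = (m ^+ N) `^ N%:R^-1.
  by rewrite -powR_mulrn// -powRrM divff ?powRr1// gt_eqF.
by rewrite ge0_ler_powR ?nnegrE ?exprn_ge0// ?prodr_ge0//.
Qed.

Lemma prod_powR I (s : seq I) (F : I -> R) p : (forall i, 0 <= F i) ->
  \prod_(i <- s) (F i `^ p) = (\prod_(i <- s) F i) `^ p.
Proof.
move=> F0; elim: s => [|i s ih]; first by rewrite !big_nil powR1.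
by rewrite !big_cons ih powRM// prodr_ge0.
Qed.

(** A lower bound, independent of [N > 0], of the product over [a] in [rs] of the [|1 - (w
    / a) ^ N|]. It is positive off the circles about 0 through the points of [rs]. *)
Definition circle_gap (rs : seq R[i]) w : R :=
  \prod_(a <- rs) Num.min 1 `|1 - cmod w / cmod a|.

Lemma circle_gap_ge0 rs w : 0 <= circle_gap rs w.
Proof. by apply: prodr_ge0 => a _; rewrite le_min ler01 normr_ge0. Qed.

Lemma circle_gap_le1 rs w : circle_gap rs w <= 1.
Proof.
rewrite /circle_gap; elim: rs => [|a rs ih]; first by rewrite big_nil.
by rewrite big_cons mulr_ile1 ?circle_gap_ge0// ?ge_min ?lexx// le_min ler01 normr_ge0.
Qed.

Lemma circle_gap_gt0 rs w : (forall a, a \in rs -> a != 0 /\ cmod w != cmod a) -> 0 < circle_gap rs w.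
Proof.
move=> h; rewrite /circle_gap; elim: rs h => [|a rs ih] h; first by rewrite big_nil.
rewrite big_cons mulr_gt0//; last by apply: ih => b brs; apply: h; rewrite inE brs orbT.
have [a0 wa] := h a (mem_head _ _).
rewrite lt_min ltr01 normr_gt0 subr_eq0 eq_sym; apply: contra wa => /eqP h1.
by rewrite -(divfK (_ : cmod a != 0) (cmod w)) ?h1 ?mul1r// cmod_eq0.
Qed.

Lemma one_sub_powX N (x : R[i]) : (0 < N)%N -> Num.min 1 `|1 - cmod x| <= cmod (1 - x ^+ N).
Proof.
move=> N0; have r0 := cmod_ge0 x.
have [r1|r1] := leP (cmod x) 1.
  rewrite ge_min; apply/orP; right; rewrite ger0_norm ?subr_ge0//.
  apply: le_trans (ler_distB _ _); rewrite cmod1 cmodX lerB//.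
  by case: N N0 => // N _; rewrite exprS -[X in _ <= X]mulr1 ler_wpM2l// exprn_ile1.
rewrite ge_min; apply/orP; right; rewrite ler0_norm ?subr_le0 ?(ltW r1)// opprB.
rewrite cmodC; apply: le_trans (ler_distB _ _); rewrite cmod1 cmodX lerB//.
case: N N0 => // N _; rewrite exprS -[X in X <= _]mulr1 ler_wpM2l// exprn_ege1//; exact: ltW.
Qed.

Section orbit.
Variables (P : {poly R[i]}) (p : R).
Hypotheses (P0 : P`_0 != 0) (p0 : 0 < p).

Definition proots := sval (closed_field_poly_normal P).

Lemma proots_horner z : P.[z] = lead_coef P * \prod_(a <- proots) (z - a).
Proof.
rewrite {1}(svalP (closed_field_poly_normal P)) -/proots hornerZ horner_prod.
by congr (_ * _); apply: eq_bigr => a _; rewrite !hornerE.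
Qed.

Lemma proots_neq0 a : a \in proots -> a != 0.
Proof.
move=> ain; apply: contraNneq P0 => a0; rewrite a0 in ain.
rewrite -horner_coef0 (svalP (closed_field_poly_normal P)) -/proots hornerZ.
by move: ain; rewrite -root_prod_XsubC rootE => /eqP ->; rewrite mulr0.
Qed.

Lemma prootsE w : P.[w] = P`_0 * \prod_(a <- proots) (1 - w / a).
Proof.
rewrite -horner_coef0 !proots_horner -mulrA; congr (_ * _).
have nz : all (fun a => a != 0) proots by apply/allP => a; exact: proots_neq0.
elim: (proots) nz => [|a s ih] /=; first by rewrite !big_nil mulr1.
move=> /andP[a0 sn]; rewrite !big_cons ih// mulrACA; congr (_ * _).
by field.
Qed.

(** A discrete Jensen inequality. Over an orbit, each factor [1 - w / a] of [P / P(0)] has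
    the product [1 - (w / a) ^ N], and a mean is at least the geometric mean. The exponent
    [p / N] lets the loss disappear as [N] grows. *)
Lemma orbit_geomean N w : (0 < N)%N ->
  cmod P`_0 `^ p * circle_gap proots w `^ (p / N%:R) <= omean N (fun w => cmod P.[w] `^ p) w.
Proof.
move=> N0; have NR : 0 < N%:R :> R by rewrite ltr0n.
apply: le_trans (ler_geomean N0 (fun i => powR_ge0 _ _)).
rewrite prod_powR; last by move=> i; exact: cmod_ge0.
rewrite -powRrM.
have pN : 0 <= p / N%:R by rewrite divr_ge0// ltW.
have -> : cmod P`_0 `^ p = (cmod P`_0 ^+ N) `^ (p / N%:R).
  rewrite -powR_mulrn ?cmod_ge0// -powRrM; congr (_ `^ _).
  by field; rewrite gt_eqF.
rewrite -powRM ?circle_gap_ge0 ?exprn_ge0 ?cmod_ge0//.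
have B0 : 0 <= \prod_(i < N) cmod P.[zeta N ^+ i * w] by apply: prodr_ge0 => i _; exact: cmod_ge0.
apply: ge0_ler_powR => //; rewrite ?nnegrE ?mulr_ge0 ?exprn_ge0 ?cmod_ge0 ?circle_gap_ge0//.
under eq_bigr do rewrite prootsE cmodM.
rewrite big_split/= prodr_const card_ord ler_wpM2l ?exprn_ge0 ?cmod_ge0//.
under eq_bigr do rewrite cmod_prod.
rewrite exchange_big/= /circle_gap big_seq [leRHS]big_seq; apply: ler_prod => a ain.
have a0 := proots_neq0 ain.
rewrite le_min ler01 normr_ge0/= -cmod_prod.
under eq_bigr do rewrite -mulrA.
rewrite zeta_prod//; apply: le_trans (one_sub_powX _ N0).
by rewrite cmodM cmodV.
Qed.

End orbit.
End roots.

(** * Subharmonicity for polynomials *)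

Section submean.
Variable R : realType.
Local Notation mu := (@lebesgue_measure R).
Local Notation mu2 := (mu \x mu)%E.
Implicit Types (x y t p : R) (w z : R[i]) (U : set R[i]).

Lemma cdiff_cmfun U (f : R[i] -> R[i]) : copen U -> (forall w, U w -> cdiff f w) ->
  cmfun U (fun w => cmod (f w)).
Proof.
move=> oU hf; apply: ccont_cmfun => // w /hf/cdiff_cctn cf e e0.
exact: (cctn_cmod cf e0).
Qed.

Lemma cdiff_horner (P : {poly R[i]}) w : cdiff (horner P) w.
Proof.
elim/poly_ind: P => [|P c ih].
  by have := cdiff_cst 0 w; congr (cdiff _ w); apply/funext => z; rewrite horner0.
have := cdiffD (cdiffM ih (cdiff_id w)) (cdiff_cst c w).
by congr (cdiff _ w); apply/funext => z; rewrite !hornerE.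
Qed.

Lemma cmfun_horner D (P : {poly R[i]}) : cmset D -> cmfun D (fun w => cmod P.[w]).
Proof.
move=> mD; apply: (@cmfunS _ _ setT) => //; first exact: measurableT.
by apply: cdiff_cmfun; [move=> w _; exists 1|move=> w _; exact: cdiff_horner].
Qed.

Lemma cpow0 w : cpow 0 w = 1.
Proof. by rewrite /cpow powRr0. Qed.

(** A circle lies in annuli of arbitrarily small area. *)
Lemma circle_null (a : R) : 0 < a -> mu2 (planar [set w | cmod w = a]) = 0%E.
Proof.
move=> a0; have mC : cmset [set w : R[i] | cmod w = a].
  by apply: (@cmset_cmod R [set a]).
apply/eqP; rewrite eq_le measure_ge0 andbT; apply/lee_addgt0Pr => e e0; rewrite add0e.
pose d := Num.min 1 (e / (pi * (2 * a + 1))).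
have c0 : 0 < pi * (2 * a + 1) by rewrite mulr_gt0 ?pi_gt0//; lra.
have d0 : 0 < d by rewrite lt_min ltr01 divr_gt0.
have -> : mu2 (planar [set w | cmod w = a]) = aint [set w | cmod w = a] (cpow 0).
  rewrite /aint; under eq_integral do rewrite cpow0.
  by rewrite integral_cst// mul1e.
have ad : a <= a + d by rewrite lerDl ltW.
apply: le_trans (subset_aint mC (@cmset_annulus R a (a + d)) _ _ _) _.
- by apply: cmfun_cpow; exact: cmset_annulus.
- by move=> w /= wa; rewrite /annulus /= -/(cmod w) wa lexx ltrDl.
- by move=> w _; exact: cpow_ge0.
have m2 : - 2 < 0 :> R by lra.
rewrite (aint_cpow_annulus m2 (ltW a0) ad).
rewrite lee_fin (_ : 2 * pi / (2 + 0) = pi); last by field.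
rewrite addr0.
rewrite !(powR_mulrn 2) ?(ltW a0) ?(ltW (addr_gt0 a0 d0))//.
have d1 : d <= 1 by rewrite ge_min lexx.
have -> : (a + d) ^+ 2 - a ^+ 2 = d * (2 * a + d) by ring.
have h : d * (pi * (2 * a + 1)) <= e.
  by rewrite -ler_pdivlMr// ge_min lexx orbT.
apply: le_trans h; rewrite mulrCA ler_pM2l// ler_pM2l ?pi_gt0//; lra.
Qed.

Lemma circles_null (s : seq R) : (forall a, a \in s -> 0 < a) ->
  cmset [set w : R[i] | cmod w \in s] /\ mu2 (planar [set w | cmod w \in s]) = 0%E.
Proof.
elim: s => [|a s ih] h.
  rewrite (_ : [set w : R[i] | cmod w \in [::]] = set0); last by apply/seteqP; split.
  by rewrite /cmset /planar/= measure0; split => //; exact: measurable0.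
have [|m1 m2] := ih; first by move=> c cs; apply: h; rewrite inE cs orbT.
have mC : cmset [set w : R[i] | cmod w = a] by apply: (@cmset_cmod R [set a]).
have E : planar [set w : R[i] | cmod w \in a :: s] =
    planar [set w | cmod w = a] `|` planar [set w | cmod w \in s].
  apply/seteqP; split => -[x y]; rewrite /planar /= inE.
    by move=> /orP[/eqP|]; [left|right].
  by case=> [->|->]; rewrite ?eqxx ?orbT.
rewrite /cmset E; split; first exact: measurableU.
by rewrite measureU0//; apply: circle_null; apply: h; rewrite inE eqxx.
Qed.

Lemma powR_cvg1 (x p : R) : 0 < x -> (x `^ (p / n.+1%:R)) @[n --> \oo] --> (1 : R).
Proof.
move=> x0.
have E n : x `^ (p / n.+1%:R) = expR (p * ln x * n.+1%:R^-1).
  by rewrite /powR gt_eqF//; congr expR; ring.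
under eq_fun do rewrite E.
have h : (p * ln x * n.+1%:R^-1) @[n --> \oo] --> p * ln x * 0.
  by apply: cvgMr; exact: (@cvg_harmonic R).
rewrite mulr0 in h.
have h2 : expR (p * ln x * n.+1%:R^-1) @[n --> \oo] --> expR 0.
  by apply: continuous_cvg h; exact: continuous_expR.
by rewrite expR0 in h2.
Qed.

Lemma cmfun_circle_gap D (rs : seq R[i]) : cmset D -> cmfun D (circle_gap rs).
Proof.
move=> mD; rewrite /cmfun /circle_gap.
apply: (measurable_prod (s := rs) (h := fun a (xy : R * R) =>
  Num.min 1 `|1 - cmod (Complex xy.1 xy.2) / cmod a|)) => a _.
apply: measurable_minr; first exact: measurable_cst.
apply: measurableT_comp; first exact: normr_measurable.
apply: measurable_funB; first exact: measurable_cst.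
by apply: measurable_funM; [exact: (cmfun_cmodw mD)|exact: measurable_cst].
Qed.

(** The p-th power of the modulus of a polynomial is subharmonic, for every [p > 0].
    Replace it by its orbit means, use [orbit_geomean], and let [N] tend to infinity: by
    monotone convergence the loss vanishes off the finitely many circles through the
    roots. *)
Theorem poly_submean (P : {poly R[i]}) (p b s t : R) : 0 < p -> - 2 < b -> 0 <= s -> s <= t ->
  ((cmod P`_0 `^ p)%:E * aint (annulus s t) (cpow b) <=
   aint (annulus s t) (fun w => cpow b w * cmod P.[w] `^ p)%R)%E.
Proof.
move=> p0 b2 s0 st; have mA := @cmset_annulus R s t.
have mc := cmfun_cpow b mA.
have mP : cmfun (annulus s t) (fun w => cmod P.[w] `^ p).
  by apply: cmfun_powR; exact: cmfun_horner.
set F := fun w => cpow b w * cmod P.[w] `^ p.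
have mF : cmfun (annulus s t) F by apply: cmfunM.
have F0 w : annulus s t w -> 0 <= F w by move=> _; rewrite /F mulr_ge0 ?cpow_ge0 ?powR_ge0.
have [Pz|Pn] := eqVneq P`_0 0.
  by rewrite Pz cmod0 powR0 ?gt_eqF// mul0e aint_ge0.
have mcc : cmfun (annulus s t) (fun w => cmod P`_0 `^ p * cpow b w).
  exact: (cmfunM (cmfun_cst (D := annulus s t) _) mc).
pose rs := proots P.
pose c := cmod P`_0 `^ p.
have c0 : 0 <= c by exact: powR_ge0.
pose G n w := c * cpow b w * circle_gap rs w `^ (p / n.+1%:R).
have mG n : cmfun (annulus s t) (G n).
  apply: cmfunM; first by apply: cmfunM => //; exact: cmfun_cst.
  by apply: cmfun_powR; exact: cmfun_circle_gap.
have G0 n w : 0 <= G n w by rewrite !mulr_ge0 ?cpow_ge0 ?powR_ge0.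
have GX n : (aint (annulus s t) (G n) <= aint (annulus s t) F)%E.
  rewrite -(aint_omean (N := n.+1) _ mF F0)//.
  have E w : omean n.+1 F w = cpow b w * omean n.+1 (fun w => cmod P.[w] `^ p) w.
    rewrite /omean mulrCA; congr (_ * _); rewrite mulr_sumr; apply: eq_bigr => j _.
    by rewrite /F /cpow cmodM cmodX cmod_zeta expr1n mul1r.
  apply: le_aint => //; last first.
    move=> w _; rewrite G0 E /G -mulrA mulrCA ler_wpM2l ?cpow_ge0//.
    exact: orbit_geomean.
  exact: cmfun_omean.
pose N := [set w : R[i] | cmod w \in map (@ComplexField.Normc.normc R) rs].
have [|mN N0] := @circles_null (map (@ComplexField.Normc.normc R) rs).
  by move=> a /mapP[z zrs ->]; rewrite cmod_gt0; exact: proots_neq0 zrs.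
have mD : cmset (annulus s t `\` N) by apply: measurableD.
have DA : annulus s t `\` N `<=` annulus s t by move=> w [].
have -> : ((cmod P`_0 `^ p)%:E * aint (annulus s t) (cpow b))%E =
    aint (annulus s t `\` N) (fun w => c * cpow b w).
  rewrite -aintZ//; last by move=> w _; exact: cpow_ge0.
  apply: ge0_negligible_integral => //.
  - exact/measurable_EFinP.
  - by move=> x _; rewrite lee_fin mulr_ge0 ?cpow_ge0.
have eta0 w : (annulus s t `\` N) w -> 0 < circle_gap rs w.
  move=> [_ Nw]; apply: circle_gap_gt0 => a ars; split; first exact: proots_neq0 ars.
  by apply: contra_notN Nw => /eqP wa; rewrite /N /= wa map_f.
have L w : (annulus s t `\` N) w -> (G n w)%:E @[n --> \oo] --> (c * cpow b w)%:E.
  move=> Dw; apply: cvg_EFin; first exact: nearW.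
  rewrite -[X in _ --> X]mulr1; apply: cvgMr; exact: powR_cvg1 (eta0 _ Dw).
have C : (fun n => aint (annulus s t `\` N) (G n)) @ \oo --> aint (annulus s t `\` N) (fun w => c * cpow b w).
  have -> : aint (annulus s t `\` N) (fun w => c * cpow b w) =
     (\int[mu2]_(xy in planar (annulus s t `\` N)) limn (fun n => (G n (Complex xy.1 xy.2))%:E))%E.
    by apply: eq_integral => x; rewrite inE => Dx; apply/esym/cvg_lim => //; exact: L Dx.
  apply: cvg_monotone_convergence => //.
  - by move=> n; apply/measurable_EFinP; exact: (cmfunS mA DA (mG n)).
  - by move=> n x _; rewrite lee_fin G0.
  - move=> x Dx m n mn; rewrite lee_fin /G ler_wpM2l ?mulr_ge0 ?cpow_ge0//.
    apply: ger_powR; first by rewrite circle_gap_le1 andbT; exact: eta0.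
    by rewrite ler_pM2l// lef_pV2 ?posrE ?ltr0n// ler_nat.
apply: (cvge_to_le C); apply: nearW => n; apply: le_trans (GX n).
apply: subset_aint => //; by move=> w _; exact: G0.
Qed.
End submean.

(** * Second-order expansions of powers *)

Section quad.
Variable R : realType.
Implicit Types (x y t p q : R) (w z v : R[i]).

(** One integration, by the mean value theorem, raises the order of smallness at 0 by one.
    *)
Lemma mvt_bound (g g' : R -> R) (a C : R) n : 0 <= C ->
  (forall x, `|x| <= a -> is_derive x (1 : R) g (g' x)) -> g 0 = 0 ->
  (forall x, `|x| <= a -> `|g' x| <= C * `|x| ^+ n) ->
  forall x, `|x| <= a -> `|g x| <= C * `|x| ^+ n.+1.
Proof.
move=> C0 dg g0 hg x xa.
have fin c : `|c| <= `|x| -> g x = g' c * x -> `|g x| <= C * `|x| ^+ n.+1.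
  move=> cx ->; rewrite normrM exprSr mulrA ler_wpM2r//.
  apply: le_trans (hg _ (le_trans cx xa)) _.
  by rewrite ler_wpM2l// lerXn2r// ?nnegrE.
have cg y : `|y| <= a -> {for y, continuous g}.
  by move=> /dg[h _]; apply/differentiable_continuous/derivable1_diffP.
have [x0|x0|->] := ltgtP x 0; last by rewrite g0 normr0 expr0n/= mulr0.
  have dM c : c \in `]x, 0[ -> is_derive c (1 : R) g (g' c).
    rewrite in_itv/= => /andP[c1 c2]; apply: dg; apply: le_trans xa.
    by rewrite !ltr0_norm// lerN2 ltW.
  have cM : {within `[x, 0], continuous g}.
    apply: continuous_in_subspaceT => y; rewrite inE/= in_itv/= => /andP[y1 y2]; apply: cg.
    by apply: le_trans xa; rewrite (ler0_norm y2) ltr0_norm// lerN2.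
  have [c] := MVT x0 dM cM; rewrite in_itv/= => /andP[c1 c2] E; apply: (fin c).
    by rewrite !ltr0_norm// lerN2 ltW.
  by move: E; rewrite g0 !sub0r => /eqP; rewrite mulrN eqr_opp => /eqP.
have dM c : c \in `]0, x[ -> is_derive c (1 : R) g (g' c).
  rewrite in_itv/= => /andP[c1 c2]; apply: dg; apply: le_trans xa.
  by rewrite !gtr0_norm// ltW.
have cM : {within `[0, x], continuous g}.
  apply: continuous_in_subspaceT => y; rewrite inE/= in_itv/= => /andP[y1 y2]; apply: cg.
  by apply: le_trans xa; rewrite (ger0_norm y1) gtr0_norm.
have [c] := MVT x0 dM cM; rewrite in_itv/= => /andP[c1 c2] E; apply: (fin c).
  by rewrite !gtr0_norm// ltW.
by move: E; rewrite g0 !subr0.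
Qed.

Lemma is_derive_pow1 (s x : R) : 0 < 1 + x -> is_derive x (1 : R) (fun y => (1 + y) `^ s) (s * (1 + x) `^ (s - 1)).
Proof.
move=> x0.
have d1 : is_derive x (1 : R) (fun y : R => 1 + y) 1.
  by apply: is_derive_eq; rewrite add0r mulr1.
have d2 := @is_derive1_powR R s (1 + x) x0.
have := @is_derive1_comp R (fun y => y `^ s) (fun y => 1 + y) x _ _ d2 d1.
by rewrite mulr1.
Qed.

(** Each derivative of the remainder is a remainder of lower order, down to [(1 + x) `^ (q
    - 2) - 1], so that [mvt_bound] applies three times. *)
Lemma powR_taylor q : exists2 C : R, 0 <= C & forall x, `|x| <= 3 / 4 ->
  `|(1 + x) `^ q - (1 + q * x + q * (q - 1) / 2 * x ^+ 2)| <= C * `|x| ^+ 3.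
Proof.
pose s := q - 2 - 1.
pose K := 4 `^ `|s| : R.
pose C := `|q * (q - 1) * (q - 2)| * K.
have C0 : 0 <= C by rewrite mulr_ge0 ?powR_ge0.
have pos x : `|x| <= 3 / 4 -> 0 < 1 + x by rewrite ler_norml => /andP[? ?]; lra.
have bound x : `|x| <= 3 / 4 -> (1 + x) `^ s <= K.
  move=> xa; have x0 := pos _ xa; move: xa; rewrite ler_norml => /andP[x1 x2].
  have ss : - `|s| <= s <= `|s| by rewrite -ler_norml.
  case/andP: ss => s1 s2.
  have [x3|x3] := leP (1 + x) 1.
    apply: (@le_trans _ _ ((1 + x) `^ (- `|s|))).
      by apply: ger_powR => //; rewrite x0 x3.
    have KE : (4^-1 : R) `^ `|s| = K^-1.
      by rewrite -powR_inv1// -powRrM mulN1r powRN.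
    rewrite powRN -[K]invrK -KE.
    rewrite lef_pV2 ?posrE ?powR_gt0 ?invr_gt0//.
    apply: ge0_ler_powR; rewrite ?nnegrE ?normr_ge0 ?invr_ge0 ?(ltW x0)//; lra.
  apply: (@le_trans _ _ ((1 + x) `^ `|s|)); first by apply: ler_powR => //; exact: ltW.
  apply: ge0_ler_powR; rewrite ?nnegrE ?normr_ge0 ?(ltW x0)//; lra.
exists C => //.
have D s' x : `|x| <= 3 / 4 -> is_derive x (1 : R) (fun y => (1 + y) `^ s') (s' * (1 + x) `^ (s' - 1)).
  by move=> xa; apply: is_derive_pow1; exact: pos.
pose g2 x := q * (q - 1) * ((1 + x) `^ (q - 2) - 1).
pose g1 x := q * ((1 + x) `^ (q - 1) - 1 - (q - 1) * x).
pose g0 x := (1 + x) `^ q - (1 + q * x + q * (q - 1) / 2 * x ^+ 2).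
have one a : (1 + 0 : R) `^ a = 1 by rewrite addr0 pow1R.
have b2 x : `|x| <= 3 / 4 -> `|g2 x| <= C * `|x| ^+ 1.
  apply: (@mvt_bound g2 (fun x => q * (q - 1) * (q - 2) * (1 + x) `^ s) (3 / 4) C 0 C0).
  - move=> y ya; have := D (q - 2) _ ya => h; rewrite /g2.
    apply: is_derive_eq; rewrite /GRing.scale/= -/s; ring.
  - by rewrite /g2 one subrr mulr0.
  - move=> y ya; rewrite expr0 mulr1 normrM ler_wpM2l//.
    by rewrite ger0_norm ?powR_ge0//; exact: bound.
have b1 x : `|x| <= 3 / 4 -> `|g1 x| <= C * `|x| ^+ 2.
  apply: (@mvt_bound g1 g2 (3 / 4) C 1 C0).
  - move=> y ya; have := D (q - 1) _ ya => h; rewrite /g1 /g2.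
    have e2 : q - 1 - 1 = q - 2 by ring.
    rewrite e2 in h; apply: is_derive_eq; rewrite /GRing.scale/=; ring.
  - by rewrite /g1 one; ring.
  - exact: b2.
apply: (@mvt_bound g0 g1 (3 / 4) C 2 C0).
- move=> y ya; have := D q _ ya => h; rewrite /g0 /g1.
  by apply: is_derive_eq; rewrite /GRing.scale/=; field.
- by rewrite /g0 one; ring.
- exact: b1.
Qed.

Lemma powR_quad q : exists2 C, 0 <= C & forall x, `|x| <= 3 / 4 -> `|(1 + x) `^ q - (1 + q * x)| <= C * x ^+ 2.
Proof.
have [C C0 HC] := powR_taylor q.
exists (`|q * (q - 1) / 2| + C); first by rewrite addr_ge0.
move=> x x34; have h := HC x x34.
have x1 : `|x| <= 1 by lra.
have x2 : `|x| ^+ 3 <= x ^+ 2 by rewrite exprS real_normK ?num_real// ler_piMl// sqr_ge0.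
have h2 : `|q * (q - 1) / 2 * x ^+ 2| = `|q * (q - 1) / 2| * x ^+ 2.
  by rewrite normrM [X in _ * X]ger0_norm// sqr_ge0.
have h3 : C * `|x| ^+ 3 <= C * x ^+ 2 by rewrite ler_wpM2l.
have -> : (1 + x) `^ q - (1 + q * x) = ((1 + x) `^ q - (1 + q * x + q * (q - 1) / 2 * x ^+ 2)) +
    q * (q - 1) / 2 * x ^+ 2 by ring.
apply: le_trans (ler_normD _ _) _; rewrite h2; lra.
Qed.

Lemma powR_near1 q : exists2 L, 0 <= L & forall x, `|x| <= 3 / 4 -> `|(1 + x) `^ q - 1| <= L * `|x|.
Proof.
have [C C0 HC] := powR_quad q.
exists (`|q| + C); first by rewrite addr_ge0.
move=> x x34; have h := HC x x34.
have -> : (1 + x) `^ q - 1 = ((1 + x) `^ q - (1 + q * x)) + q * x by ring.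
apply: le_trans (ler_normD _ _) _; rewrite normrM mulrDl addrC lerD2l; apply: le_trans h _.
by rewrite ler_wpM2l// -real_normK ?num_real// expr2 ler_piMr//; lra.
Qed.

(** [|1 + v| ^ p] is [(1 + x) ^ (p / 2)] with [x = 2 Re v + |v| ^ 2]. *)
Lemma cpowR_taylor p : exists2 C : R, 0 <= C & forall v, cmod v <= 4^-1 ->
  `|cmod (1 + v) `^ p - (1 + p * cRe v + p ^+ 2 / 4 * cmod v ^+ 2 + p * (p - 2) / 4 * cRe (v ^+ 2))|
   <= C * cmod v ^+ 3.
Proof.
have [C C0 hC] := powR_taylor (p / 2).
pose q := p / 2.
exists (27 * C + `|q * (q - 1) / 2| * 5); first by rewrite addr_ge0// mulr_ge0.
move=> v v4; set r := cmod v in v4 *; pose a := cRe v.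
have r0 : 0 <= r by exact: cmod_ge0.
have ar : `|a| <= r by exact: ler_Re.
pose x := 2 * a + r ^+ 2.
have E1 : cmod (1 + v) `^ p = (1 + x) `^ q.
  have -> : p = 2 * q by rewrite /q; field.
  rewrite powRrM (powR_mulrn 2) ?cmod_ge0// cmod_sqr /x /r cmod_sqr /a.
  by case: (v) => u1 u2 /=; congr (_ `^ _); ring.
have E2 : cRe (v ^+ 2) = 2 * a ^+ 2 - r ^+ 2.
  by rewrite /r cmod_sqr /a; case: (v) => u1 u2 /=; rewrite expr2 /=; ring.
have x3 : `|x| <= 3 * r.
  rewrite /x; apply: le_trans (ler_normD _ _) _; rewrite normrM (ger0_norm (_ : 0 <= 2))//.
  have : `|r ^+ 2| <= r by rewrite ger0_norm ?sqr_ge0// expr2 -[X in _ <= X]mulr1 ler_wpM2l//; lra.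
  lra.
have xs : `|x| <= 3 / 4 by lra.
have := hC x xs; rewrite E1 E2 -/q => h.
set T := (1 + x) `^ q in h *.
have -> : T - (1 + p * a + p ^+ 2 / 4 * r ^+ 2 + p * (p - 2) / 4 * (2 * a ^+ 2 - r ^+ 2)) =
   (T - (1 + q * x + q * (q - 1) / 2 * x ^+ 2)) + q * (q - 1) / 2 * (4 * a * r ^+ 2 + r ^+ 4).
  by rewrite /x /q; field.
apply: le_trans (ler_normD _ _) _; rewrite [X in _ <= X]mulrDl; apply: lerD.
  apply: le_trans h _; rewrite (mulrC 27) -mulrA ler_wpM2l//.
  have -> : 27 * r ^+ 3 = (3 * r) ^+ 3 by ring.
  by rewrite lerXn2r// ?nnegrE ?mulr_ge0.
rewrite normrM; set k := `|q * (q - 1) / 2|; rewrite -(mulrA k 5); apply: ler_wpM2l; first exact: normr_ge0.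
have h1 : `|4 * a * r ^+ 2| <= 4 * r ^+ 3.
  rewrite (normrM (4 * a)) (normrM 4) (ger0_norm (_ : 0 <= 4))// (ger0_norm (sqr_ge0 r)) (exprS r 2) mulrA.
  by rewrite ler_wpM2r ?sqr_ge0// ler_wpM2l.
have h2 : `|r ^+ 4| <= r ^+ 3.
  rewrite ger0_norm ?exprn_ge0// exprS -[X in _ <= X]mul1r ler_wpM2r ?exprn_ge0//; lra.
apply: le_trans (ler_normD _ _) _; lra.
Qed.

End quad.

(** * The quadratic gain for polynomials *)

Section orbitquad.
Variable R : realType.
Implicit Types (x y t p q : R) (w z v : R[i]).

(** Discrete Fourier inversion: the exponent [N - n] stands for [- n] modulo [N]. *)
Lemma orbit_coef N n (V : {poly R[i]}) w : (n < N)%N -> (size V <= N)%N ->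
  \sum_(j < N) V.[zeta R N ^+ j * w] * (zeta R N ^+ j) ^+ (N - n) = N%:R * (V`_n * w ^+ n).
Proof.
move=> nN sV; have N0 : (0 < N)%N by exact: leq_trans nN.
under eq_bigr do rewrite (horner_coef_wide _ sV) mulr_suml.
rewrite exchange_big/= (bigD1 (Ordinal nN))//= [X in _ + X]big1 ?addr0.
  transitivity (\sum_(j < N) V`_n * w ^+ n).
    apply: eq_bigr => j _; rewrite exprMn.
    have e : (zeta R N ^+ j) ^+ n * (zeta R N ^+ j) ^+ (N - n) = 1.
      by rewrite -exprD subnKC 1?ltnW// exprAC (prim_expr_order (zeta_prim R N0)) expr1n.
    by rewrite (mulrC (_ ^+ n)) mulrA -[LHS]mulrA e mulr1.
  by rewrite sumr_const card_ord mulr_natl.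
move=> m mn; transitivity (V`_m * w ^+ m * \sum_(j < N) (zeta R N ^+ j) ^+ (m + (N - n))).
  by rewrite mulr_sumr; apply: eq_bigr => j _; rewrite exprMn exprD; ring.
rewrite zeta_sum ?mulr0//.
have mN := ltn_ord m; apply/negP => /dvdnP[k E].
have mn' : (m : nat) <> n by move=> h; move/eqP: mn; apply; apply/val_inj.
have : (0 < k * N < 2 * N)%N by rewrite -E; apply/andP; split; lia.
by case: k E => [|[|k]] E /=; lia.
Qed.

(** A modulus is at most the mean of moduli, and a squared mean at most the mean of
    squares. *)
Lemma discrete_bessel N (F u : 'I_N -> R[i]) : (0 < N)%N -> (forall j, cmod (u j) = 1) ->
  cmod (\sum_(j < N) F j * u j) ^+ 2 <= N%:R * \sum_(j < N) cmod (F j) ^+ 2.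
Proof.
move=> N0 u1; have NR : 0 < N%:R :> R by rewrite ltr0n.
pose S := \sum_(j < N) cmod (F j).
have S0 : 0 <= S by apply: sumr_ge0 => j _; exact: cmod_ge0.
have h1 : cmod (\sum_(j < N) F j * u j) <= S.
  apply: le_trans (cmod_sum _ _ _) _; apply: ler_sum => j _.
  by rewrite cmodM u1 mulr1.
apply: (@le_trans _ _ (S ^+ 2)); first by rewrite lerXn2r// ?nnegrE ?cmod_ge0.
pose c := S / N%:R.
have : 0 <= \sum_(j < N) (cmod (F j) - c) ^+ 2 by apply: sumr_ge0 => j _; exact: sqr_ge0.
have -> : \sum_(j < N) (cmod (F j) - c) ^+ 2 = \sum_(j < N) cmod (F j) ^+ 2 - S ^+ 2 / N%:R.
  have E (j : 'I_N) : (cmod (F j) - c) ^+ 2 = cmod (F j) ^+ 2 + ((- 2 * c) * cmod (F j) + c ^+ 2) by ring.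
  under eq_bigr do rewrite E.
  rewrite !big_split/= -mulr_sumr -/S sumr_const card_ord -[c ^+ 2 *+ N]mulr_natl /c.
  by field; rewrite gt_eqF.
by rewrite subr_ge0 ler_pdivrMr// mulrC.
Qed.

(** A choice of the constant in [cpowR_taylor], so that smallness conditions can refer to
    it. *)
Definition qconst p : R := s2val (cid2 (cpowR_taylor (R := R) p)).

Lemma qconst_ge0 p : 0 <= qconst p.
Proof. exact: (s2valP (cid2 (cpowR_taylor (R := R) p))). Qed.

Lemma qconstP p v : cmod v <= 4^-1 ->
  `|cmod (1 + v) `^ p - (1 + p * cRe v + p ^+ 2 / 4 * cmod v ^+ 2 + p * (p - 2) / 4 * cRe (v ^+ 2))|
   <= qconst p * cmod v ^+ 3.
Proof. by move: v; exact: (s2valP' (cid2 (cpowR_taylor (R := R) p))). Qed.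

Lemma Re_sum (I : Type) (s : seq I) (F : I -> R[i]) : cRe (\sum_(i <- s) F i) = \sum_(i <- s) cRe (F i).
Proof.
elim: s => [|i s ih]; first by rewrite !big_nil.
by rewrite !big_cons -ih; case: (F i) (\sum_(j <- s) F j) => ? ? [].
Qed.

(** The terms [v] and [v ^ 2] of the expansion of [|1 + v| ^ p] average to 0 over an
    orbit, since [V] and [V ^ 2] have no constant term and degree below [N]. What is left
    is [p ^ 2 / 4] times the mean of [|v| ^ 2]. *)
Lemma orbit_quad N (V : {poly R[i]}) p (dl : R) w : (2 * size V < N)%N -> V`_0 = 0 ->
  dl <= 4^-1 -> (forall j : 'I_N, cmod V.[zeta R N ^+ j * w] <= dl) ->
  forall S, S = omean N (fun w => cmod V.[w] ^+ 2) w ->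
  `|omean N (fun w => cmod (1 + V.[w]) `^ p) w - (1 + p ^+ 2 / 4 * S)| <= qconst p * dl * S.
Proof.
move=> sN V0 dl4 hV S SE; have N0 : (0 < N)%N by lia.
have NR : 0 < N%:R :> R by rewrite ltr0n.
set z := zeta R N.
have s1 : \sum_(j < N) V.[z ^+ j * w] = 0.
  have sVN : (size V <= N)%N by lia.
  have := orbit_coef w N0 sVN; rewrite subn0 V0 mul0r mulr0 => h; rewrite -[RHS]h.
  apply: eq_bigr => j _.
  by rewrite exprAC (prim_expr_order (zeta_prim R N0)) expr1n mulr1.
have s2 : \sum_(j < N) V.[z ^+ j * w] ^+ 2 = 0.
  have sVN : (size (V ^+ 2) <= N)%N.
    by rewrite expr2; apply: leq_trans (size_polyMleq _ _) _; lia.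
  have := orbit_coef w N0 sVN; rewrite subn0.
  have -> : (V ^+ 2)`_0 = 0 by rewrite -horner_coef0 horner_exp horner_coef0 V0 expr0n.
  rewrite mul0r mulr0 => h; rewrite -[RHS]h.
  apply: eq_bigr => j _; rewrite horner_exp.
  by rewrite exprAC (prim_expr_order (zeta_prim R N0)) expr1n mulr1.
have E : omean N (fun w => cmod (1 + V.[w]) `^ p) w - (1 + p ^+ 2 / 4 * S) =
    N%:R^-1 * \sum_(j < N) (cmod (1 + V.[z ^+ j * w]) `^ p - (1 + p * cRe V.[z ^+ j * w] +
      p ^+ 2 / 4 * cmod V.[z ^+ j * w] ^+ 2 + p * (p - 2) / 4 * cRe (V.[z ^+ j * w] ^+ 2))).
  rewrite sumrB !big_split/= -!mulr_sumr -!Re_sum s1 s2 /= !mulr0 !addr0.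
  rewrite sumr_const card_ord SE /omean mulrBr mulrDr; congr (_ - (_ + _)).
    by rewrite mulVf// gt_eqF.
  by rewrite mulrCA.
have NV : 0 < N%:R^-1 :> R by rewrite invr_gt0.
rewrite E normrM (ger0_norm (ltW NV)) SE /omean [X in _ <= X]mulrCA ler_pM2l ?invr_gt0//.
apply: le_trans (ler_norm_sum _ _ _) _; rewrite mulr_sumr; apply: ler_sum => j _.
apply: le_trans (qconstP p (le_trans (hV j) dl4)) _.
rewrite exprS -mulrA ler_wpM2l ?qconst_ge0// ler_wpM2r ?sqr_ge0//; exact: hV.
Qed.

Lemma omean_sq_lower N n (V : {poly R[i]}) w : (n < N)%N -> (size V <= N)%N ->
  cmod V`_n ^+ 2 * cmod w ^+ (2 * n) <= omean N (fun w => cmod V.[w] ^+ 2) w.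
Proof.
move=> nN sV; have N0 : (0 < N)%N by exact: leq_trans nN.
have NR : 0 < N%:R :> R by rewrite ltr0n.
have := @discrete_bessel N (fun j => V.[zeta R N ^+ j * w]) (fun j => (zeta R N ^+ j) ^+ (N - n)) N0.
move=> /(_ (fun j => _)); rewrite orbit_coef// => h.
have {}h : cmod (N%:R * (V`_n * w ^+ n)) ^+ 2 <= N%:R * \sum_(j < N) cmod V.[zeta R N ^+ j * w] ^+ 2.
  by apply: h => j; rewrite !cmodX cmod_zeta !expr1n.
have cN : cmod (N%:R : R[i]) = N%:R.
  have -> : (N%:R : R[i]) = Complex N%:R 0.
    by elim: (N) => // k ih; rewrite -!natr1 ih; congr Complex => /=; rewrite addr0.
  by rewrite cmod_real ger0_norm// ler0n.
move: h; rewrite cmodM cN exprMn {1}expr2 -mulrA ler_pM2l// cmodM exprMn cmodX -exprM (mulnC n).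
by rewrite /omean => h; rewrite -ler_pdivrMl ?invr_gt0// invrK.
Qed.

(** For [b > - 2], the integral of [|w| ^ b] over the disc of radius [r]. *)
Definition disc_moment (b r : R) := 2 * pi / (2 + b) * r `^ (2 + b).

Lemma aint_disc_moment b r : - 2 < b -> 0 <= r -> aint (annulus 0 r) (cpow b) = (disc_moment b r)%:E.
Proof. by move=> b2 r0; rewrite -disc_annulus0 aint_cpow_disc. Qed.

Lemma cpowDn b n w : w != 0 -> cpow (b + (2 * n)%:R) w = cpow b w * cmod w ^+ (2 * n).
Proof.
move=> w0; rewrite /cpow powRD; last by rewrite cmod_eq0 w0 implybT.
by rewrite powR_mulrn// cmod_ge0.
Qed.

(** The improvement of [poly_submean] for polynomials close to their constant term:
    [orbit_quad] on each orbit, with the mean of [|v| ^ 2] bounded below by one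
    coefficient. *)
Theorem poly_quad_lower (P : {poly R[i]}) p b r dl n (kp := p ^+ 2 / 4 - qconst p * dl) :
  - 2 < b -> 0 <= r -> P`_0 != 0 -> (0 < n)%N -> dl <= 4^-1 -> 0 <= kp ->
  (forall w, cmod w < r -> cmod (P.[w] - P`_0) <= dl * cmod P`_0) ->
  ((cmod P`_0 `^ p * (disc_moment b r + kp * cmod (P`_n / P`_0) ^+ 2 * disc_moment (b + (2 * n)%:R) r))%:E <=
   aint (annulus 0 r) (fun w => cpow b w * cmod P.[w] `^ p)%R)%E.
Proof.
move=> b2 r0 P0 n0 dl4 kp0 hP.
have mA := @cmset_annulus R 0 r.
have b2n : - 2 < b + (2 * n)%:R by rewrite (lt_le_trans b2)// lerDl ler0n.
set c := cmod P`_0 `^ p; have c0 : 0 <= c by exact: powR_ge0.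
set k := kp * _; have k0 : 0 <= k by rewrite mulr_ge0// sqr_ge0.
(* large enough for orbit_quad and for the coefficient of index n *)
pose N := (2 * size P + n + 3)%N.
have nN : (n < N)%N by rewrite /N; clear; lia.
have sPN : (2 * size P < N)%N by rewrite /N; clear; lia.
have N0 : (0 < N)%N by exact: leq_trans nN.
pose V := (P`_0)^-1 *: P - 1.
have V0 : V`_0 = 0 by rewrite coefB coefZ coef1 mulVf// subrr.
have Vn : V`_n = P`_n / P`_0 by rewrite coefB coefZ coef1 gtn_eqF// subr0 mulrC.
have sP : (0 < size P)%N by rewrite lt0n size_poly_eq0; apply: contraNneq P0 => ->; rewrite coef0.
have sV : (size V <= size P)%N.
  apply: leq_trans (size_polyD _ _) _; rewrite size_polyN size_poly1 geq_max sP andbT.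
  exact: size_scale_leq.
have PV w : P.[w] = P`_0 * (1 + V.[w]).
  by rewrite /V hornerD hornerZ hornerN hornerC addrCA subrr addr0 mulVKf.
have hV w : cmod w < r -> cmod V.[w] <= dl.
  move=> /hP; rewrite PV (_ : _ - _ = P`_0 * V.[w]); last by ring.
  by rewrite cmodM mulrC ler_pM2r// cmod_gt0.
pose F w := cpow b w * cmod P.[w] `^ p.
have mF : cmfun (annulus 0 r) F.
  apply: cmfunM; first exact: cmfun_cpow.
  by apply: cmfun_powR; exact: cmfun_horner.
have F0 w : annulus 0 r w -> 0 <= F w by move=> _; rewrite mulr_ge0 ?cpow_ge0 ?powR_ge0.
rewrite -/F -(aint_omean N0 mF F0).
have mc := cmfun_cpow b mA; have mcn := cmfun_cpow (b + (2 * n)%:R) mA.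
have -> : (c * (disc_moment b r + k * disc_moment (b + (2 * n)%:R) r))%:E =
    aint (annulus 0 r) (fun w => c * cpow b w + c * k * cpow (b + (2 * n)%:R) w).
  rewrite aintD; last 5 first.
  - exact: mA.
  - exact: (cmfunM (cmfun_cst (D := annulus 0 r) c) mc).
  - exact: (cmfunM (cmfun_cst (D := annulus 0 r) (c * k)) mcn).
  - by move=> w _; rewrite mulr_ge0// cpow_ge0.
  - by move=> w _; exact: mulr_ge0 (mulr_ge0 c0 k0) (cpow_ge0 _ _).
  rewrite (aintZ mA mc (fun _ _ => cpow_ge0 _ _) c0).
  rewrite (aintZ mA mcn (fun _ _ => cpow_ge0 _ _) (mulr_ge0 c0 k0)).
  by rewrite !aint_disc_moment// mulrDr mulrA.
apply: le_aint => //.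
- apply: cmfunD; first exact: (cmfunM (cmfun_cst (D := annulus 0 r) c) mc).
  exact: (cmfunM (cmfun_cst (D := annulus 0 r) (c * k)) mcn).
- exact: cmfun_omean.
move=> w; rewrite /annulus /= -/(cmod w) => /andP[_ wr].
apply/andP; split.
  exact: addr_ge0 (mulr_ge0 c0 (cpow_ge0 _ _)) (mulr_ge0 (mulr_ge0 c0 k0) (cpow_ge0 _ _)).
have FE : omean N F w = c * cpow b w * omean N (fun w => cmod (1 + V.[w]) `^ p) w.
  rewrite /omean [RHS]mulrCA; congr (_ * _); rewrite mulr_sumr; apply: eq_bigr => j _.
  rewrite /F PV cmodM powRM ?cmod_ge0// /cpow cmodM cmodX cmod_zeta expr1n mul1r -/c; ring.
have hj (j : 'I_N) : cmod V.[zeta R N ^+ j * w] <= dl.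
  by apply: hV; rewrite cmodM cmodX cmod_zeta expr1n mul1r.
have sVN : (2 * size V < N)%N by apply: leq_ltn_trans sPN; rewrite leq_mul2l sV orbT.
pose S := omean N (fun w => cmod V.[w] ^+ 2) w.
have hS := orbit_quad p sVN V0 dl4 hj (erefl S).
have S1 : cmod V`_n ^+ 2 * cmod w ^+ (2 * n) <= S.
  by apply: omean_sq_lower => //; apply: leq_trans (ltnW sVN); rewrite leq_pmull.
have M1 : 1 + kp * S <= omean N (fun w => cmod (1 + V.[w]) `^ p) w.
  move: hS; rewrite ler_norml => /andP[+ _]; rewrite /kp; lra.
rewrite FE.
have [w0|w0] := eqVneq w 0.
  have bn0 : b + (2 * n)%:R != 0.
    have : 2 <= (2 * n)%:R :> R by rewrite ler_nat leq_pmulr.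
    by move=> h; rewrite gt_eqF//; lra.
  rewrite {2}w0 /cpow cmod0 (powR0 bn0) mulr0 addr0 -[X in X <= _]mulr1 ler_wpM2l//.
    by rewrite mulr_ge0 ?powR_ge0.
  apply: le_trans M1; rewrite lerDl mulr_ge0//; apply: le_trans S1.
  by rewrite mulr_ge0 ?sqr_ge0// exprn_ge0// cmod_ge0.
rewrite cpowDn//.
have -> : c * cpow b w + c * k * (cpow b w * cmod w ^+ (2 * n)) =
          c * cpow b w * (1 + k * cmod w ^+ (2 * n)) by ring.
rewrite ler_wpM2l//; first exact: mulr_ge0 c0 (cpow_ge0 _ _).
apply: le_trans M1; rewrite lerD2l /k -mulrA; apply: ler_wpM2l => //.
by rewrite -Vn.
Qed.


(** For [1 + a w] the mean of [|v| ^ 2] is exactly [|a w| ^ 2], and [orbit_quad] gives an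
    upper bound as well. Fifth roots of unity suffice: [2 * 2 < 5]. *)
Lemma lin_quad_upper p b (a : R[i]) : - 2 < b -> cmod a <= 4^-1 ->
  (aint (annulus 0 1) (fun w => cpow b w * cmod (1 + a * w) `^ p)%R <=
   (disc_moment b 1 + (p ^+ 2 / 4 + qconst p * cmod a) * cmod a ^+ 2 * disc_moment (b + 2) 1)%:E)%E.
Proof.
move=> b2 a4.
have mA := @cmset_annulus R 0 1.
have b22 : - 2 < b + 2 by lra.
set k := (_ + _) * _; have k0 : 0 <= k.
  apply: mulr_ge0 (sqr_ge0 _); apply: addr_ge0; last exact: mulr_ge0 (qconst_ge0 p) (cmod_ge0 _).
  by apply: mulr_ge0 (sqr_ge0 _) _; rewrite invr_ge0.
pose V : {poly R[i]} := a *: 'X.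
have VE w : V.[w] = a * w by rewrite hornerZ hornerX.
have V0 : V`_0 = 0 by rewrite coefZ coefX mulr0.
have sV : (2 * size V < 5)%N.
  have : (size V <= 2)%N by apply: leq_trans (size_scale_leq _ _) _; rewrite size_polyX.
  by case: (size V) => [|[|[|]]].
pose F w := cpow b w * cmod (1 + a * w) `^ p.
have mF : cmfun (annulus 0 1) F.
  apply: cmfunM; first exact: cmfun_cpow.
  apply: cmfun_powR; have := @cmfun_horner R (annulus 0 1) (1 + V) mA.
  by congr cmfun; apply/funext => w; rewrite hornerD hornerC VE.
have F0 w : annulus 0 1 w -> 0 <= F w by move=> _; rewrite mulr_ge0 ?cpow_ge0 ?powR_ge0.
have N0 : (0 < 5)%N by [].
rewrite -(aint_omean N0 mF F0).
have mc := cmfun_cpow b mA; have mcn := cmfun_cpow (b + 2) mA.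
have mkc : cmfun (annulus 0 1) (fun w => k * cpow (b + 2) w).
  exact: (cmfunM (cmfun_cst (D := annulus 0 1) k) mcn).
have -> : (disc_moment b 1 + k * disc_moment (b + 2) 1)%:E =
    aint (annulus 0 1) (fun w => cpow b w + k * cpow (b + 2) w).
  rewrite (aintD mA mc mkc); last 2 first.
  - by move=> w _; exact: cpow_ge0.
  - by move=> w _; exact: mulr_ge0 k0 (cpow_ge0 _ _).
  rewrite (aintZ mA mcn (fun _ _ => cpow_ge0 _ _) k0).
  by rewrite !aint_disc_moment.
apply: le_aint => //.
- exact: cmfun_omean.
- exact: cmfunD.
move=> w; rewrite /annulus /= -/(cmod w) => /andP[_ w1].
have FE : omean 5 F w = cpow b w * omean 5 (fun w => cmod (1 + V.[w]) `^ p) w.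
  rewrite /omean [RHS]mulrCA; congr (_ * _); rewrite mulr_sumr; apply: eq_bigr => j _.
  by rewrite /F VE /cpow cmodM cmodX cmod_zeta expr1n mul1r.
apply/andP; split.
  rewrite FE mulr_ge0 ?cpow_ge0// /omean mulr_ge0 ?invr_ge0//.
  by apply: sumr_ge0 => j _; exact: powR_ge0.
have hj (j : 'I_5) : cmod V.[zeta R 5 ^+ j * w] <= cmod a.
  rewrite VE !cmodM cmodX cmod_zeta expr1n mul1r.
  by rewrite ler_piMr ?cmod_ge0// ltW.
pose S := omean 5 (fun w => cmod V.[w] ^+ 2) w.
have SE : S = cmod a ^+ 2 * cmod w ^+ 2.
  rewrite /S /omean (eq_bigr (fun _ => cmod a ^+ 2 * cmod w ^+ 2)).
    by rewrite sumr_const card_ord -[X in _ * X]mulr_natl mulKf.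
  by move=> j _; rewrite VE !cmodM cmodX cmod_zeta expr1n mul1r exprMn.
have := orbit_quad p sV V0 a4 hj (erefl S).
rewrite ler_norml -/S => /andP[_]; rewrite lerBlDl => h.
rewrite FE; apply: (@le_trans _ _ (cpow b w * (1 + k * cmod w ^+ 2))).
  rewrite ler_wpM2l ?cpow_ge0//; apply: le_trans h _.
  by rewrite SE /k le_eqVlt; apply/orP; left; apply/eqP; ring.
have [->|w0] := eqVneq w 0.
  rewrite cmod0 expr0n/= mulr0 addr0 mulr1 lerDl; exact: mulr_ge0 k0 (cpow_ge0 _ _).
have -> : cpow (b + 2) w = cpow b w * cmod w ^+ 2 by have := @cpowDn b 1 w w0; rewrite muln1.
by rewrite mulrDr mulr1 lerD2l mulrCA.
Qed.

End orbitquad.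

(** * From polynomials to holomorphic functions *)

Section approx.
Variable R : realType.
Implicit Types (x y r s t p q b e : R) (w z v : R[i]) (g : R[i] -> R[i]).

Lemma geo_sum_le q (N m : nat) : 0 <= q < 1 -> \sum_(n < m) q ^+ (N + n) <= q ^+ N / (1 - q).
Proof.
move=> /andP[q0 q1]; have q1' : 0 < 1 - q by rewrite subr_gt0.
under eq_bigr do rewrite exprD.
rewrite -mulr_sumr; apply: ler_wpM2l; first exact: exprn_ge0.
rewrite -[X in _ <= X]mulr1 ler_pdivlMl// -opprB mulNr -subrX1 opprB.
by rewrite gerBl exprn_ge0.
Qed.

Lemma geo_tail_small (C r t e : R) : 0 <= C -> 0 <= r < t -> 0 < e ->
  exists N0, forall N, (N0 <= N)%N -> forall x, 0 <= x <= r -> C * ((x / t) ^+ N / (1 - x / t)) <= e.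
Proof.
move=> C0 /andP[r0 rt] e0; have t0 : 0 < t by exact: le_lt_trans rt.
pose q := r / t.
have q0 : 0 <= q by rewrite divr_ge0// ltW.
have q1 : q < 1 by rewrite ltr_pdivrMr// mul1r.
have : (fun n => q ^+ n) @ \oo --> (0 : R) by apply: cvg_expr; rewrite ger0_norm.
pose e' := e / (C + 1) * (1 - q).
have e'0 : 0 < e' by rewrite mulr_gt0 ?divr_gt0 ?subr_gt0// ltr_wpDl.
move/cvgrPdist_le => /(_ _ e'0)[N0 _ H]; exists N0 => N N0N x /andP[x0 xr].
have xq : x / t <= q by rewrite ler_pM2r ?invr_gt0.
have xt : 0 <= x / t by rewrite divr_ge0// ltW.
have := H N N0N; rewrite /= sub0r normrN ger0_norm ?exprn_ge0// => h.
have h1 : (x / t) ^+ N / (1 - x / t) <= e / (C + 1).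
  apply: (@le_trans _ _ (q ^+ N / (1 - q))).
    apply: ler_pM; [exact: exprn_ge0| |by rewrite lerXn2r ?nnegrE|].
      by rewrite invr_ge0 subr_ge0 (le_trans xq)// ltW.
    by rewrite lef_pV2 ?posrE ?subr_gt0// ?lerB// (le_lt_trans xq).
  by rewrite ler_pdivrMr ?subr_gt0.
apply: le_trans (ler_wpM2l C0 h1) _; rewrite mulrCA ler_piMr ?(ltW e0)//.
by rewrite ler_pdivrMr ?ltr_wpDl// mul1r lerDl.
Qed.

Definition taylor_poly g N : {poly R[i]} := \poly_(n < N) coef g n.

Lemma taylor_polyE g N w : (taylor_poly g N).[w] = \sum_(n < N) coef g n * w ^+ n.
Proof. exact: horner_poly. Qed.

Lemma coef_taylor_poly g N n : (n < N)%N -> (taylor_poly g N)`_n = coef g n.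
Proof. by move=> nN; rewrite coef_poly nN. Qed.

Section expansion.
Variable g : R[i] -> R[i].
Hypotheses (hg : hol_pdisc g) (ng : nopole g) (g0 : g 0 = coef g 0).

(** By [taylor], the remainder is a limit of finite sums, which are dominated by a
    geometric series. *)
Lemma taylor_tail (t C : R) N w : 0 < t <= 1 -> (forall n, cmod (coef g n) <= C / t ^+ n) ->
  cmod w < t -> (0 < N)%N ->
  cmod (g w - (taylor_poly g N).[w]) <= C * ((cmod w / t) ^+ N / (1 - cmod w / t)).
Proof.
move=> /andP[t0 t1] hC wt N0.
have C0 : 0 <= C by have := le_trans (cmod_ge0 _) (hC 0%N); rewrite expr0 divr1.
set q := cmod w / t.
have q01 : 0 <= q < 1.
  by rewrite /q divr_ge0 ?cmod_ge0 ?(ltW t0)//= ltr_pdivrMr// mul1r.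
have B0 : 0 <= q ^+ N / (1 - q).
  by case/andP: q01 => q0 q1; rewrite divr_ge0 ?exprn_ge0// subr_ge0 ltW.
have [w0|w0] := eqVneq w 0.
  rewrite w0 horner_coef0 coef_taylor_poly// g0 subrr cmod0; exact: mulr_ge0.
have w01 : 0 < cmod w < 1 by rewrite cmod_gt0 w0 (lt_le_trans wt).
apply/ler_addgt0Pr => e e0; have [N1 H] := taylor hg ng w01 e0.
have /H/ltW hM : (N1 <= N + N1)%N by rewrite leq_addl.
have -> : g w - (taylor_poly g N).[w] = (g w - \sum_(n < N + N1) coef g n * w ^+ n) +
    \sum_(n < N1) coef g (N + n) * w ^+ (N + n).
  by rewrite taylor_polyE big_split_ord/=; ring.
apply: le_trans (ler_cmodD _ _) _; rewrite [X in _ <= X]addrC; apply: lerD => //.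
apply: le_trans (cmod_sum _ _ _) _.
apply: le_trans (ler_wpM2l C0 (geo_sum_le N N1 q01)); rewrite mulr_sumr.
apply: ler_sum => n _; rewrite cmodM cmodX /q exprMn exprVn mulrA mulrAC.
by rewrite ler_wpM2r// exprn_ge0// cmod_ge0.
Qed.

(** On the circle of radius [t] the Fourier coefficients tend to 0, hence are bounded. *)
Lemma coef_geo t : 0 < t < 1 -> exists C, forall n, cmod (coef g n) <= C / t ^+ n.
Proof.
move=> t01; have /andP[t0 t1] := t01.
have [N H] := riemann_lebesgueN (hol_ccurve hg t01) ltr01.
have key n : cmod (cmean (fun x => g (circ t x) * expi (- x) ^+ n)) = cmod (coef g n) * t ^+ n.
  rewrite -(coef_circ n hg t01).
  have -> : (fun x => g (circ t x) * (circ t x)^-1 ^+ n) =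
            (fun x => Complex (t ^- n) 0 * (g (circ t x) * expi (- x) ^+ n)).
    by apply/funext => x; rewrite circVX// mulrCA.
  rewrite cmeanZ; last first.
    by apply: ccurveM (hol_ccurve hg t01) _; apply: ccurveX; exact: ccurve_expiN.
  rewrite cmodM cmod_real ger0_norm ?invr_ge0 ?exprn_ge0 ?(ltW t0)// mulrAC mulVf ?mul1r//.
  by rewrite expf_neq0// gt_eqF.
exists (1 + \sum_(n < N) cmod (coef g n) * t ^+ n) => n.
rewrite ler_pdivlMr ?exprn_gt0//.
have S0 m : 0 <= cmod (coef g m) * t ^+ m by rewrite mulr_ge0 ?cmod_ge0 ?exprn_ge0 ?(ltW t0).
have [Nn|nN] := leqP N n.
  apply: (@le_trans _ _ 1); last by rewrite lerDl sumr_ge0.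
  by rewrite -(key n); exact: ltW (H n Nn).
rewrite (bigD1 (Ordinal nN))//= addrCA lerDl; apply: addr_ge0 => //.
by apply: sumr_ge0 => i _; exact: S0.
Qed.

Lemma unif_approx r e : 0 <= r < 1 -> 0 < e -> exists N0, forall N, (N0 < N)%N ->
  forall w, cmod w < r -> cmod (g w - (taylor_poly g N).[w]) <= e.
Proof.
move=> /andP[r0 r1] e0; pose t := (r + 1) / 2.
have t0 : 0 < t by rewrite /t; lra.
have t1 : t < 1 by rewrite /t; lra.
have rt : r < t by rewrite /t; lra.
have [|C hC] := @coef_geo t; first by rewrite t0.
have C0 : 0 <= C by have := le_trans (cmod_ge0 _) (hC 0%N); rewrite expr0 divr1.
have rt' : 0 <= r < t by rewrite r0.
have [N0 H] := geo_tail_small C0 rt' e0; exists N0 => N N0N w wr.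
have wt : cmod w < t by exact: lt_trans wr rt.
apply: le_trans (taylor_tail _ hC wt _) _; [by rewrite t0 ltW|exact: leq_ltn_trans N0N|].
by apply: (H _ (ltnW N0N)); rewrite cmod_ge0 ltW.
Qed.

End expansion.

Definition pdisc : set R[i] := [set w | 0 < cmod w < 1].

Lemma copen_pdisc : copen pdisc.
Proof.
move=> w /andP[w0 w1]; exists (Num.min (cmod w) (1 - cmod w)).
  by rewrite lt_min w0 subr_gt0.
move=> v; rewrite lt_min => /andP[h1 h2]; apply/andP; split.
  rewrite cmodC in h1; have := le_lt_trans (ler_distB w v) h1; lra.
have := le_lt_trans (ler_distB v w) h2; lra.
Qed.

Lemma cmset_pdisc : cmset pdisc.
Proof. exact: copen_cmset copen_pdisc. Qed.

(** The value at 0 is arbitrary here, but a point does not affect measurability. *)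
Lemma cmfun_disc1 g : hol_pdisc g -> cmfun (disc 1) (fun w => cmod (g w)).
Proof.
move=> hg; have oU := copen_pdisc; set U := pdisc in oU.
have -> : disc 1 = U `|` [set 0].
  apply/seteqP; split => w; rewrite /disc /U /pdisc /=.
    move=> w1; have [->|w0] := eqVneq w 0; [by right|left].
    by rewrite cmod_gt0 w0.
  by move=> [/andP[]//|->]; rewrite cmod0.
have p0 : planar [set 0 : R[i]] = [set (0, 0)].
  apply/seteqP; split => [[a b]|[a b]]; rewrite /planar/=; first by move=> [-> ->].
  by move=> [-> ->].
rewrite /cmfun; have -> : planar (U `|` [set 0]) = planar U `|` [set (0, 0)].
  by rewrite -p0.
have m0 : measurable [set (0 : R, 0 : R)].
  rewrite (_ : [set (0 : R, 0 : R)] = [set 0] `*` [set 0]).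
    by apply: measurableX; exact: measurable_set1.
  by apply/seteqP; split => [_ ->//|[a b]] [/= -> ->].
apply/measurable_funU; [exact: copen_cmset|exact: m0|split].
  by apply: cdiff_cmfun => // w; exact: hg.
exact: measurable_fun_set1.
Qed.

(** Either [e <= h x] or [x <= e / h]. This replaces the triangle inequality and is valid
    for every exponent. *)
Lemma powR_split p x e h y : 0 <= p -> 0 <= x -> 0 <= e -> 0 < h -> 0 <= y -> y <= x + e ->
  y `^ p <= (1 + h) `^ p * x `^ p + ((1 + h^-1) * e) `^ p.
Proof.
move=> p0 x0 e0 h0 y0 yxe.
have h1 : 0 <= 1 + h by lra.
have hV : 0 <= 1 + h^-1 by rewrite addr_ge0 ?invr_ge0 ?(ltW h0).
rewrite -powRM//.
have [exh|xeh] := leP e (h * x).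
  apply: ler_wpDr; first exact: powR_ge0.
  by apply: ge0_ler_powR => //; rewrite ?nnegrE// ?mulr_ge0//; lra.
apply: ler_wpDl; first exact: powR_ge0.
have : x <= h^-1 * e by rewrite ler_pdivlMl// ltW.
by move=> xe; apply: ge0_ler_powR => //; rewrite ?nnegrE// ?mulr_ge0//; lra.
Qed.

Lemma limit_le p (L G I : R) : 0 < p -> 0 <= G -> 0 <= I ->
  (forall h, 0 < h -> L <= (1 + h) `^ p * G + h `^ p * I) -> L <= G.
Proof.
move=> p0 G0 I0 H; apply/ler_addgt0Pr => e e0.
have [K K0 HK] := powR_near1 p.
pose M := K * G + I + 1.
have M0 : 0 < M by rewrite /M ltr_wpDl// addr_ge0// mulr_ge0.
pose zt := Num.min (3 / 4) (e / M).
have zt0 : 0 < zt by rewrite lt_min !divr_gt0.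
pose h := Num.min zt (zt `^ p^-1).
have h0 : 0 < h by rewrite lt_min zt0 powR_gt0.
have hz : h <= zt by rewrite ge_min lexx.
have h34 : h <= 3 / 4 by apply: le_trans hz _; rewrite ge_min lexx.
have hp : h `^ p <= zt.
  have -> : zt = (zt `^ p^-1) `^ p by rewrite -powRrM mulVf ?gt_eqF// powRr1// ltW.
  apply: ge0_ler_powR; rewrite ?nnegrE ?(ltW p0) ?(ltW h0) ?powR_ge0//.
  by rewrite ge_min lexx orbT.
have h1p : (1 + h) `^ p <= 1 + K * zt.
  have := HK h; rewrite ger0_norm ?(ltW h0)// => /(_ h34).
  rewrite ler_norml => /andP[_ h2]; have : K * h <= K * zt by rewrite ler_wpM2l.
  by lra.
apply: le_trans (H h h0) _.
apply: (@le_trans _ _ ((1 + K * zt) * G + zt * I)).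
  by apply: lerD; rewrite ler_wpM2r.
have : zt * M <= e.
  by rewrite -ler_pdivlMr// ge_min lexx orbT.
by rewrite /M; have := ltW zt0; nra.
Qed.

(** Integral lower bounds pass from polynomials to uniform limits: with the uniform error
    [e = h / (1 + 1 / h)], [powR_split] loses a factor [(1 + h) ^ p] and a term [h ^ p I].
    *)
Lemma aint_approx D g p b (I L : R) : 0 < p -> cmset D -> cmfun D (fun w => cmod (g w)) ->
  aint D (cpow b) = I%:E ->
  (forall e, 0 < e -> exists2 P : {poly R[i]}, (forall w, D w -> cmod (g w - P.[w]) <= e) &
     (L%:E <= aint D (fun w => cpow b w * cmod P.[w] `^ p)%R)%E) ->
  (L%:E <= aint D (fun w => cpow b w * cmod (g w) `^ p)%R)%E.
Proof.
move=> p0 mD mg IE H.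
have mc := cmfun_cpow b mD.
have mF : cmfun D (fun w => cpow b w * cmod (g w) `^ p) by apply: cmfunM => //; exact: cmfun_powR.
have F0 w : D w -> 0 <= cpow b w * cmod (g w) `^ p by move=> _; rewrite mulr_ge0 ?cpow_ge0 ?powR_ge0.
have I0 : 0 <= I.
  by rewrite -lee_fin -IE; apply: aint_ge0 => w _; exact: cpow_ge0.
have := aint_ge0 F0; set A := aint D _ => A0.
have [->|Afin] := eqVneq A +oo%E; first by rewrite leey.
have AE : A = (fine A)%:E by rewrite fineK// ge0_fin_numE// ltey.
rewrite AE lee_fin; apply: (limit_le p0 _ I0); first exact: fine_ge0.
move=> h h0; pose e := h / (1 + h^-1).
have hV : 0 < 1 + h^-1 by rewrite ltr_wpDr// invr_ge0 ltW.
have e0 : 0 < e by rewrite divr_gt0.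
have [P gP] := H e e0.
rewrite -lee_fin => /le_trans; apply.
have k0 : 0 <= (1 + h) `^ p by exact: powR_ge0.
have k1 : 0 <= h `^ p by exact: powR_ge0.
rewrite EFinD !EFinM -AE -IE /A -aintZ// -(aintZ mD mc _ k1); last by move=> *; exact: cpow_ge0.
have m1 : cmfun D (fun w => (1 + h) `^ p * (cpow b w * cmod (g w) `^ p)).
  exact: (cmfunM (cmfun_cst (D := D) _) mF).
have m2 : cmfun D (fun w => h `^ p * cpow b w).
  exact: (cmfunM (cmfun_cst (D := D) _) mc).
rewrite -aintD//; last 2 first.
- by move=> w Dw; exact: mulr_ge0 k0 (F0 w Dw).
- by move=> w Dw; exact: mulr_ge0 k1 (cpow_ge0 _ _).
apply: le_aint => //.
- apply: cmfunM => //; apply: cmfun_powR; exact: cmfun_horner.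
- exact: cmfunD.
move=> w Dw; apply/andP; split; first by rewrite mulr_ge0 ?cpow_ge0 ?powR_ge0.
rewrite (mulrCA ((1 + h) `^ p)) (mulrC (h `^ p)) -mulrDr ler_wpM2l ?cpow_ge0//.
have he : (1 + h^-1) * e = h by rewrite /e mulrC divfK// gt_eqF.
rewrite -[in h `^ p]he; apply: powR_split; rewrite ?cmod_ge0 ?(ltW p0) ?(ltW e0)//.
have := gP w Dw; rewrite cmodC => gPw.
by have := ler_distB P.[w] (g w); lra.
Qed.

Section lower.
Variable g : R[i] -> R[i].
Hypotheses (hg : hol_pdisc g) (ng : nopole g) (g0 : g 0 = coef g 0).

Lemma cmfun_annulus s t : t <= 1 -> cmfun (annulus s t) (fun w => cmod (g w)).
Proof.
move=> t1; apply: cmfunS (cmfun_disc1 hg); first exact: cmset_disc.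
by move=> w /andP[_ wt]; exact: lt_le_trans wt t1.
Qed.

Theorem submean p b s t : 0 < p -> - 2 < b -> 0 <= s -> s <= t -> t < 1 ->
  ((cmod (coef g 0) `^ p)%:E * aint (annulus s t) (cpow b) <=
   aint (annulus s t) (fun w => cpow b w * cmod (g w) `^ p)%R)%E.
Proof.
move=> p0 b2 s0 st t1; have t0 : 0 <= t by exact: le_trans st.
have IE := aint_cpow_annulus b2 s0 st; rewrite IE -EFinM.
apply: (aint_approx p0 (@cmset_annulus R s t) (cmfun_annulus (ltW t1)) IE) => e e0.
have [|N0 H] := @unif_approx g hg ng g0 t e _ e0; first by rewrite t0.
exists (taylor_poly g N0.+1) => [w /andP[_ wt]|]; first exact: (H N0.+1).
rewrite EFinM -IE -(@coef_taylor_poly g N0.+1 0)//; exact: poly_submean.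
Qed.

(** The hypothesis on [g] passes to its Taylor polynomials with [2 dl] in place of [dl].
    *)
Theorem quad_lower p b r dl n (kp := p ^+ 2 / 4 - qconst p * (2 * dl)) (b0 := coef g 0) :
  0 < p -> - 2 < b -> 0 <= r < 1 -> b0 != 0 -> (0 < n)%N -> 0 < dl <= 8^-1 -> 0 <= kp ->
  (forall w, cmod w < r -> cmod (g w - b0) <= dl * cmod b0) ->
  ((cmod b0 `^ p * (disc_moment b r + kp * cmod (coef g n / b0) ^+ 2 * disc_moment (b + (2 * n)%:R) r))%:E <=
   aint (annulus 0 r) (fun w => cpow b w * cmod (g w) `^ p)%R)%E.
Proof.
move=> p0 b2 r01 b00 n0 /andP[dl0 dl8] kp0 hgb; have /andP[r0 r1] := r01.
apply: (aint_approx p0 (@cmset_annulus R 0 r) (cmfun_annulus (ltW r1)) (aint_disc_moment b2 r0)) => e e0.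
pose e' := Num.min e (dl * cmod b0).
have e'0 : 0 < e' by rewrite lt_min e0 mulr_gt0// cmod_gt0.
have [N0 H] := @unif_approx g hg ng g0 r e' r01 e'0.
have N0N : (N0 < (N0 + n).+1)%N by rewrite ltnS leq_addr.
have nN : (n < (N0 + n).+1)%N by rewrite ltnS leq_addl.
exists (taylor_poly g (N0 + n).+1) => [w /andP[_ wr]|].
  by apply: le_trans (H _ N0N _ wr) _; rewrite ge_min lexx.
have c0 : (taylor_poly g (N0 + n).+1)`_0 = b0 by rewrite coef_taylor_poly.
rewrite -(coef_taylor_poly g nN) -c0; apply: poly_quad_lower => //; rewrite ?c0//; first lra.
move=> w wr; have := H _ N0N _ wr; rewrite le_min cmodC => /andP[_ h1].
have h2 := hgb w wr; set P := _.[w] in h1 *.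
have -> : P - b0 = (P - g w) + (g w - b0) by ring.
apply: le_trans (ler_cmodD _ _) _; lra.
Qed.

End lower.
End approx.

Arguments pdisc {R}.

(** * Local bounds and the order of the pole *)

Section local.
Variable R : realType.
Implicit Types (x y r s t p q b e rho : R) (w z v : R[i]) (f g h : R[i] -> R[i]) (F : R[i] -> R).

(** Near 0 the function is bounded and close to [h 0]; take circles of small radius. *)
Lemma hol_disc_nopole h : (forall w, cmod w < 1 -> cdiff h w) -> nopole h /\ h 0 = coef h 0.
Proof.
move=> dh; have hh : hol_pdisc h by move=> w /andP[_ w1]; exact: dh.
have ch : cctn h 0 by apply: cdiff_cctn; apply: dh; rewrite cmod0.
split.
  apply: nopole_crit => // e e0.
  have [d d0 hd] := ch 1 ltr01; pose M := cmod (h 0) + 1.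
  have M0 : 0 < M by rewrite ltr_wpDl// cmod_ge0.
  pose t := Num.min (d / 2) (Num.min 2^-1 (e / M)).
  have t0 : 0 < t by rewrite !lt_min invr_gt0 ltr0n /= !divr_gt0.
  have td : t <= d / 2 by rewrite ge_min lexx.
  have t2 : t <= 2^-1 by rewrite !ge_min lexx orbT.
  have te : t <= e / M by rewrite !ge_min lexx !orbT.
  exists t; first by rewrite t0/=; lra.
  move=> x; have : cmod (h (circ t x)) <= M.
    have /hd : cmod (circ t x - 0) < d by rewrite subr0 cmod_circ ?(ltW t0)//; lra.
    by have := ler_distB (h (circ t x)) (h 0); rewrite /M; lra.
  move=> hM; apply: le_trans (_ : M * t <= e); first by rewrite ler_pM2r.
  by rewrite mulrC -ler_pdivlMr.
pose F w := h w - h 0.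
have hF : hol_pdisc F by move=> w w1; apply: cdiffB; [exact: hh|exact: cdiff_cst].
have EF : coef F 0 = coef h 0 - h 0.
  have := hol_ccurve hh (half01 R) => c1.
  rewrite /coef; have -> : (fun x : R => F (circ 2^-1 x) * (circ 2^-1 x)^-1 ^+ 0) =
      (fun x => h (circ 2^-1 x) + (- h 0)) by apply/funext => x; rewrite expr0 mulr1.
  rewrite cmeanD//; last exact: ccurve_cst.
  rewrite cmean_cst; congr (cmean _ + _); by apply/funext => x; rewrite expr0 mulr1.
apply/eqP; rewrite eq_sym -subr_eq0 -cmod_eq0 eq_le cmod_ge0 andbT -EF.
apply/ler_addgt0Pr => e e0; rewrite add0r.
have [d d0 hd] := ch (e / 2) ltac:(by rewrite divr_gt0).
pose t := Num.min (d / 2) 2^-1.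
have t0 : 0 < t by rewrite !lt_min invr_gt0 ltr0n !divr_gt0.
have td : t <= d / 2 by rewrite ge_min lexx.
have t2 : t <= 2^-1 by rewrite !ge_min lexx orbT.
have t01 : 0 < t < 1 by rewrite t0/=; lra.
apply: le_trans (coef_bound 0 hF t01 (M := e / 2) _) _; last by rewrite expr0 divr1; lra.
move=> x; apply/ltW/hd; rewrite subr0 cmod_circ ?(ltW t0)//; lra.
Qed.

(** [submean] on the half-radius ball, moved to the origin. Pointwise values are thus
    controlled by any integral whose integrand dominates [|f| ^ p] near the point. *)
Lemma ball_submean p f w0 rho (D : set R[i]) F : 0 < p -> 0 < rho ->
  (forall w, cmod (w - w0) < rho -> cdiff f w) -> cmset D -> cmfun D F ->
  (forall w, D w -> 0 <= F w) ->
  (forall w, cmod (w - w0) < rho -> D w /\ cmod (f w) `^ p <= F w) ->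
  ((disc_moment 0 2^-1 * rho ^+ 2 * cmod (f w0) `^ p)%:E <= aint D F)%E.
Proof.
move=> p0 rho0 df mD mF F0 fF.
pose a : R[i] := Complex rho 0.
have ca : cmod a = rho by rewrite cmod_real gtr0_norm.
have a0 : a != 0 by rewrite -cmod_gt0 ca.
pose h u := f (a * u + w0).
have hD u : cmod u < 1 -> cmod (a * u + w0 - w0) < rho.
  by move=> u1; rewrite addrK cmodM ca gtr_pMr.
have dh u : cmod u < 1 -> cdiff h u by move=> /hD/df; exact: cdiff_affine.
have [nh h0] := hol_disc_nopole dh.
have hh : hol_pdisc h by move=> w /andP[_ w1]; exact: dh.
have b2 : - 2 < 0 :> R by lra.
have V0 : 0 <= (2^-1 : R) by rewrite invr_ge0.
have V1 : (2^-1 : R) < 1 by lra.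
have := submean hh nh h0 p0 b2 (lexx 0) V0 V1.
rewrite aint_disc_moment// -h0 /h mulr0 add0r => H.
pose B : set R[i] := [set w | cmod (w - w0) < rho / 2].
have r2 : rho / 2 < rho by lra.
have oB : copen B.
  move=> w Bw; exists (rho / 2 - cmod (w - w0)); first by rewrite subr_gt0.
  move=> v vw; rewrite /B /= (_ : v - w0 = (v - w) + (w - w0)); last by ring.
  by apply: le_lt_trans (ler_cmodD _ _) _; lra.
have mB := copen_cmset oB.
have BD : B `<=` D by move=> w Bw; have [] := fF w (lt_trans Bw r2).
have mf : cmfun B (fun w => cmod (f w) `^ p).
  by apply: cmfun_powR; apply: cdiff_cmfun => // w Bw; apply: df; exact: lt_trans Bw r2.
have f0 w : B w -> 0 <= cmod (f w) `^ p by move=> _; exact: powR_ge0.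
apply: (@le_trans _ _ (aint B (fun w => cmod (f w) `^ p))); last first.
  apply: (@le_trans _ _ (aint B F)).
    apply: le_aint => //; first exact: cmfunS mF.
    by move=> w Bw; rewrite powR_ge0/=; have [] := fF w (lt_trans Bw r2).
  exact: subset_aint.
rewrite (aint_affine w0 mB mf f0 a0) ca.
have -> : [set w | B (a * w + w0)] = annulus 0 2^-1.
  apply/seteqP; split => w; rewrite /B /annulus /= addrK cmodM ca cmod_ge0/=; rewrite ltr_pM2l//.
have -> : aint (annulus 0 2^-1) (fun w => cmod (f (a * w + w0)) `^ p) =
          aint (annulus 0 2^-1) (fun w => cpow 0 w * cmod (h w) `^ p).
  by apply: eq_aint => w _; rewrite /cpow powRr0 mul1r.
rewrite mulrAC [X in X%:E]mulrC EFinM; apply: lee_wpmul2l.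
  by rewrite lee_fin exprn_ge0// ltW.
by rewrite mulrC EFinM.
Qed.

(** Otherwise infinitely many disjoint annuli would each contribute more than [e]. *)
Lemma dyadic_small F e : cmfun pdisc F -> (forall w, pdisc w -> 0 <= F w) ->
  (aint pdisc F < +oo)%E -> 0 < e ->
  exists j, (aint (annulus (2^-1 ^+ j.+1)%R (2^-1 ^+ j)%R) F <= e%:E)%E.
Proof.
move=> mF F0 Ffin e0; apply/not_existsP => H.
have h0 : 0 < (2^-1 : R) by rewrite invr_gt0.
have h1 : (2^-1 : R) <= 1 by lra.
have pw J : 0 < (2^-1 : R) ^+ J by rewrite exprn_gt0.
have pw1 J : (2^-1 : R) ^+ J <= 1 by rewrite exprn_ile1// ltW.
have pwS J : (2^-1 : R) ^+ J.+1 <= 2^-1 ^+ J by rewrite exprS ler_piMl// ltW.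
have sub J t : t <= 1 -> annulus (2^-1 ^+ J) t `<=` pdisc.
  by move=> t1 w /andP[w0 w1]; apply/andP; split; [exact: lt_le_trans w0|exact: lt_le_trans t1].
have mA J t : t <= 1 -> cmfun (annulus (2^-1 ^+ J) t) F.
  by move=> t1; apply: cmfunS mF => //; [exact: cmset_pdisc|exact: sub].
have key J : ((J%:R * e)%:E <= aint (annulus (2^-1 ^+ J)%R 1%R) F)%E.
  elim: J => [|J ih].
    rewrite mul0r; apply: aint_ge0 => w Aw; apply: F0; exact: sub Aw.
  rewrite (@aint_split R F _ (2^-1 ^+ J))//; last 2 first.
  - exact: mA.
  - by move=> w Aw; apply: F0; exact: sub Aw.
  rewrite -natr1 mulrDl mul1r addrC EFinD; apply: leeD => //.
  by apply/ltW; rewrite ltNge; apply/negP; exact: H.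
have [J HJ] : exists J : nat, fine (aint pdisc F) < J%:R * e.
  exists (Num.bound (`|fine (aint pdisc F)| / e)).
  rewrite -ltr_pdivrMr//; apply: le_lt_trans (archi_boundP _).
    by rewrite ler_pM2r ?invr_gt0// ler_norm.
  by rewrite divr_ge0// ltW.
have A0 : (0 <= aint pdisc F)%E by exact: aint_ge0.
have : ((J%:R * e)%:E <= aint pdisc F)%E.
  apply: le_trans (key J) _; apply: subset_aint => //; [exact: cmset_annulus|exact: cmset_pdisc|].
  exact: sub.
rewrite -(@fineK _ (aint pdisc F)) ?ge0_fin_numE// lee_fin.
by rewrite leNgt HJ.
Qed.

(** On a circle of radius [t] in the middle of a dyadic annulus with a small share of the
    integral, [ball_submean] with radius [t / 4] makes [t ^ 2 |f| ^ p] small. As [(k + 1)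
    p >= 2], so is [t ^ (k + 1) |f|], and [w ^ k f] is smaller than a simple pole along
    these circles. *)
Lemma pole_order p f k : 0 < p -> 2 <= p * k.+1%:R -> hol_pdisc f ->
  (aint pdisc (fun w => cmod (f w) `^ p)%R < +oo)%E -> nopole (fun w => w ^+ k * f w).
Proof.
move=> p0 pk hf fin; apply: nopole_crit; first exact: hol_pdiscM (@hol_pdiscX R k) hf.
move=> e e0.
have mF : cmfun pdisc (fun w => cmod (f w) `^ p).
  by apply: cmfun_powR; apply: cdiff_cmfun; [exact: copen_pdisc|move=> w; exact: hf].
have F0 w : pdisc w -> 0 <= cmod (f w) `^ p by move=> _; exact: powR_ge0.
have c0 : 0 < disc_moment 0 2^-1 :> R.
  by rewrite /disc_moment addr0 mulr_gt0 ?powR_gt0 ?invr_gt0// divr_gt0// mulr_gt0 ?pi_gt0.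
pose e' := disc_moment 0 2^-1 / 16 * e `^ p.
have e'0 : 0 < e' by rewrite mulr_gt0 ?powR_gt0// divr_gt0.
have [j hj] := dyadic_small mF F0 fin e'0.
(* the balls of radius t / 4 about the circle of radius t = 3 u / 4 stay in u / 2 <= |w| < u *)
pose u : R := 2^-1 ^+ j.
have u0 : 0 < u by rewrite exprn_gt0// invr_gt0.
have u1 : u <= 1 by rewrite exprn_ile1 ?invr_ge0//; lra.
pose t := 3 / 4 * u.
have t0 : 0 < t by rewrite /t; lra.
have t1 : t < 1 by rewrite /t; lra.
exists t; first by rewrite t0.
move=> x; set w0 := circ t x; have cw : cmod w0 = t by rewrite cmod_circ// ltW.
have rho0 : 0 < t / 4 by rewrite divr_gt0.
have uS : (2^-1 : R) ^+ j.+1 = u / 2 by rewrite exprS mulrC.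
have inA w : cmod (w - w0) < t / 4 -> annulus (2^-1 ^+ j.+1) u w.
  move=> h; rewrite /annulus /= uS.
  have h2 := le_lt_trans (ler_distB w w0) h; have h3 := ler_distB w0 w.
  rewrite cmodC in h3; rewrite cw in h2 h3; rewrite /t in h h2 h3.
  by apply/andP; split; lra.
have sub : annulus (2^-1 ^+ j.+1) u `<=` pdisc.
  move=> w /andP[h1 h2]; apply/andP; split; last exact: lt_le_trans u1.
  by apply: lt_le_trans h1; rewrite exprn_gt0// invr_gt0.
have mA := @cmset_annulus R (2^-1 ^+ j.+1) u.
have := @ball_submean p f w0 (t / 4) (annulus (2^-1 ^+ j.+1) u) (fun w => cmod (f w) `^ p) p0 rho0.
move=> /(_ (fun w wh => hf w (sub w (inA w wh))) mA (cmfunS (@cmset_pdisc R) sub mF)).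
move=> /(_ (fun w _ => powR_ge0 _ _) (fun w wh => conj (inA w wh) (lexx _))).
move=> /le_trans => /(_ _ hj); rewrite lee_fin /e' => H.
have {}H : t ^+ 2 * cmod (f w0) `^ p <= e `^ p.
  rewrite -(ler_pM2l (_ : 0 < disc_moment 0 2^-1 / 16)) ?divr_gt0//.
  apply: le_trans H; rewrite le_eqVlt; apply/orP; left; apply/eqP; by field.
rewrite leNgt; apply/negP => h.
have : e `^ p < (cmod (w0 ^+ k * f w0) * t) `^ p.
  by apply: gt0_ltr_powR => //; rewrite ?nnegrE ?mulr_ge0 ?cmod_ge0// ltW.
rewrite ltNge; case/negP; apply: le_trans H.
rewrite cmodM cmodX cw mulrAC -exprSr powRM ?cmod_ge0 ?exprn_ge0 ?(ltW t0)//.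
rewrite ler_wpM2r ?powR_ge0// -!powR_mulrn ?(ltW t0)// -powRrM.
by apply: ger_powR; rewrite ?t0 ?(ltW t1)// mulrC.
Qed.

End local.

(** * Competitors: smallness of the coefficients *)

Section energy.
Variable R : realType.
Variables (p b : R).
Hypotheses (p0 : 0 < p) (b2 : - 2 < b) (b0 : b <= 0).
Implicit Types (x y r s t q e : R) (w z v : R[i]) (f g : R[i] -> R[i]) (F : R[i] -> R).

Definition energy g := aint (annulus 0 1) (fun w => cpow b w * cmod (g w) `^ p).

(** The constant 1 has energy [disc_moment b 1], so that only functions of at most this energy
    compete. *)
Definition competitor g := [/\ hol_pdisc g, nopole g, g 0 = coef g 0 & (energy g <= (disc_moment b 1)%:E)%E].

(** The radius [d] must not depend on [g], since the competitor varies with [z]. *)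
Definition near_origin (P : (R[i] -> R[i]) -> R[i] -> Prop) := exists2 d : R, 0 < d &
  forall g z, competitor g -> g z = 1 -> 0 < cmod z < d -> P g z.

Lemma near_origin_and P Q : near_origin P -> near_origin Q -> near_origin (fun g z => P g z /\ Q g z).
Proof.
move=> [d d0 hP] [d' d'0 hQ]; exists (Num.min d d'); first by rewrite lt_min d0.
by move=> g z ag gz; rewrite lt_min => /andP[z0 /andP[z1 z2]]; split; [apply: hP|apply: hQ]; rewrite ?z0.
Qed.

Lemma near_origin_imp (P Q : (R[i] -> R[i]) -> R[i] -> Prop) :
  (forall g z, competitor g -> g z = 1 -> 0 < cmod z -> P g z -> Q g z) -> near_origin P -> near_origin Q.
Proof.
move=> PQ [d d0 hP]; exists d => // g z ag gz zd; apply: PQ => //; last exact: hP.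
by case/andP: zd.
Qed.

Lemma near_origin_le e : 0 < e -> near_origin (fun _ z => cmod z <= e).
Proof. by move=> e0; exists e => // g z _ _ /andP[_ /ltW]. Qed.

Lemma disc_moment_gt0 c r : - 2 < c -> 0 < r -> 0 < disc_moment c r.
Proof.
move=> c2 r0; have h : 0 < 2 + c by lra.
by rewrite mulr_gt0 ?powR_gt0// divr_gt0// mulr_gt0 ?pi_gt0.
Qed.

Lemma cpow_ge1 w : 0 < cmod w <= 1 -> 1 <= cpow b w.
Proof. by move=> w01; rewrite -[X in X <= _](powRr0 (cmod w)); exact: ger_powR. Qed.

(** Cauchy estimates: [ball_submean] bounds [g] on the circle of radius [t] through the
    energy, because the weight is at least 1. *)
Lemma coef_unif t : 2^-1 <= t < 1 -> exists2 C, 0 <= C & forall g, competitor g ->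
  forall n, cmod (coef g n) <= C / t ^+ n.
Proof.
move=> /andP[t2 t1]; have t0 : 0 < t by lra.
have I0 := disc_moment_gt0 b2 ltr01.
have c1 : 0 < disc_moment 0 2^-1 :> R by apply: disc_moment_gt0; lra.
pose rho := 1 - t; have rho0 : 0 < rho by rewrite /rho; lra.
pose Y := disc_moment b 1 / (disc_moment 0 2^-1 * rho ^+ 2).
have cr : 0 < disc_moment 0 2^-1 * rho ^+ 2 by rewrite mulr_gt0// exprn_gt0.
exists (2 * Y `^ p^-1) => [|g [hg ng g0 Eg] n]; first by rewrite mulr_ge0 ?powR_ge0.
rewrite -mulrA; apply: coef_bound => //; first by rewrite t0.
move=> x; set w0 := circ t x; have cw : cmod w0 = t by rewrite cmod_circ// ltW.
have inA w : cmod (w - w0) < rho -> 0 < cmod w < 1.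
  move=> wr; have h2 := le_lt_trans (ler_distB w w0) wr; have h3 := ler_distB w0 w.
  rewrite cmodC in h3; rewrite cw in h2 h3; rewrite /rho in wr h2.
  by apply/andP; split; lra.
have mA := @cmset_annulus R 0 1.
have mF : cmfun (annulus 0 1) (fun w => cpow b w * cmod (g w) `^ p).
  by apply: cmfunM; [exact: cmfun_cpow|apply: cmfun_powR; exact: cmfun_annulus].
have := @ball_submean R p g w0 rho (annulus 0 1) _ p0 rho0 (fun w wh => hg w (inA w wh)) mA mF.
move=> /(_ (fun w _ => mulr_ge0 (cpow_ge0 _ _) (powR_ge0 _ _))).
have key w : cmod (w - w0) < rho -> annulus 0 1 w /\ cmod (g w) `^ p <= cpow b w * cmod (g w) `^ p.
  move=> /inA/andP[w0' w1]; split; first by rewrite /annulus /= cmod_ge0.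
  by rewrite ler_peMl ?powR_ge0// cpow_ge1// w0' ltW.
move=> /(_ key) /le_trans => /(_ _ Eg); rewrite lee_fin mulrC -ler_pdivlMr// -/Y => H.
rewrite -[X in X <= _](powRr1 (cmod_ge0 _)) -[in X in X <= _](@mulfV _ p) ?gt_eqF// powRrM.
by apply: ge0_ler_powR; rewrite ?nnegrE ?powR_ge0// ?invr_ge0 ?divr_ge0 ?(ltW p0) ?(ltW I0) ?(ltW cr).
Qed.

(** [quad_lower] on the disc of radius [r] and [submean] on the annulus from [r] to [t],
    with [t] tending to 1. The gain over [|c| ^ p disc_moment b 1] comes from the disc only. *)
Lemma excess g r n dl (kp := p ^+ 2 / 4 - qconst p * (2 * dl)) (c := coef g 0) :
  hol_pdisc g -> nopole g -> g 0 = coef g 0 -> 0 < r < 1 -> c != 0 -> (0 < n)%N ->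
  0 < dl <= 8^-1 -> 0 <= kp -> (forall w, cmod w < r -> cmod (g w - c) <= dl * cmod c) ->
  ((cmod c `^ p * (disc_moment b 1 + kp * cmod (coef g n / c) ^+ 2 * disc_moment (b + (2 * n)%:R) r))%:E
    <= energy g)%E.
Proof.
move=> hg ng g0 /andP[r0 r1] c0 n0 dl8 kp0 gc.
have r01 : 0 <= r < 1 by rewrite ltW.
have := quad_lower hg ng g0 p0 b2 r01 c0 n0 dl8 kp0 gc; rewrite -/kp -/c.
set Y := kp * _ * _; set c' := cmod c `^ p => H1.
have c'0 : 0 <= c' by exact: powR_ge0.
have mF s t : t <= 1 -> cmfun (annulus s t) (fun w => cpow b w * cmod (g w) `^ p).
  move=> t1; apply: cmfunM; first by apply: cmfun_cpow; exact: cmset_annulus.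
  by apply: cmfun_powR; exact: cmfun_annulus.
have F0 w : 0 <= cpow b w * cmod (g w) `^ p by rewrite mulr_ge0 ?cpow_ge0 ?powR_ge0.
have [->|Efin] := eqVneq (energy g) +oo%E; first by rewrite leey.
have E0 : (0 <= energy g)%E by apply: aint_ge0 => w _; exact: F0.
have EE : energy g = (fine (energy g))%:E by rewrite fineK// ge0_fin_numE// ltey.
rewrite EE lee_fin; apply/ler_addgt0Pr => e e0.
pose q := 2 + b; have q0 : 0 < q by rewrite -ltrBlDl sub0r.
have I0 := disc_moment_gt0 b2 ltr01.
have rq1 : r `^ q < 1.
  have -> : (1 : R) = 1 `^ q by rewrite pow1R.
  by apply: gt0_ltr_powR => //; rewrite nnegrE// ltW.
(* t is chosen with t ^ q = 1 - d, so that the disc of radius t misses only a share d of disc_moment b 1 *)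
pose d := Num.min (1 - r `^ q) (e / (c' * disc_moment b 1 + 1)).
have cI : 0 < c' * disc_moment b 1 + 1 by rewrite ltr_wpDl// mulr_ge0// ltW.
have d0 : 0 < d by rewrite lt_min subr_gt0 rq1 divr_gt0.
have dr : d <= 1 - r `^ q by rewrite ge_min lexx.
have de : d * (c' * disc_moment b 1 + 1) <= e by rewrite -ler_pdivlMr// ge_min lexx orbT.
have rq0 : 0 < r `^ q by exact: powR_gt0.
pose t := (1 - d) `^ q^-1.
have d1 : 0 < 1 - d by lra.
have tq : t `^ q = 1 - d by rewrite -powRrM mulVf ?gt_eqF// powRr1// ltW.
have t1 : t < 1.
  have -> : (1 : R) = 1 `^ q^-1 by rewrite pow1R.
  apply: gt0_ltr_powR; rewrite ?invr_gt0 ?nnegrE ?(ltW d1)//; lra.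
have rt : r <= t.
  have -> : r = (r `^ q) `^ q^-1 by rewrite -powRrM mulfV ?gt_eqF// powRr1// ltW.
  apply: ge0_ler_powR; rewrite ?invr_ge0 ?nnegrE ?(ltW d1) ?(ltW q0) ?(ltW rq0)//; lra.
have := submean hg ng g0 p0 b2 (ltW r0) rt t1.
rewrite (aint_cpow_annulus b2 (ltW r0) rt) -EFinM -/c -/c' => H2.
have st : annulus 0 t `<=` annulus 0 1.
  by move=> w /andP[w0 wt]; rewrite /annulus /= w0 (lt_trans wt).
have H3 : (aint (annulus 0 t) (fun w => cpow b w * cmod (g w) `^ p)%R <= energy g)%E.
  by apply: subset_aint => //; [exact: cmset_annulus|exact: cmset_annulus|exact: mF].
rewrite (aint_split (s := r)) in H3; [|exact: mF (ltW t1)|by []|exact: ltW|by []].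
have := le_trans (leeD H1 H2) H3; rewrite EE -EFinD lee_fin /disc_moment pow1R mulr1 -/q tq.
move: de; rewrite /disc_moment pow1R mulr1 -/q; set J := 2 * pi / q => de H4.
have : c' * (J + Y) - d * (c' * J) <= fine (energy g).
  by apply: le_trans H4; rewrite le_eqVlt; apply/orP; left; apply/eqP; ring.
move: de; rewrite mulrDr mulr1; clear - d0; lra.
Qed.

(** [g z = 1], and [g] varies little near 0. *)
Lemma coef0_near : exists2 K, 0 <= K & near_origin (fun g z => cmod (coef g 0 - 1) <= K * cmod z).
Proof.
have [|C C0 hC] := @coef_unif 2^-1; first by lra.
exists (4 * C); first by rewrite mulr_ge0.
apply: near_origin_imp (near_origin_le (_ : 0 < 4^-1)); last by rewrite invr_gt0.
move=> g z ag gz z0 z4; have [hg ng g0 _] := ag.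
have z2 : cmod z < 2^-1 by lra.
have := taylor_tail hg ng g0 _ (hC g ag) z2 (ltn0Sn 0) => /(_ ltac:(by rewrite invr_gt0; lra)).
rewrite taylor_polyE big_ord1 expr0 mulr1 gz expr1 cmodC invrK => /le_trans; apply.
rewrite (_ : 4 * C * cmod z = C * (4 * cmod z)); last by ring.
by rewrite ler_wpM2l// ler_pdivrMr; [nra|lra].
Qed.

Lemma coef0_bounds e : 0 < e -> near_origin (fun g z => [/\ coef g 0 != 0, 2^-1 <= cmod (coef g 0) <= 2 &
  1 - e <= cmod (coef g 0) `^ p]).
Proof.
move=> e0; have [K K0 hK] := coef0_near; have [L L0 hL] := powR_near1 p.
pose d := Num.min (2^-1 / (K + 1)) (e / (L * K + 1)).
have K1 : 0 < K + 1 by lra.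
have LK : 0 <= L * K by rewrite mulr_ge0.
have d0 : 0 < d by rewrite lt_min !divr_gt0//; lra.
apply: near_origin_imp (near_origin_and hK (near_origin_le d0)) => g z _ _ z0 [h1 h2].
have a1 : K * cmod z <= 2^-1.
  have : cmod z <= 2^-1 / (K + 1) by apply: le_trans h2 _; rewrite ge_min lexx.
  by rewrite ler_pdivlMr//; lra.
have a2 : L * K * cmod z <= e.
  have : cmod z <= e / (L * K + 1) by apply: le_trans h2 _; rewrite ge_min lexx orbT.
  by rewrite ler_pdivlMr; lra.
have n1 := ler_distB (coef g 0) 1; have n2 := ler_distB 1 (coef g 0).
rewrite cmodC in n2; rewrite cmod1 in n1 n2.
set x := cmod (coef g 0) - 1.
have xK : `|x| <= K * cmod z by rewrite ler_norml /x; apply/andP; split; lra.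
split.
- by rewrite -cmod_gt0; lra.
- by apply/andP; split; lra.
have := hL x ltac:(lra); rewrite (_ : 1 + x = cmod (coef g 0)); last by rewrite /x; ring.
rewrite ler_norml => /andP[+ _]; have : L * `|x| <= L * (K * cmod z) by rewrite ler_wpM2l.
lra.
Qed.

Lemma dl_choice k : k < p ^+ 2 / 4 -> exists2 dl, 0 < dl <= 8^-1 &
  k <= p ^+ 2 / 4 - qconst p * (2 * dl).
Proof.
move=> kp; have Q0 := qconst_ge0 p.
have u0 : 0 < p ^+ 2 / 4 - k by lra.
have q1 : 0 < 2 * (qconst p + 1) by lra.
exists (Num.min 8^-1 ((p ^+ 2 / 4 - k) / (2 * (qconst p + 1)))).
  by rewrite lt_min invr_gt0 ltr0n divr_gt0//= ge_min lexx.
set dl := Num.min _ _.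
have d0 : 0 < dl by rewrite lt_min invr_gt0 ltr0n divr_gt0.
have : dl <= (p ^+ 2 / 4 - k) / (2 * (qconst p + 1)) by rewrite ge_min lexx orbT.
rewrite ler_pdivlMr//; lra.
Qed.

(** [coef g 0] is close to 1, so the constant term already uses up nearly all the
    admissible energy; by [excess] on a fixed small disc, nothing is left for other
    coefficients. *)
Lemma coef_small n e : (0 < n)%N -> 0 < e -> near_origin (fun g _ => cmod (coef g n) <= e).
Proof.
move=> n0 e0; have p2 : 0 < p ^+ 2 by rewrite exprn_gt0.
have [|dl dl8 hk] := @dl_choice (p ^+ 2 / 8); first by lra.
have [|C C0 hC] := @coef_unif 2^-1; first by lra.
have dl0 : 0 < dl by case/andP: dl8.
have C8 : 0 < 8 * C + 1 by lra.
pose r := Num.min 4^-1 (dl / (8 * C + 1)).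
have r0 : 0 < r by rewrite lt_min invr_gt0 ltr0n divr_gt0.
have r4 : r <= 4^-1 by rewrite ge_min lexx.
have rC : r * (8 * C + 1) <= dl by rewrite -ler_pdivlMr// ge_min lexx orbT.
set k := p ^+ 2 / 4 - _ in hk.
pose J := disc_moment (b + (2 * n)%:R) r.
have J0 : 0 < J by apply: disc_moment_gt0 => //; rewrite (lt_le_trans b2)// lerDl.
have I0 := disc_moment_gt0 b2 ltr01.
have k0 : 0 < k by lra.
pose X := k * (e / 2) ^+ 2 * J.
have X0 : 0 < X.
  by apply: mulr_gt0 J0; apply: mulr_gt0 k0 _; rewrite exprn_gt0// divr_gt0.
pose e1 := Num.min 2^-1 (X / (2 * disc_moment b 1)).
have e10 : 0 < e1 by rewrite lt_min invr_gt0 ltr0n divr_gt0// mulr_gt0.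
have I2 : 0 < 2 * disc_moment b 1 by rewrite mulr_gt0.
have e1X : e1 * (2 * disc_moment b 1) <= X by rewrite -(ler_pdivlMr _ _ I2) ge_min lexx orbT.
have e12 : e1 <= 2^-1 by rewrite ge_min lexx.
apply: near_origin_imp (coef0_bounds e10) => g z ag gz z0 [c0 /andP[c2 c3] c1].
have [hg ng g0 Eg] := ag.
have r01 : 0 < r < 1 by rewrite r0; lra.
have gc w : cmod w < r -> cmod (g w - coef g 0) <= dl * cmod (coef g 0).
  move=> wr; have w2 : cmod w < 2^-1 by lra.
  have := taylor_tail hg ng g0 _ (hC g ag) w2 (ltn0Sn 0) => /(_ ltac:(by rewrite invr_gt0; lra)).
  rewrite taylor_polyE big_ord1 expr0 mulr1 expr1 invrK => /le_trans; apply.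
  apply: (@le_trans _ _ (C * (4 * cmod w))).
    by rewrite ler_wpM2l// ler_pdivrMr; have := cmod_ge0 w; nra.
  have : C * (4 * cmod w) <= C * (4 * r) by rewrite ler_wpM2l// ler_pM2l// ltW.
  have : dl * 2^-1 <= dl * cmod (coef g 0) by rewrite ler_pM2l.
  nra.
have := le_trans (excess hg ng g0 r01 c0 n0 dl8 (ltW k0) gc) Eg; rewrite lee_fin -/k -/J.
set c' := cmod _ `^ p in c1 *; set u := cmod (_ / _) => H.
have {}H : c' * (k * u ^+ 2 * J) <= (1 - c') * disc_moment b 1 by lra.
have {}H : k * u ^+ 2 * J <= X.
  apply: le_trans e1X; have t0 : 0 <= k * u ^+ 2 * J.
    exact: mulr_ge0 (mulr_ge0 (ltW k0) (sqr_ge0 _)) (ltW J0).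
  have : 2^-1 * (k * u ^+ 2 * J) <= c' * (k * u ^+ 2 * J) by rewrite ler_wpM2r//; lra.
  have : (1 - c') * disc_moment b 1 <= e1 * disc_moment b 1 by rewrite ler_pM2r//; lra.
  lra.
have {}H : u <= e / 2.
  have u0 : 0 <= u by exact: cmod_ge0.
  have e20 : 0 <= e / 2 by lra.
  by rewrite -ler_sqr ?nnegrE//; move: H; rewrite ler_pM2r// ler_pM2l.
have -> : coef g n = (coef g n / coef g 0) * coef g 0 by rewrite divfK.
rewrite cmodM -/u; apply: (@le_trans _ _ (e / 2 * 2)); last lra.
by apply: ler_pM => //; exact: cmod_ge0.
Qed.

Lemma coefs_small N e : 0 < e -> near_origin (fun g _ => forall n, (0 < n < N)%N -> cmod (coef g n) <= e).
Proof.
move=> e0; elim: N => [|N ih]; first by exists 1 => // g z _ _ _ n; rewrite ltn0 andbF.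
have [->|N0] := posnP N; first by exists 1 => // g z _ _ _ [].
apply: near_origin_imp (near_origin_and ih (coef_small N0 e0)) => g z _ _ _ [h1 h2] n /andP[n0].
by rewrite ltnS leq_eqVlt => /orP[/eqP->//|nN]; apply: h1; rewrite n0.
Qed.

(** Finitely many coefficients are small by [coef_small], the others are dominated by the
    remainder of a geometric series. *)
Lemma nearly_const r dl : 0 < r < 1 -> 0 < dl -> near_origin (fun g _ =>
  forall w, cmod w < r -> cmod (g w - coef g 0) <= dl * cmod (coef g 0)).
Proof.
move=> /andP[r0 r1] dl0; pose t := (1 + r) / 2.
have t2 : 2^-1 <= t by rewrite /t; lra.
have t1 : t < 1 by rewrite /t; lra.
have t0 : 0 < t by lra.
have rt : r < t by rewrite /t; lra.
have [|C C0 hC] := @coef_unif t; first by rewrite t2.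
have rt' : 0 <= r < t by rewrite ltW.
have dl4 : 0 < dl / 4 by rewrite divr_gt0.
have [N H] := geo_tail_small C0 rt' dl4.
pose e := dl / (4 * (N.+1%:R)).
have N1 : 0 < N.+1%:R :> R by rewrite ltr0n.
have e0 : 0 < e by rewrite divr_gt0// mulr_gt0.
have h2 : 0 < (2^-1 : R) by rewrite invr_gt0.
apply: near_origin_imp (near_origin_and (coefs_small N.+1 e0) (coef0_bounds h2)) => g z ag _ _.
move=> [hs [_ /andP[c2 _] _]] w wr; have [hg ng g0 _] := ag.
have wt : cmod w < t by exact: lt_trans wr rt.
have HT : cmod (g w - (taylor_poly g N.+1).[w]) <= dl / 4.
  apply: le_trans (taylor_tail hg ng g0 _ (hC g ag) wt (ltn0Sn N)) _; first by rewrite t0 ltW.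
  by apply: (H N.+1 (leqnSn N)); rewrite cmod_ge0 ltW.
have HP : cmod ((taylor_poly g N.+1).[w] - coef g 0) <= dl / 4.
  rewrite taylor_polyE big_ord_recl/= expr0 mulr1 addrAC subrr add0r.
  apply: le_trans (cmod_sum _ _ _) _; apply: (@le_trans _ _ (\sum_(i < N) e)).
    apply: ler_sum => i _; rewrite cmodM cmodX; apply: le_trans (hs (lift ord0 i) _).
      by rewrite ler_piMr ?cmod_ge0// exprn_ile1 ?cmod_ge0//; lra.
    by rewrite /= /bump /= add1n ltnS ltn_ord.
  rewrite sumr_const card_ord -[e *+ N]mulr_natl /e -(natr1 N).
  have N0 : 0 <= N%:R :> R by [].
  rewrite mulrA ler_pdivrMr; last by rewrite mulr_gt0// ltr_wpDl.
  by rewrite (_ : dl / 4 * _ = N%:R * dl + dl); [lra|field].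
have -> : g w - coef g 0 = (g w - (taylor_poly g N.+1).[w]) + ((taylor_poly g N.+1).[w] - coef g 0) by ring.
apply: le_trans (ler_cmodD _ _) _.
have : dl * 2^-1 <= dl * cmod (coef g 0) by rewrite ler_pM2l.
lra.
Qed.

(** By [nearly_const], [excess] applies with [r] close to 1 and [dl] close to 0, that is
    with nearly sharp constants. *)
Lemma quad_energy k : 0 < k < p ^+ 2 / 4 -> near_origin (fun g _ =>
  ((cmod (coef g 0) `^ p * (disc_moment b 1 + k * cmod (coef g 1 / coef g 0) ^+ 2 * disc_moment (b + 2) 1))%:E
   <= energy g)%E).
Proof.
move=> /andP[k0 kp]; pose k' := (k + p ^+ 2 / 4) / 2.
have k'p : k' < p ^+ 2 / 4 by rewrite /k'; lra.
have kk' : k < k' by rewrite /k'; lra.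
have k'0 : 0 < k' by lra.
have [dl dl8 hk] := dl_choice k'p; have dl0 : 0 < dl by case/andP: dl8.
have q0 : 0 < 2 + (b + 2) by move: b2; lra.
set q := 2 + (b + 2) in q0.
(* the radius at which the loss in disc_moment (b + 2) r turns k' into k *)
pose r := (k / k') `^ q^-1.
have kk0 : 0 < k / k' by exact: divr_gt0.
have r0 : 0 < r by exact: powR_gt0.
have r1 : r < 1.
  have -> : (1 : R) = 1 `^ q^-1 by rewrite pow1R.
  have kk1 : k / k' < 1 by rewrite ltr_pdivrMr// mul1r.
  by apply: gt0_ltr_powR; rewrite ?invr_gt0 ?nnegrE ?(ltW kk0).
have rq : k' * r `^ q = k.
  rewrite -powRrM mulVf ?gt_eqF// powRr1 ?(ltW kk0)//.
  by rewrite mulrCA divff ?mulr1// gt_eqF.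
have r01 : 0 < r < 1 by rewrite r0.
have h2 : 0 < (2^-1 : R) by rewrite invr_gt0.
apply: near_origin_imp (near_origin_and (nearly_const r01 dl0) (coef0_bounds h2)) => g z ag _ _ [gc [c0 _ _]].
have [hg ng g0 _] := ag.
have kp0 := le_trans (ltW k'0) hk.
apply: le_trans (excess hg ng g0 r01 c0 (ltn0Sn 0) dl8 kp0 gc); rewrite lee_fin muln1.
rewrite ler_wpM2l ?powR_ge0// lerD2l.
have -> : disc_moment (b + 2) r = r `^ q * disc_moment (b + 2) 1 by rewrite /disc_moment pow1R -/q; ring.
have I1 : 0 < disc_moment (b + 2) 1 by apply: disc_moment_gt0 => //; move: b2; lra.
rewrite mulrA ler_pM2r// [X in _ <= X]mulrAC; apply: ler_wpM2r; first exact: sqr_ge0.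
by rewrite -rq ler_pM2r// powR_gt0.
Qed.

End energy.

(** * Sharp bounds for the energy *)

Section bounds.
Variable R : realType.
Variables (p b : R).
Hypotheses (p0 : 0 < p) (b2 : - 2 < b) (b0 : b <= 0).
Implicit Types (x y r s t q e eta : R) (w z v : R[i]) (f g : R[i] -> R[i]) (F : R[i] -> R).

Let I0 := disc_moment b 1.
Let I1 := disc_moment (b + 2) 1.

Let I0_gt0 : 0 < I0. Proof. exact: disc_moment_gt0. Qed.
Let I1_gt0 : 0 < I1. Proof. by apply: disc_moment_gt0 => //; move: b2; lra. Qed.

(** The error must be [o(z ^ 2)], which is why the coefficient of index 2 has to tend to 0
    too. *)
Lemma linear_part_near1 e : 0 < e -> near_origin p b (fun g z =>
  cmod (coef g 0 + coef g 1 * z - 1) <= e * cmod z ^+ 2).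
Proof.
move=> e0; have [|C C0 hC] := @coef_unif R p b p0 b2 b0 2^-1; first by lra.
have C1 : 0 < 32 * C + 1 by lra.
pose d := Num.min 4^-1 (e / (32 * C + 1)).
have d0 : 0 < d by rewrite lt_min invr_gt0 ltr0n divr_gt0.
have e2 : 0 < e / 2 by rewrite divr_gt0.
apply: near_origin_imp (near_origin_and (near_origin_le p b d0) (coef_small p0 b2 b0 (ltn0Sn 1) e2)) => g z ag gz z0 [zd h2].
have [hg ng g0 _] := ag.
have z4 : cmod z <= 4^-1 by apply: le_trans zd _; rewrite ge_min lexx.
have zC : cmod z * (32 * C + 1) <= e.
  by rewrite -ler_pdivlMr//; apply: le_trans zd _; rewrite ge_min lexx orbT.
have z2 : cmod z < 2^-1 by lra.
have := taylor_tail hg ng g0 _ (hC g ag) z2 (ltn0Sn 2) => /(_ ltac:(by rewrite invr_gt0; lra)).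
rewrite taylor_polyE !big_ord_recl big_ord0/= expr0 mulr1 addr0 gz invrK => h1.
have h3 : (cmod z * 2) ^+ 3 / (1 - cmod z * 2) <= 16 * (cmod z * cmod z ^+ 2).
  rewrite ler_pdivrMr; last lra.
  have -> : (cmod z * 2) ^+ 3 = 8 * (cmod z * cmod z ^+ 2) by ring.
  have : 0 <= cmod z * cmod z ^+ 2 by rewrite mulr_ge0 ?cmod_ge0// sqr_ge0.
  move: (cmod z * cmod z ^+ 2) => y y0.
  have : y * (cmod z * 2) <= y * 2^-1 by rewrite ler_wpM2l//; lra.
  lra.
have -> : coef g 0 + coef g 1 * z - 1 =
   - (1 - (coef g 0 + (coef g (bump 0 0) * z ^+ bump 0 0 +
     coef g (bump 0 (bump 0 0)) * z ^+ bump 0 (bump 0 0)))) - coef g 2 * z ^+ 2.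
  by rewrite /bump /= expr1; ring.
apply: le_trans (ler_cmodB _ _) _; rewrite cmodN cmodM cmodX.
have s0 : 0 <= cmod z ^+ 2 by exact: sqr_ge0.
have h4 : cmod (coef g 2) * cmod z ^+ 2 <= e / 2 * cmod z ^+ 2 by rewrite ler_wpM2r.
have h5 := le_trans h1 (ler_wpM2l C0 h3).
have h6 : cmod z * (32 * C + 1) * cmod z ^+ 2 <= e * cmod z ^+ 2 by rewrite ler_wpM2r.
have h7 : 0 <= cmod z * cmod z ^+ 2 by rewrite mulr_ge0 ?cmod_ge0.
lra.
Qed.

(** The product on the right exceeds the left side by the square [A M (ze - m u) ^ 2],
    where [m] is determined by [4 k1 B M = p ^ 2], and terms that absorb the one in [C].
    *)
Lemma quad_opt (A B M k1 k C u ze : R) : 0 < A -> 0 < B -> 0 < M -> 4 * k1 * B * M = p ^+ 2 -> 0 < k1 < k ->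
  0 <= C -> 0 < ze <= 1 -> ze * (A * (C + 1)) <= (k - k1) * B ->
  1 + p * (u * ze) + C * (u * ze) ^+ 2 <= (A + k * u ^+ 2 * B) * (A^-1 + M * ze ^+ 2).
Proof.
move=> A0 B0 M0 kM /andP[k10 k1k] C0 /andP[z0 z1] zC.
have nA : A != 0 by rewrite gt_eqF.
have nB : B != 0 by rewrite gt_eqF.
have nM : M != 0 by rewrite gt_eqF.
pose m := p / (2 * A * M).
have k1E : k1 = p ^+ 2 / (4 * B * M) by rewrite -kM; field; rewrite nB nM.
have -> : (A + k * u ^+ 2 * B) * (A^-1 + M * ze ^+ 2) = 1 + p * (u * ze) + A * M * (ze - m * u) ^+ 2 +
    (k - k1) * B / A * u ^+ 2 + k * u ^+ 2 * B * (M * ze ^+ 2).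
  by rewrite k1E /m; field; rewrite nA nB nM.
have a1 : 0 <= A * M * (ze - m * u) ^+ 2 by apply: mulr_ge0 (sqr_ge0 _); exact: mulr_ge0 (ltW A0) (ltW M0).
have k0 : 0 < k by exact: lt_trans k1k.
have a2 : 0 <= k * u ^+ 2 * B * (M * ze ^+ 2).
  apply: mulr_ge0 (mulr_ge0 (ltW M0) (sqr_ge0 _)).
  exact: mulr_ge0 (mulr_ge0 (ltW k0) (sqr_ge0 _)) (ltW B0).
have a3 : C * (u * ze) ^+ 2 <= (k - k1) * B / A * u ^+ 2.
  have -> : C * (u * ze) ^+ 2 = C * ze ^+ 2 * u ^+ 2 by ring.
  apply: ler_wpM2r; first exact: sqr_ge0.
  rewrite ler_pdivlMr//; apply: le_trans zC.
  have zz : ze ^+ 2 <= ze by rewrite expr2 ler_piMr// ltW.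
  have : C * ze ^+ 2 * A <= C * ze * A by rewrite ler_pM2r// ler_wpM2l.
  have : 0 <= ze * A by rewrite mulr_ge0// ltW.
  clear - p0 b2 b0 I0_gt0 I1_gt0; lra.
move: a1 a2 a3; clear - p0 b2 b0 I0_gt0 I1_gt0; lra.
Qed.

Lemma normalised_modulus (a0 a1 z : R[i]) y : a0 != 0 -> cmod (a0 + a1 * z - 1) <= y ->
  1 - y <= cmod a0 * (1 + cmod (a1 / a0) * cmod z).
Proof.
move=> a00 ht.
have e1 : a0 + a1 * z = a0 * (1 + a1 / a0 * z).
  by rewrite mulrDr mulr1 mulrA mulrCA divff// mulr1.
have h1 : cmod (1 + a1 / a0 * z) <= 1 + cmod (a1 / a0) * cmod z.
  by apply: le_trans (ler_cmodD _ _) _; rewrite cmod1 cmodM.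
have h2 : cmod (a0 * (1 + a1 / a0 * z)) <= cmod a0 * (1 + cmod (a1 / a0) * cmod z).
  by rewrite cmodM ler_wpM2l// cmod_ge0.
have h3 := ler_distB 1 (a0 + a1 * z).
rewrite cmodC cmod1 e1 in h3; rewrite e1 in ht.
move: ht h2 h3; clear - p0 b2 b0 I0_gt0 I1_gt0; lra.
Qed.

Lemma absorb_error (A eta c X W L y sg ze : R) : 0 < A -> 0 < eta -> 0 < ze -> 0 < W -> 
  sg * L <= eta * A / 2 -> y = sg * ze ^+ 2 -> 1 - L * y <= c * X * W -> A / 2 <= c * X ->
  (W + eta * ze ^+ 2)^-1 <= c * X.
Proof.
move=> A0 eta0 z0 W0 sgL yE B4 B5.
have zz0 : 0 <= eta * ze ^+ 2 by apply: mulr_ge0 (ltW eta0) (sqr_ge0 _).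
have V0 : 0 < W + eta * ze ^+ 2 by rewrite ltr_pwDl.
rewrite -[X in X <= _]mul1r ler_pdivrMr// mulrDr.
have h1 : A / 2 * (eta * ze ^+ 2) <= c * X * (eta * ze ^+ 2) by exact: ler_wpM2r B5.
have h2 : L * y <= A / 2 * (eta * ze ^+ 2).
  have -> : L * y = sg * L * ze ^+ 2 by rewrite yE; ring.
  have -> : A / 2 * (eta * ze ^+ 2) = eta * A / 2 * ze ^+ 2 by field.
  by apply: ler_wpM2r sgL; exact: sqr_ge0.
move: B4 h1 h2; clear - p0 b2 b0 I0_gt0 I1_gt0; lra.
Qed.

(** Let [u = |b1 / b0|] and [x = u |z|]. The normalisation gives [|b0| (1 + x) >= 1 -
    o(|z| ^ 2)], and [quad_energy] bounds the energy below by [|b0| ^ p (I0 + k u ^ 2 I1)]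
    with [k] close to [p ^ 2 / 4]. What remains is the inequality [quad_opt] between [(1 +
    x) ^ p], which is [1 + p x] to first order, and [I0 + k u ^ 2 I1]. *)
Lemma competitor_lower eta : 0 < eta -> near_origin p b (fun g z =>
  (((I0^-1 + (I1^-1 + 2 * eta) * cmod z ^+ 2)^-1)%:E <= energy p b g)%E).
Proof.
move=> eta0.
have nI1 : I1 != 0 by rewrite gt_eqF.
have p2 : 0 < p ^+ 2 by rewrite exprn_gt0.
pose M := I1^-1 + eta; have M0 : 0 < M by rewrite addr_gt0// invr_gt0.
have nM : M != 0 by rewrite gt_eqF.
(* the smallest value allowed by quad_opt for the slope M slightly above 1 / I1 *)
pose k1 := p ^+ 2 / (4 * I1 * M).
have IM0 : 0 < 4 * I1 * M by apply: mulr_gt0 M0; exact: mulr_gt0.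
have k10 : 0 < k1 by rewrite divr_gt0.
have k1E : 4 * k1 * I1 * M = p ^+ 2 by rewrite /k1; field; rewrite nM nI1.
have k1p : k1 < p ^+ 2 / 4.
  have -> : k1 = p ^+ 2 / 4 / (I1 * M) by rewrite /k1 -[4 * I1 * M]mulrA invfM mulrA.
  have : 1 < I1 * M by rewrite /M mulrDr divff// ltrDl mulr_gt0.
  move=> h; rewrite ltr_pdivrMr; last exact: lt_trans h.
  by rewrite ltr_pMr// divr_gt0.
pose k := (k1 + p ^+ 2 / 4) / 2.
have k1k : k1 < k by rewrite /k; lra.
have kk : 0 < k < p ^+ 2 / 4 by rewrite (lt_trans k10 k1k) /k/=; lra.
have [C C0 HC] := powR_quad p.
have [L L0 HL] := powR_near1 p.
have L1 : 0 < 2 * (L + 1) by lra.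
have C1 : 0 < C + 1 by lra.
pose sg := eta * I0 / (2 * (L + 1)).
have sg0 : 0 < sg by rewrite divr_gt0// mulr_gt0.
have sgL : sg * L <= eta * I0 / 2.
  have : sg * (2 * (L + 1)) = eta * I0 by rewrite /sg divfK// gt_eqF.
  move: sg0; clear - p0 b2 b0 I0_gt0 I1_gt0; lra.
have IC : 0 < I0 * (C + 1) by rewrite mulr_gt0.
have kI : 0 < (k - k1) * I1 by rewrite mulr_gt0 ?subr_gt0.
pose d := Num.min 2^-1 (Num.min (2^-1 / sg) ((k - k1) * I1 / (I0 * (C + 1)))).
have h2 : 0 < (2^-1 : R) by rewrite invr_gt0.
have h4 : 0 < (4^-1 : R) by rewrite invr_gt0.
have d0 : 0 < d by rewrite !lt_min h2 (divr_gt0 h2 sg0) (divr_gt0 kI IC).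
apply: near_origin_imp (near_origin_and (near_origin_and (near_origin_le p b d0) (quad_energy p0 b2 b0 kk))
  (near_origin_and (near_origin_and (linear_part_near1 sg0) (coef0_bounds p0 b2 b0 h2)) (coef_small p0 b2 b0 (ltn0Sn 0) h4))).
move=> g z _ _ z0 [[zd H] [[ht [b00 /andP[b01 _] c1]] hb1]]; apply: le_trans H; rewrite lee_fin.
rewrite -/I0 -/I1.
have uE : cmod (coef g 1 / coef g 0) * cmod (coef g 0) = cmod (coef g 1) by rewrite -cmodM divfK.
set c := cmod (coef g 0) `^ p in c1 *; set u := cmod (_ / _) in uE *.
have B1 := normalised_modulus b00 ht; rewrite -/u in B1.
set ze := cmod z in z0 zd ht B1 *.
have u0 : 0 <= u by exact: cmod_ge0.
have zd1 : ze <= 2^-1 by apply: le_trans zd _; rewrite ge_min lexx.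
have zd2 : ze * sg <= 2^-1 by rewrite -ler_pdivlMr//; apply: le_trans zd _; rewrite !ge_min lexx orbT.
have zd3 : ze * (I0 * (C + 1)) <= (k - k1) * I1.
  by rewrite -ler_pdivlMr//; apply: le_trans zd _; rewrite !ge_min lexx !orbT.
have z1 : ze <= 1 by move: zd1; clear - p0 b2 b0 I0_gt0 I1_gt0; lra.
have zz : ze ^+ 2 <= ze by rewrite expr2 ler_piMl ?(ltW z0).
have u1 : u <= 2^-1.
  have : u * 2^-1 <= u * cmod (coef g 0) by rewrite ler_wpM2l.
  move: uE hb1; clear - p0 b2 b0 I0_gt0 I1_gt0; lra.
set x := u * ze in B1.
have x0 : 0 <= x by rewrite mulr_ge0// ltW.
have x1 : x <= 3 / 4.
  have : u * ze <= u * 1 by rewrite ler_wpM2l.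
  rewrite /x; move: u1; clear - p0 b2 b0 I0_gt0 I1_gt0; lra.
set y := sg * ze ^+ 2 in B1.
have y0 : 0 <= y by rewrite mulr_ge0 ?sqr_ge0// ltW.
have y1 : y <= 3 / 4.
  have : sg * ze ^+ 2 <= sg * ze by rewrite ler_pM2l.
  rewrite /y; move: zd2; clear - p0 b2 b0 I0_gt0 I1_gt0; lra.
have c0 : 0 < c by move: c1; clear - p0 b2 b0 I0_gt0 I1_gt0; lra.
have B2 : 1 - L * y <= c * (1 + p * x + C * x ^+ 2).
  have a1 : (1 - y) `^ p <= (cmod (coef g 0) * (1 + x)) `^ p.
    have y10 : 0 <= 1 - y by move: y1; clear - p0 b2 b0 I0_gt0 I1_gt0; lra.
    by apply: ge0_ler_powR; rewrite ?nnegrE ?(ltW p0)//; exact: le_trans B1.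
  have x10 : 0 <= 1 + x by rewrite addr_ge0.
  rewrite (powRM _ (cmod_ge0 _) x10) -/c in a1.
  have := HL (- y); rewrite normrN ger0_norm// => /(_ y1); rewrite ler_norml => /andP[a2 _].
  have := HC x; rewrite ger0_norm// => /(_ x1); rewrite ler_norml => /andP[_ a3].
  have a4 : c * (1 + x) `^ p <= c * (1 + p * x + C * x ^+ 2).
    by rewrite ler_pM2l//; move: a3; clear - p0 b2 b0 I0_gt0 I1_gt0; lra.
  move: a1 a2 a4; clear - p0 b2 b0 I0_gt0 I1_gt0; lra.
pose W := I0^-1 + M * ze ^+ 2.
have W0 : 0 < W by rewrite ltr_pwDl ?invr_gt0// mulr_ge0 ?sqr_ge0// ltW.
pose X := I0 + k * u ^+ 2 * I1.
have B3 : 1 + p * x + C * x ^+ 2 <= X * W.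
  apply: (@quad_opt I0 I1 M k1 k C u ze) => //; first by rewrite k10.
  by rewrite z0.
have B4 : 1 - L * y <= c * X * W by apply: le_trans B2 _; rewrite -mulrA ler_pM2l.
have B5 : I0 / 2 <= c * X.
  have : c * I0 <= c * X.
    rewrite ler_pM2l// lerDl mulr_ge0 ?(ltW I1_gt0)//; case/andP: kk => k0 _.
    exact: mulr_ge0 (ltW k0) (sqr_ge0 _).
  have : 2^-1 * I0 <= c * I0 by rewrite ler_pM2r//; move: c1; clear - p0 b2 b0 I0_gt0 I1_gt0; lra.
  clear - p0 b2 b0 I0_gt0 I1_gt0; lra.
have -> : I0^-1 + (I1^-1 + 2 * eta) * ze ^+ 2 = W + eta * ze ^+ 2 by rewrite /W /M; ring.
exact: (absorb_error I0_gt0 eta0 z0 W0 sgL (erefl y) B4 B5).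
Qed.

(** A function of energy above [I0] satisfies the bound trivially; the others are
    competitors. *)
Theorem energy_lower eta : 0 < eta -> exists2 d : R, 0 < d & forall g z,
  hol_pdisc g -> nopole g -> g 0 = coef g 0 -> g z = 1 -> 0 < cmod z < d ->
  (((I0^-1 + (I1^-1 + eta) * cmod z ^+ 2)^-1)%:E <= energy p b g)%E.
Proof.
move=> eta0; have e2 : 0 < eta / 2 by rewrite divr_gt0.
have [d d0 H] := competitor_lower e2; exists d => // g z hg ng g0 gz zd.
have [EI|/ltW IE] := leP (energy p b g) I0%:E.
  have : competitor p b g by [].
  have e2E : 2 * (eta / 2) = eta by field.
  by move=> /H/(_ gz zd); rewrite e2E.
apply: le_trans IE; rewrite lee_fin -[X in _ <= X]invrK lef_pV2 ?posrE ?invr_gt0//.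
  by rewrite lerDl mulr_ge0 ?sqr_ge0// addr_ge0 ?invr_ge0// ltW.
by rewrite ltr_pwDl ?invr_gt0// mulr_ge0 ?sqr_ge0// addr_ge0 ?invr_ge0// ltW.
Qed.

Lemma test_product_le (X D Q h ze : R) : 0 <= X -> 0 <= D -> 0 <= Q -> 0 <= h -> 0 < ze <= 1 ->
  ze * (D + (X + D) * X + Q) <= h ->
  (1 + X * ze ^+ 2 + D * ze ^+ 3) * (1 + (X - h) * ze ^+ 2) <= 1 + 2 * X * ze ^+ 2 - Q * ze ^+ 4.
Proof.
move=> X0 D0 Q0 h0 /andP[z0 z1] zB.
have z2 : 0 <= ze ^+ 2 by exact: sqr_ge0.
have z3 : 0 <= ze ^+ 3 by rewrite exprn_ge0// ltW.
have z43 : ze ^+ 4 <= ze ^+ 3 by rewrite (exprS ze 3) ler_piMl.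
have z53 : ze ^+ 5 <= ze ^+ 3 by rewrite (exprD ze 2 3) ler_piMl// exprn_ile1// ltW.
have e1 : ze * (D + (X + D) * X + Q) * ze ^+ 2 <= h * ze ^+ 2 by rewrite ler_wpM2r.
have e2 : X * X * ze ^+ 4 <= X * X * ze ^+ 3 by rewrite ler_wpM2l// mulr_ge0.
have e3 : X * D * ze ^+ 5 <= X * D * ze ^+ 3 by rewrite ler_wpM2l// mulr_ge0.
have e4 : Q * ze ^+ 4 <= Q * ze ^+ 3 by rewrite ler_wpM2l.
have e5 : 0 <= h * X * ze ^+ 4 by apply: mulr_ge0 (mulr_ge0 h0 X0) _; rewrite exprn_ge0// ltW.
have e6 : 0 <= h * D * ze ^+ 5 by apply: mulr_ge0 (mulr_ge0 h0 D0) _; rewrite exprn_ge0// ltW.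
rewrite -subr_ge0; have -> : 1 + 2 * X * ze ^+ 2 - Q * ze ^+ 4 -
    (1 + X * ze ^+ 2 + D * ze ^+ 3) * (1 + (X - h) * ze ^+ 2) =
    (h * ze ^+ 2 - ze * (D + (X + D) * X + Q) * ze ^+ 2) + (X * X * ze ^+ 3 - X * X * ze ^+ 4) +
    (X * D * ze ^+ 3 - X * D * ze ^+ 5) + (Q * ze ^+ 3 - Q * ze ^+ 4) + h * X * ze ^+ 4 + h * D * ze ^+ 5.
  by ring.
apply: addr_ge0 e6; apply: addr_ge0 e5.
by do 3?[apply: addr_ge0; last by rewrite subr_ge0]; rewrite subr_ge0.
Qed.

(** The function [(1 + a w) / (1 + a z)] with [a = s conj z], where [s] is to leading
    order the ratio of [u] to [|z|] in the equality case of [quad_opt]. *)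
Theorem energy_test eta : 0 < eta -> exists2 d : R, 0 < d & forall z, 0 < cmod z < d ->
  0 < I0^-1 + (I1^-1 - eta) * cmod z ^+ 2 /\
  exists g, [/\ forall w, cdiff g w, g z = 1 &
    (energy p b g <= ((I0^-1 + (I1^-1 - eta) * cmod z ^+ 2)^-1)%:E)%E].
Proof.
move=> eta0.
have nI0 : I0 != 0 by rewrite gt_eqF.
have nI1 : I1 != 0 by rewrite gt_eqF.
have np : p != 0 by rewrite gt_eqF.
have [C C0 HC] := powR_quad p.
have Q0 := qconst_ge0 p.
(* p s |z| ^ 2 is then twice the relative increase (I0 / I1) |z| ^ 2 of the integral *)
pose s := 2 * I0 / (p * I1).
have s0 : 0 < s by apply: divr_gt0; exact: mulr_gt0.
pose X := I0 / I1; have X0 : 0 < X by rewrite divr_gt0.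
pose D := qconst p * s ^+ 3 * I1 / I0.
have D0 : 0 <= D.
  by rewrite divr_ge0 ?(ltW I0_gt0)// mulr_ge0 ?(ltW I1_gt0)// mulr_ge0// exprn_ge0// ltW.
pose Bd := D + (X + D) * X + C * s ^+ 2.
have Bd0 : 0 <= Bd.
  apply: addr_ge0 (mulr_ge0 C0 (sqr_ge0 _)); apply: addr_ge0 => //.
  by rewrite mulr_ge0 ?addr_ge0// ltW.
have etaI : 0 < eta * I0 by rewrite mulr_gt0.
pose d := Num.min 2^-1 (Num.min (4^-1 / s) (Num.min (2^-1 / (eta * I0)) (eta * I0 / (Bd + 1)))).
have B1 : 0 < Bd + 1 by lra.
have d0 : 0 < d.
  have h2 : 0 < (2^-1 : R) by rewrite invr_gt0.
  have h4 : 0 < (4^-1 : R) by rewrite invr_gt0.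
  by rewrite !lt_min h2 (divr_gt0 h4 s0) (divr_gt0 h2 etaI) (divr_gt0 etaI B1).
exists d => // z /andP[z0 zd]; set ze := cmod z in z0 zd *.
have {}zd := ltW zd.
have zd1 : ze <= 2^-1 by apply: le_trans zd _; rewrite ge_min lexx.
have zd2 : ze * s <= 4^-1 by rewrite -ler_pdivlMr//; apply: le_trans zd _; rewrite !ge_min lexx orbT.
have zd3 : ze * (eta * I0) <= 2^-1.
  by rewrite -ler_pdivlMr//; apply: le_trans zd _; rewrite !ge_min lexx !orbT.
have zd4 : ze * (Bd + 1) <= eta * I0.
  by rewrite -ler_pdivlMr//; apply: le_trans zd _; rewrite !ge_min lexx !orbT.
have zz : ze ^+ 2 <= ze by rewrite expr2 ler_piMl ?(ltW z0)//; lra.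
have zz0 : 0 < ze ^+ 2 by rewrite exprn_gt0.
set Z := I0^-1 + _.
have ZE : Z * I0 = 1 + (X - eta * I0) * ze ^+ 2 by rewrite /Z /X; field; rewrite nI0 nI1.
have Z0 : 0 < Z.
  rewrite -(pmulr_lgt0 _ I0_gt0) ZE mulrBl.
  have : 0 <= X * ze ^+ 2 by rewrite mulr_ge0// ltW.
  have : eta * I0 * ze ^+ 2 <= eta * I0 * ze by rewrite ler_pM2l.
  lra.
split => //.
pose a : R[i] := Complex s 0 * conjc z.
have ca : cmod a = s * ze.
  rewrite cmodM cmod_real (gtr0_norm s0); congr (_ * _).
  by rewrite /ze; case: (z) => x y; rewrite /= sqrrN.
have az : a * z = Complex (s * ze ^+ 2) 0.
  rewrite /ze cmod_sqr /a; case: (z) => x y /=; congr Complex; ring.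
pose y := s * ze ^+ 2.
have y0 : 0 <= y by rewrite mulr_ge0// ltW.
have y1 : y <= 3 / 4.
  have : s * ze ^+ 2 <= s * ze by rewrite ler_pM2l.
  rewrite /y; lra.
have az1 : 1 + a * z = Complex (1 + y) 0 by rewrite az; congr Complex; rewrite /= addr0.
have cz : cmod (1 + a * z) = 1 + y by rewrite az1 cmod_real ger0_norm// addr_ge0.
have n1 : 1 + a * z != 0 by rewrite -cmod_gt0 cz; lra.
exists (fun w => (1 + a * z)^-1 * (1 + a * w)); split; last 1 first.
- have mA := @cmset_annulus R 0 1.
  have m1 : cmfun (annulus 0 1) (fun w => cpow b w * cmod (1 + a * w) `^ p).
    apply: cmfunM; first exact: cmfun_cpow.
    apply: cmfun_powR; have := @cmfun_horner R (annulus 0 1) (1 + a *: 'X) mA.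
    by congr cmfun; apply/funext => w; rewrite hornerD hornerC hornerZ hornerX.
  have e0 w : annulus 0 1 w -> 0 <= cpow b w * cmod (1 + a * w) `^ p.
    by move=> _; rewrite mulr_ge0 ?cpow_ge0 ?powR_ge0.
  have c0 : 0 <= (1 + y)^-1 `^ p by exact: powR_ge0.
  have -> : energy p b (fun w => (1 + a * z)^-1 * (1 + a * w)) =
      (((1 + y)^-1 `^ p)%:E * aint (annulus 0 1) (fun w => cpow b w * cmod (1 + a * w) `^ p)%R)%E.
    rewrite -(aintZ mA m1 e0 c0); apply: eq_aint => w _.
    by rewrite cmodM cmodV cz powRM ?cmod_ge0 ?invr_ge0 ?addr_ge0//; ring.
  have a4 : cmod a <= 4^-1 by rewrite ca; lra.
  have := lin_quad_upper p b2 a4; rewrite -/I0 -/I1 ca => H.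
  apply: le_trans (lee_wpmul2l _ H) _; first by rewrite lee_fin.
  rewrite -EFinM lee_fin.
  have y10 : 0 < 1 + y by rewrite ltr_wpDr.
  have P0 : 0 < (1 + y) `^ p by exact: powR_gt0.
  have cP : (1 + y)^-1 `^ p * (1 + y) `^ p = 1.
    by rewrite -powRM ?invr_ge0 ?(ltW y10)// mulVf ?gt_eqF// pow1R.
  rewrite -[X in _ <= X]mul1r ler_pdivlMr// -[X in X <= _]mulrA -[X in _ <= X]cP; apply: ler_wpM2l => //.
  have := HC y; rewrite ger0_norm// => /(_ y1); rewrite ler_norml => /andP[h1 _].
  have -> : (I0 + (p ^+ 2 / 4 + qconst p * (s * ze)) * (s * ze) ^+ 2 * I1) * Z =
      (1 + X * ze ^+ 2 + D * ze ^+ 3) * (1 + (X - eta * I0) * ze ^+ 2).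
    by rewrite -ZE /X /D /s; field; rewrite nI0 nI1 np.
  have py : p * y = 2 * X * ze ^+ 2 by rewrite /y /X /s; field; rewrite nI1 np.
  have yC : C * y ^+ 2 = C * s ^+ 2 * ze ^+ 4 by rewrite /y; ring.
  have Q1 : 0 <= C * s ^+ 2 by exact: mulr_ge0 C0 (sqr_ge0 _).
  have z01 : 0 < ze <= 1 by rewrite z0; move: zd1; clear - p0 b2 b0 I0_gt0 I1_gt0; lra.
  have zB : ze * (D + (X + D) * X + C * s ^+ 2) <= eta * I0.
    by apply: le_trans zd4; rewrite ler_pM2l// lerDl.
  have h2 := test_product_le (ltW X0) D0 Q1 (ltW etaI) z01 zB.
  by move: h1 h2; rewrite py yC; clear - p0 b2 b0 I0_gt0 I1_gt0; lra.
- by move=> w; apply: cdiffM; [exact: cdiff_cst|apply: cdiffD; [exact: cdiff_cst|apply: cdiffM; [exact: cdiff_cst|exact: cdiff_id]]].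
- by rewrite mulVf.
Qed.

End bounds.

(** * The kernel of the punctured disc *)

Section kernel.
Variable R : realType.
Implicit Types (x y r s t q e eta : R) (w z v : R[i]) (f g : R[i] -> R[i]) (F : R[i] -> R).

Lemma cdiff_near f g z r : 0 < r -> (forall w, cmod (w - z) < r -> f w = g w) -> cdiff g z -> cdiff f z.
Proof.
move=> r0 fg [l H]; exists l => e e0; have [d d0 hd] := H e e0.
exists (Num.min r d); first by rewrite lt_min r0.
move=> w; rewrite lt_min => /andP[h1 h2]; rewrite !fg//; first exact: hd.
by rewrite subrr cmod0.
Qed.

Lemma cdiff_pdisc f g : (forall w, pdisc w -> f w = g w) -> hol_pdisc g -> hol_pdisc f.
Proof.
move=> fg hg w w1; have [r r0 hr] := copen_pdisc w1.
by apply: (cdiff_near r0 _ (hg w w1)) => v /hr/fg.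
Qed.

Lemma circ_pdisc x : pdisc (circ 2^-1 x).
Proof. by rewrite /pdisc /mkset cmod_circ ?half01// invr_ge0. Qed.

Lemma coef_pdisc f g n : (forall w, pdisc w -> f w = g w) -> coef f n = coef g n.
Proof. by move=> fg; congr cmean; apply/funext => x; rewrite fg//; exact: circ_pdisc. Qed.

Lemma nopole_pdisc f g : (forall w, pdisc w -> f w = g w) -> nopole g -> nopole f.
Proof.
move=> fg ng m m0; rewrite -(ng m m0); congr cmean.
by apply/funext => x; rewrite fg//; exact: circ_pdisc.
Qed.

Lemma nopoleZ c f : hol_pdisc f -> nopole f -> nopole (fun w => c * f w).
Proof.
move=> hf nf m m0; have := cmeanZ c (hol_ccurveM hf (@hol_pdiscX R m) (half01 R)).
by rewrite nf// mulr0 => E; rewrite -[RHS]E; congr cmean; apply/funext => x; rewrite mulrA.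
Qed.

Variables (p : R) (k : nat).
Hypotheses (p0 : 0 < p) (k0 : (0 < k)%N) (pk2 : p * k%:R < 2) (pk1 : 2 <= p * k.+1%:R).

Let al := p * k%:R.
Let al0 : 0 < al. Proof. by rewrite mulr_gt0// ltr0n. Qed.

(** On the punctured disc the two integrands differ by the factor [|z| ^ (- al)], and at 0
    the weight [cpow (- al)] takes the value 0. *)
Lemma energyE f g z : z != 0 -> hol_pdisc f -> (forall w, pdisc w -> g w = z^-1 ^+ k * (w ^+ k * f w)) ->
  hol_pdisc g -> (energy p (- al) g = (cmod z `^ (- al))%:E * aint pdisc (fun w => cmod (f w) `^ p)%R)%E.
Proof.
move=> z0 hf gE hg; pose F w := cpow (- al) w * cmod (g w) `^ p.
have mF : cmfun (annulus 0 1) F.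
  by apply: cmfunM; [apply: cmfun_cpow; exact: cmset_annulus|apply: cmfun_powR; exact: cmfun_annulus].
have AE : annulus 0 1 = pdisc `|` [set 0] :> set R[i].
  apply/seteqP; split => w; rewrite /annulus /pdisc /= cmod_ge0/=.
    by move=> w1; have [->|w0] := eqVneq w 0; [right|left; rewrite cmod_gt0 w0].
  by case=> [/andP[]//|->]; rewrite cmod0.
have m0 : cmset [set 0 : R[i]].
  have := @cmset_cmod R [set 0] (measurable_set1 0); congr cmset.
  apply/seteqP; split => w /=; last by move=> ->; rewrite cmod0.
  by move/eqP; rewrite cmod_eq0 => /eqP.
have -> : energy p (- al) g = aint pdisc F.
  rewrite /energy -/F AE aintU -?AE//.
  - rewrite [X in (_ + X)%E](_ : _ = 0)%E ?adde0//.
    rewrite /aint integral0_eq// => xy xy0; congr EFin; rewrite /F.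
    have -> : Complex xy.1 xy.2 = 0 :> R[i] by exact: xy0.
    by rewrite /cpow cmod0 powR0 ?mul0r// oppr_eq0 gt_eqF.
  - exact: cmset_pdisc.
  - by move=> w _; rewrite /F mulr_ge0 ?cpow_ge0 ?powR_ge0.
  - by move=> w /andP[w0 _] w00; move: w0; rewrite w00 cmod0 ltxx.
have mf : cmfun pdisc (fun w => cmod (f w) `^ p).
  by apply: cmfun_powR; apply: cdiff_cmfun; [exact: copen_pdisc|move=> w; exact: hf].
rewrite -(aintZ (@cmset_pdisc R) mf (fun _ _ => powR_ge0 _ _) (powR_ge0 _ _)).
apply: eq_aint => w w1; have cz : 0 < cmod z by rewrite cmod_gt0.
have /andP[cw _] := w1.
have e1 : cmod (z^-1 ^+ k) `^ p = cmod z `^ (- al).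
  rewrite exprVn cmodV cmodX -powR_mulrn ?cmod_ge0// -powR_inv1 ?powR_ge0// -!powRrM.
  by congr (_ `^ _); rewrite /al; ring.
have e2 : cmod (w ^+ k) `^ p = cmod w `^ al.
  by rewrite cmodX -powR_mulrn ?cmod_ge0// -powRrM mulrC.
rewrite /F (gE _ w1) !cmodM !powRM ?mulr_ge0 ?cmod_ge0// e1 e2 /cpow mulrCA; congr (_ * _).
by rewrite mulrA -powRD ?addNr ?powRr0 ?mul1r// (gt_eqF cw) implybT.
Qed.

Let I0 : R := disc_moment (- al) 1.
Let I1 : R := disc_moment (- al + 2) 1.

(** [g w = (w / z) ^ k f w] extends over 0 by [pole_order], and [energy_lower] applies to
    it. *)
Lemma norm_lower eta : 0 < eta -> exists2 d : R, 0 < d & forall z f,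
  0 < cmod z < d -> hol_pdisc f -> (aint pdisc (fun w => cmod (f w) `^ p)%R < +oo)%E -> f z = 1 ->
  cmod z `^ al * (I0^-1 + (I1^-1 + eta) * cmod z ^+ 2)^-1 <= fine (aint pdisc (fun w => cmod (f w) `^ p)).
Proof.
move=> eta0; have b2 : - 2 < - al by rewrite ltrN2.
have b0 : - al <= 0 by rewrite oppr_le0 ltW.
have [d d0 H] := energy_lower p0 b2 b0 eta0.
exists d => // z f zd hf ffin fz.
have z0 : z != 0 by rewrite -cmod_gt0; case/andP: zd.
pose G w := z^-1 ^+ k * (w ^+ k * f w).
have hwf : hol_pdisc (fun w => w ^+ k * f w) by exact: hol_pdiscM (@hol_pdiscX R k) hf.
have hG : hol_pdisc G by exact: hol_pdiscZ.
have nG : nopole G := nopoleZ _ hwf (pole_order p0 pk1 hf ffin).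
(* the removable singularity is filled in with the limit value *)
pose g w := if w == 0 then coef G 0 else G w.
have gG w : pdisc w -> g w = G w by move=> /andP[w0 _]; rewrite /g -cmod_eq0 gt_eqF.
have hg := cdiff_pdisc gG hG.
have g0 : g 0 = coef g 0 by rewrite /g eqxx; apply/esym/coef_pdisc.
have gz : g z = 1.
  by rewrite /g (negPf z0) /G fz mulr1 exprVn mulVf// expf_neq0.
have := H g z hg (nopole_pdisc gG nG) g0 gz zd.
rewrite (energyE z0 hf gG hg) -[aint pdisc _]fineK; last first.
  by rewrite ge0_fin_numE//; apply: aint_ge0 => w _; exact: powR_ge0.
have cz : 0 < cmod z by case/andP: zd.
rewrite -EFinM lee_fin -/I0 -/I1 powRN ler_pdivlMl ?powR_gt0//.
Qed.

Lemma norm_upper eta : 0 < eta -> exists2 d : R, 0 < d & forall z, 0 < cmod z < d ->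
  0 < I0^-1 + (I1^-1 - eta) * cmod z ^+ 2 /\ exists f, [/\ hol_pdisc f,
    (aint pdisc (fun w => cmod (f w) `^ p)%R < +oo)%E, f z = 1 &
  fine (aint pdisc (fun w => cmod (f w) `^ p)) <= cmod z `^ al * (I0^-1 + (I1^-1 - eta) * cmod z ^+ 2)^-1].
Proof.
move=> eta0; have b2 : - 2 < - al by rewrite ltrN2.
have b0 : - al <= 0 by rewrite oppr_le0 ltW.
have [d d0 H] := energy_test p0 b2 eta0.
exists d => // z zd; have [V0 [g [cg gz Eg]]] := H z zd; split => //.
have cz : 0 < cmod z by case/andP: zd.
have z0 : z != 0 by rewrite -cmod_gt0.
have hg : hol_pdisc g by move=> w _; exact: cg.
pose f w := z ^+ k * (w^-1 ^+ k * g w).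
have hf : hol_pdisc f by apply: hol_pdiscZ; exact: hol_pdiscM (@hol_pdiscV R k) hg.
have gf w : pdisc w -> g w = z^-1 ^+ k * (w ^+ k * f w).
  move=> /andP[w0 _]; have w00 : w != 0 by rewrite -cmod_gt0.
  by rewrite /f !exprVn (mulrCA (w ^+ k)) mulKf ?expf_neq0// mulVKf ?expf_neq0.
have A0 : (0 <= aint pdisc (fun w => cmod (f w) `^ p)%R)%E by apply: aint_ge0 => w _; exact: powR_ge0.
move: Eg; rewrite (energyE z0 hf gf hg) -/I0 -/I1 => Eg.
have zN : 0 < cmod z `^ (- al) by exact: powR_gt0.
have fin : (aint pdisc (fun w => cmod (f w) `^ p)%R < +oo)%E.
  rewrite ltey; apply/eqP => E; move: Eg; rewrite E gt0_muley ?lte_fin//.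
exists f; split => //; first by rewrite /f gz mulr1 exprVn mulfV// expf_neq0.
move: Eg; rewrite -[aint pdisc _]fineK ?ge0_fin_numE// -EFinM lee_fin.
by rewrite powRN ler_pdivrMl ?powR_gt0.
Qed.

Lemma int_powp_aint f : int_powp p (@punctured_disc R) f = aint pdisc (fun w => cmod (f w) `^ p).
Proof. by []. Qed.

Lemma hol_punctured f : holomorphic_on (@punctured_disc R) f <-> hol_pdisc f.
Proof. by split=> hf w w1; apply/derivable_cdiff; exact: hf. Qed.

(** The infimum of the norms lies between the bounds of [norm_lower] and [norm_upper]
    raised to the power [1 / p]. *)
Theorem kernel_asymp eta : 0 < eta -> exists2 d : R, 0 < d & forall z, 0 < cmod z < d ->
  `|bergman_kernel p (@punctured_disc R) z - (I0^-1 / cmod z `^ al + I1^-1 * cmod z `^ (2 - al))|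
    <= eta * cmod z `^ (2 - al).
Proof.
move=> eta0; have [d1 d10 lo] := norm_lower eta0; have [d2 d20 up] := norm_upper eta0.
have I00 : 0 < I0 by apply: disc_moment_gt0; rewrite // ltrN2.
have I10 : 0 < I1 by apply: disc_moment_gt0 => //; have := pk2; rewrite -/al; lra.
exists (Num.min d1 d2); first by rewrite lt_min d10.
move=> z; rewrite lt_min => /andP[z0 /andP[zd1 zd2]].
have {}lo f := lo z f (introT andP (conj z0 zd1)).
have [V0 [f0 [hf0 ffin0 f0z f0E]]] := up z (introT andP (conj z0 zd2)).
set V := I0^-1 + _ in V0 f0E.
rewrite /bergman_kernel; set S := (X in inf X).
set ze := cmod z in z0 zd1 zd2 lo V V0 f0E *.
pose W := I0^-1 + (I1^-1 + eta) * ze ^+ 2.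
have W0 : 0 < W by rewrite ltr_pwDl ?invr_gt0// mulr_ge0 ?sqr_ge0// addr_ge0 ?invr_ge0// ltW.
have za : 0 < ze `^ al by exact: powR_gt0.
pose m := (ze `^ al * W^-1) `^ p^-1; pose M := (ze `^ al * V^-1) `^ p^-1.
have m0 : 0 < m by rewrite powR_gt0// mulr_gt0// invr_gt0.
have pV : 0 <= p^-1 by rewrite invr_ge0 ltW.
have lbS : lbound S m.
  move=> _ [f [[/hol_punctured hf ffin] fz] <-]; rewrite /bergman_norm int_powp_aint.
  apply: ge0_ler_powR => //; rewrite ?nnegrE.
  - by rewrite mulr_ge0 ?(ltW za)// invr_ge0 ltW.
  - by apply: fine_ge0; apply: aint_ge0 => w _; exact: powR_ge0.
  - exact: lo.
have S0 : S (bergman_norm p (@punctured_disc R) f0).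
  by exists f0 => //; split=> //; split=> //; exact/hol_punctured.
have infm : m <= inf S by apply: lb_le_inf => //; exists (bergman_norm p (@punctured_disc R) f0).
have infM : inf S <= M.
  apply: le_trans (_ : bergman_norm p (@punctured_disc R) f0 <= M).
    by apply: ge_inf => //; exists m.
  rewrite /bergman_norm int_powp_aint; apply: ge0_ler_powR => //; rewrite ?nnegrE.
  - by apply: fine_ge0; apply: aint_ge0 => w _; exact: powR_ge0.
  - by rewrite mulr_ge0 ?(ltW za)// invr_ge0 ltW.
have inf0 : 0 < inf S by exact: lt_le_trans infm.
have M0 : 0 < M by exact: lt_le_trans infM.
have decr x y : 0 < x -> x <= y -> y `^ (- p) <= x `^ (- p).
  move=> x0 xy; have y0 : 0 < y by exact: lt_le_trans xy.
  rewrite !powRN lef_pV2 ?posrE ?powR_gt0//.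
  by apply: ge0_ler_powR; rewrite ?nnegrE ?(ltW p0) ?(ltW x0) ?(ltW y0).
have key U : 0 < U -> (ze `^ al * U^-1) `^ p^-1 `^ (- p) = U / ze `^ al.
  move=> U0; rewrite -powRrM mulrN mulVf ?gt_eqF// powR_inv1; last by rewrite mulr_ge0 ?(ltW za)// invr_ge0 ltW.
  by rewrite invfM invrK mulrC.
have h1 := decr _ _ m0 infm; have h2 := decr _ _ inf0 infM.
rewrite /m key// in h1; rewrite /M key// in h2.
have E2 : ze ^+ 2 / ze `^ al = ze `^ (2 - al).
  rewrite -powR_mulrn ?(ltW z0)// -powRN -powRD//.
  by rewrite (gt_eqF z0) implybT.
have EW : W / ze `^ al = I0^-1 / ze `^ al + (I1^-1 + eta) * ze `^ (2 - al) by rewrite /W mulrDl -mulrA E2.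
have EV : V / ze `^ al = I0^-1 / ze `^ al + (I1^-1 - eta) * ze `^ (2 - al) by rewrite /V mulrDl -mulrA E2.
rewrite EW in h1; rewrite EV in h2.
rewrite ler_norml; apply/andP; split; [move: h2|move: h1]; clear - p0 k0 pk2 pk1; lra.
Qed.

End kernel.

Theorem proposition10p1 (R : realType) (p : R) (hp0 : 0 < p) (hp2 : p < 2)
    (k : nat) (hk : is_max [set j : nat | (0 < j)%N /\ j%:R < 2 / p] k) :
  (fun z : CC R => bergman_kernel p (@punctured_disc R) z) =
    (fun z : CC R =>
       (2 - p * k%:R) / (2 * pi * (cmod z `^ (p * k%:R)))
       + (4 - p * k%:R) / (2 * pi) * (cmod z `^ (2 - p * k%:R)))
    +o_ ((0 : CC R)^') (fun z : CC R => cmod z `^ (2 - p * k%:R)).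
Proof.
have [[k0 kp] kmax] := hk.
have pk2 : p * k%:R < 2 by rewrite mulrC -ltr_pdivlMr.
have pk1 : 2 <= p * k.+1%:R.
  rewrite leNgt mulrC -ltr_pdivlMr//; apply/negP => h.
  by have := kmax k.+1 (conj isT h); rewrite ltnn.
apply/eqaddoP => eta eta0.
have [d d0 H] := kernel_asymp hp0 k0 pk2 pk1 eta0.
rewrite /dnbhs /within /=; apply/nbhs_ballP.
exists (Complex d 0); first by rewrite /= ltcE /= eqxx.
move=> z; rewrite /ball /= sub0r normrN => zd zn0.
have z0 : 0 < cmod z by rewrite cmod_gt0.
have zd' : 0 < cmod z < d by rewrite z0 -cmod_lt_norm.
have := H z zd'; rewrite [X in _ -> _ <= _ * X]ger0_norm ?powR_ge0//.
have -> : (disc_moment (- (p * k%:R)) 1)^-1 = (2 - p * k%:R) / (2 * pi) :> R.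
  by rewrite /disc_moment pow1R mulr1 invfM invrK mulrC.
have -> : (disc_moment (- (p * k%:R) + 2) 1)^-1 = (4 - p * k%:R) / (2 * pi) :> R.
  by rewrite /disc_moment pow1R mulr1 invfM invrK mulrC; congr (_ / _); ring.
by rewrite -mulrA -invfM.
Qed.
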